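(* Let $c$ be an arbitrary but fixed constant. Then every instance of $\textsc{PL}^{+}_{\leq}$ with $q=c$ can be solved in polynomial time.
   Context: Let $V$ be a finite set and $\mathcal{F}=\{f_v:2^{V\setminus\{v\}}\to\mathbb{N}_0 : v\in V\}$. For a digraph $D=(V,A)$ let $P_D(v)=\{u:uv\in A\}$ and $\texttt{score}(D)=\sum_v f_v(P_D(v))$. In the additive representation, $f_v(Q)=\sum_{x\in Q}f_v(\{x\})$ for all $v$, $Q\subseteq V\setminus\{v\}$, and $\mathcal{F}$ is given by the values $f_v(\{x\})$. A polytree is a digraph whose underlying undirected graph is a forest. $\textsc{PL}^{+}_{\leq}$: given $V$, $\mathcal{F}$ in the additive representation and integers $\ell,q$, decide whether there is a polytree $D$ on $V$ with every in-degree at most $q$ and $\texttt{score}(D)\geq\ell$. *)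

(* Defs.v *)
From HB Require Import structures.
From mathcomp Require Import all_boot all_order all_algebra.

Set Implicit Arguments.
Unset Strict Implicit.
Unset Printing Implicit Defensive.

Import Order.TTheory GRing.Theory Num.Theory.

(* Deterministic multi-tape Turing machines over the input alphabet [Sigma].  *)
(* A tape symbol is [None] (blank), [Some (inl a)] with [a] an input symbol,  *)
(* or [Some (inr b)] with [b] one of the machine's own work symbols.          *)

Inductive move := MoveLeft | Stay | MoveRight.

Definition symbol (Sigma Work : finType) : finType := option (Sigma + Work).

(* There are [tm_tapes.+1] tapes, and tape [ord0] holds the input.            *)
Record turing_machine (Sigma : finType) := TuringMachine {
  tm_state  : finType;
  tm_work   : finType;
  tm_tapes  : nat;
  tm_start  : tm_state;
  tm_halt   : pred tm_state;
  tm_accept : pred tm_state;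
  tm_trans  : tm_state -> {ffun 'I_tm_tapes.+1 -> symbol Sigma tm_work} ->
              tm_state * ('I_tm_tapes.+1 -> symbol Sigma tm_work * move)
}.

(* A two-way infinite tape: [tape_left] and [tape_right] list the cells on    *)
(* either side of the head, nearest first; unlisted cells are blank.          *)
Record tape (A : Type) := Tape {
  tape_left  : seq (option A);
  tape_cur   : option A;
  tape_right : seq (option A)
}.

Definition tape_write (A : Type) (a : option A) (t : tape A) : tape A :=
  Tape (tape_left t) a (tape_right t).

Definition tape_move (A : Type) (m : move) (t : tape A) : tape A :=
  let: Tape l a r := t in
  match m with
  | MoveLeft  => Tape (behead l) (head None l) (a :: r)
  | Stay      => t
  | MoveRight => Tape (a :: l) (head None r) (behead r)
  end.

Definition blank_tape (A : Type) : tape A := Tape [::] None [::].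

Definition input_tape (Sigma Work : finType) (w : seq Sigma) :
    tape (Sigma + Work) :=
  let s := [seq Some (inl a) | a <- w] in Tape [::] (head None s) (behead s).

Record config (Sigma : finType) (M : turing_machine Sigma) := Config {
  cfg_state : tm_state M;
  cfg_tape  : 'I_(tm_tapes M).+1 -> tape (Sigma + tm_work M)
}.

Definition tm_init (Sigma : finType) (M : turing_machine Sigma)
    (w : seq Sigma) : config M :=
  Config (tm_start M)
    (fun i => if i == ord0 then input_tape (tm_work M) w
              else blank_tape (Sigma + tm_work M)).

Definition tm_step (Sigma : finType) (M : turing_machine Sigma)
    (C : config M) : config M :=
  if tm_halt (cfg_state C) then C else
  let: (s, act) :=
    tm_trans (cfg_state C) [ffun i => tape_cur (cfg_tape C i)] in
  Config s
    (fun i => tape_move (act i).2 (tape_write (act i).1 (cfg_tape C i))).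

Definition tm_run (Sigma : finType) (M : turing_machine Sigma)
    (t : nat) (w : seq Sigma) : config M :=
  iter t (@tm_step Sigma M) (tm_init M w).

(* A decision problem consists of instances [x] with [inst x], each with a    *)
(* string encoding [enc x]; its yes-instances are those with [yes x].         *)
Definition solvable_in_polynomial_time (Sigma : finType) (X : Type)
    (enc : X -> seq Sigma) (inst yes : X -> Prop) : Prop :=
  exists (M : turing_machine Sigma) (p : {poly nat}),
    forall x : X, inst x ->
      exists t : nat,
        [/\ t <= (p.[size (enc x)])%R,
            tm_halt (cfg_state (tm_run M t (enc x)))
          & tm_accept (cfg_state (tm_run M t (enc x))) <-> yes x].

(* A digraph on [V] is given by its set of arcs; [(u, v)] is the arc uv.      *)

Definition parents (V : finType) (A : {set V * V}) (v : V) : {set V} :=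
  [set u | (u, v) \in A].

Definition score (V : finType) (f : V -> {set V} -> nat)
    (A : {set V * V}) : nat :=
  \sum_(v : V) f v (parents A v).

Definition underlying (V : finType) (A : {set V * V}) : rel V :=
  fun u v => ((u, v) \in A) || ((v, u) \in A).

Definition acyclic_graph (V : finType) (e : rel V) : Prop :=
  forall s : seq V, 2 < size s -> ~ ucycle e s.

(* The first conjunct excludes loops (take [u = v]) and pairs of opposite     *)
(* arcs, i.e., the underlying cycles of length 1 and 2.                       *)
Definition polytree (V : finType) (A : {set V * V}) : Prop :=
  (forall u v : V, (u, v) \in A -> (v, u) \notin A) /\
  acyclic_graph (underlying A).

(* [f v] is only meaningful on subsets of V \ {v}; its other values are       *)
(* constrained, encoded and (for loopless digraphs) scored nowhere.           *)
Definition additive_scores (V : finType) (f : V -> {set V} -> nat) : Prop :=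
  forall (v : V) (Q : {set V}), v \notin Q ->
    f v Q = \sum_(x in Q) f v [set x].

Record PL_instance := PLInstance {
  pl_V : finType;
  pl_f : pl_V -> {set pl_V} -> nat;
  pl_l : int;
  pl_q : int;
  pl_additive : additive_scores pl_f
}.

Definition PL_yes (I : PL_instance) : Prop :=
  exists A : {set pl_V I * pl_V I},
    [/\ polytree A,
        forall v : pl_V I, (#|parents A v|%:Z <= pl_q I)%R
      & (pl_l I <= (score (@pl_f I) A)%:Z)%R].

(* Binary digits, least significant first; [binary 0 = [:: false]].           *)
Definition binary (n : nat) : seq bool :=
  mkseq (fun i => odd (n %/ 2 ^ i)) (trunc_log 2 n).+1.

Definition binary_int (z : int) : seq bool := (z < 0)%R :: binary `|z|%N.

Definition PL_words (I : PL_instance) : seq (seq bool) :=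
  [:: binary_int (pl_l I), binary_int (pl_q I), binary #|pl_V I|
    & [seq binary (pl_f v [set x])
      | v <- enum (pl_V I), x <- [seq y <- enum (pl_V I) | y != v]]].

(* Over the alphabet {0, 1, #} = [option bool], each word is ended by # = None. *)
Definition PL_encode (I : PL_instance) : seq (option bool) :=
  flatten [seq rcons (map Some w) None | w <- PL_words I].

(* Main.v *)
Require Import Defs.
From HB Require Import structures.
From mathcomp Require Import all_boot all_order all_algebra.
From mathcomp Require Import zify.
From Stdlib Require Import FunctionalExtensionality.

Set Implicit Arguments.
Unset Strict Implicit.
Unset Printing Implicit Defensive.

(* For [c <= 0] only the empty digraph matters.  For [q = c >= 1] every        *)
(* polytree extends to a spanning one, and a best spanning polytree is a       *)
(* maximum-weight common basis of a graphic and a partition matroid.  It is    *)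
(* found by a primal-dual method.  Prices [y] on the vertices give the arc     *)
(* [uv] the reduced weight [f_v({u}) - y_v]; one keeps a spanning tree of      *)
(* maximum reduced weight, with [y_v] above its minimum only where the         *)
(* in-degree is at least [q].  If some in-degree exceeds [q], either tight     *)
(* exchanges lead from such a vertex to one of in-degree below [q], and the    *)
(* first exchange of a shortest such path is made, or the prices of all        *)
(* vertices from which no such path starts are raised by the least slack.      *)
(*   The tree is stored with its fundamental cuts, as vectors over F_2, so     *)
(* that an exchange is a pivot and a forest is a set of arcs with a dual       *)
(* family of cuts.                                                             *)
(*   For the running time, functions on (unary) numbers, bits, pairs and lists *)
(* computed in polynomial time by a stack program are shown to be closed under *)
(* composition and under iteration with polynomially bounded results; a stack  *)
(* is a tape whose head is on the top of the stack.                            *)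

(** * Stack programs *)

(** By additivity the score is a sum of arc weights, so for [q >= 1] the task is to find a heaviest
    set of arcs that is a forest and has in-degrees at most [q]: a weighted intersection of two
    matroids.

    Optimality is certified by weak duality in [run_max]. Shift the prices to [z >= 0] with value
    [0] at the vertices of in-degree below [q]. A spanning tree that is optimal for the weights
    [weight f - z (hd f)] beats every forest for these weights ([forest_weight_le]); they are
    non-negative on the tree because some vertex has price [0]. What remains is the sum over [v] of
    [z v] times the in-degree of [v]. For a feasible forest the in-degree is at most [q], and for
    the tree it is at least [q] wherever [z v > 0]. So a tree that satisfies [invariant] and has no
    in-degree above [q] is best possible.

    Such a tree is reached because every [step] makes progress ([step_progress]). It lowers
    [excess], or else it does not increase [excess] and lowers the potential of [near]: an exchange
    brings a candidate one level closer to the deficient vertices ([exchange_candidate]), and a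
    price change enlarges the set of vertices that lead to them ([raise_level]). Hence a number of
    steps quadratic in [n] suffices ([run_finished]). Prices gain at most two bits in a step and cut
    vectors have length [n], so all sizes stay polynomial ([step_bounded], [poly_run]).

    Polytrees are exactly the arc sets with a dual family of cuts ([polytree_cut_independent],
    [cut_independent_polytree]). This turns the statements on items into [run_score_max] and
    [run_score_attained], and gives [decide_correct]. Finally [poly_solvable] turns a function
    satisfying [poly] into a Turing machine. *)

Definition letter : Type := option bool.
Definition store := nat -> seq letter.

Definition upd (s : store) (r : nat) (x : seq letter) : store :=
  fun i => if i == r then x else s i.

Inductive cmd :=
  | Push of nat & letter
  | Pop of nat
  | Seq of cmd & cmd
  | If of nat & pred (option letter) & cmd & cmd
  | While of nat & pred (option letter) & cmd.

Inductive exec : cmd -> store -> store -> nat -> Prop :=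
  | ExecPush r a s : exec (Push r a) s (upd s r (a :: s r)) 1
  | ExecPop r s : exec (Pop r) s (upd s r (behead (s r))) 1
  | ExecSeq c1 c2 s1 s2 s3 t1 t2 :
      exec c1 s1 s2 t1 -> exec c2 s2 s3 t2 -> exec (Seq c1 c2) s1 s3 (t1 + t2)
  | ExecIfT r (p : pred (option letter)) c1 c2 s s' t :
      p (ohead (s r)) -> exec c1 s s' t -> exec (If r p c1 c2) s s' t.+1
  | ExecIfF r (p : pred (option letter)) c1 c2 s s' t :
      ~~ p (ohead (s r)) -> exec c2 s s' t -> exec (If r p c1 c2) s s' t.+1
  | ExecWhileT r (p : pred (option letter)) c s1 s2 s3 t1 t2 :
      p (ohead (s1 r)) -> exec c s1 s2 t1 -> exec (While r p c) s2 s3 t2 ->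
      exec (While r p c) s1 s3 (t1 + t2).+1
  | ExecWhileF r (p : pred (option letter)) c s :
      ~~ p (ohead (s r)) -> exec (While r p c) s s 1.

(** A unit of time pushes at most one letter. In [computes_size] this bounds results by running
    times. *)
Lemma exec_size c s s' t : exec c s s' t -> forall r, size (s' r) <= size (s r) + t.
Proof.
elim=> {c s s' t}.
- by move=> r a s i; rewrite /upd; case: eqP => [->|_] /=; lia.
- by move=> r s i; rewrite /upd; case: eqP => [->|_]; rewrite ?size_behead; lia.
- by move=> c1 c2 s1 s2 s3 t1 t2 _ h1 _ h2 i; have := h1 i; have := h2 i; lia.
- by move=> r p c1 c2 s s' t _ _ h i; have := h i; lia.
- by move=> r p c1 c2 s s' t _ _ h i; have := h i; lia.
- by move=> r p c s1 s2 s3 t1 t2 _ _ h1 _ h2 i; have := h1 i; have := h2 i; lia.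
- by move=> r p c s _ i; lia.
Qed.

Fixpoint regs (c : cmd) : nat :=
  match c with
  | Push r _ | Pop r => r
  | Seq c1 c2 => maxn (regs c1) (regs c2)
  | If r _ c1 c2 => maxn r (maxn (regs c1) (regs c2))
  | While r _ c => maxn r (regs c)
  end.

(** * Compilation of stack programs to Turing machines *)

Definition tsym : finType := symbol (option bool) void.

Definition letter_of (x : tsym) : option letter :=
  if x is Some (inl a) then Some a else None.

(* [Jump r p l] falls through when the top of stack [r] satisfies [p] and     *)
(* jumps to [l] otherwise.                                                    *)
Inductive instr :=
  | Act of nat & (tsym -> tsym * move)
  | Jump of nat & pred (option letter) & nat.

Definition goto (l : nat) : instr := Jump 0 pred0 l.

Fixpoint compile (c : cmd) (off : nat) : seq instr :=
  match c with
  | Push r a => [:: Act r (fun x => (x, MoveLeft));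
                    Act r (fun _ => (Some (inl a), Stay))]
  | Pop r => [:: Act r (fun _ => (None, MoveRight))]
  | Seq c1 c2 => let k1 := compile c1 off in k1 ++ compile c2 (off + size k1)
  | If r p c1 c2 =>
      let k1 := compile c1 off.+1 in
      let off2 := off + (size k1).+2 in
      let k2 := compile c2 off2 in
      Jump r p off2 :: k1 ++ goto (off2 + size k2) :: k2
  | While r p c =>
      let k := compile c off.+1 in
      Jump r p (off + (size k).+2) :: k ++ [:: goto off]
  end.

(** A tape may list blanks explicitly, so any number of them is allowed to the left of the head and
    below the stack. *)
Definition stack_tape (T : tape (option bool + void)) (w : seq letter) : Prop :=
  (exists k, tape_left T = nseq k None) /\
  (exists m, tape_cur T :: tape_right T =
             [seq Some (inl a) | a <- w] ++ nseq m None).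

Lemma stack_tape_cur T w : stack_tape T w -> letter_of (tape_cur T) = ohead w.
Proof.
case=> _ [m]; case: w => [|a w] /=; last by case=> ->.
by case: m => [|m] //= [-> _].
Qed.

Lemma stack_tape_pop T w : stack_tape T w ->
  stack_tape (tape_move MoveRight (tape_write None T)) (behead w).
Proof.
case: T => l x r [[k /= ->] [m hm]]; split; first by exists k.+1.
case: w hm => [|a w] /=.
  by case: m => [|m] //= [_ ->]; exists m.-1.+1; case: m.
case=> _ ->; case: w => [|b w] /=; last by exists m.
by exists m.-1.+1; case: m.
Qed.

Lemma stack_tape_push T w a : stack_tape T w ->
  stack_tape (tape_move Stay (tape_write (Some (inl a))
    (tape_move MoveLeft (tape_write (tape_cur T) T)))) (a :: w).
Proof.
case: T => l x r [[k /= ->] [m /= ->]]; split; last by exists m.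
by exists k.-1; case: k.
Qed.

Section Machine.
Variables (prog : seq instr) (K : nat) (acc : nat).

(** The states are program counters. Those from [size prog] on halt, which leaves room for separate
    accepting and rejecting exits. *)
Definition machine : turing_machine (option bool) :=
  @TuringMachine (option bool) 'I_(size prog).+3 void K ord0
    (fun q => size prog <= q) (fun q => q == acc :> nat)
    (fun q read =>
      match nth (goto 0) prog q with
      | Act r g => (inord q.+1,
          fun i : 'I_K.+1 => if val i == r then g (read i) else (read i, Stay))
      | Jump r p l =>
          (inord (if p (letter_of (read (inord r))) then q.+1 else l),
           fun i => (read i, Stay))
      end).

Definition represents (C : config machine) (pc : nat) (s : store) : Prop :=
  cfg_state C = pc :> nat /\ forall i, stack_tape (cfg_tape C i) (s i).

Definition code_at (off : nat) (l : seq instr) : Prop :=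
  exists pre post, prog = pre ++ l ++ post /\ size pre = off.

Lemma code_at_catl off l1 l2 : code_at off (l1 ++ l2) -> code_at off l1.
Proof. by move=> [a [b [h <-]]]; exists a, (l2 ++ b); rewrite h !catA. Qed.

Lemma code_at_catr off l1 l2 : code_at off (l1 ++ l2) -> code_at (off + size l1) l2.
Proof.
by move=> [a [b [h <-]]]; exists (a ++ l1), b; rewrite h !catA size_cat.
Qed.

Lemma code_at_cons off i l : code_at off (i :: l) ->
  [/\ off < size prog, nth (goto 0) prog off = i & code_at off.+1 l].
Proof.
move=> h; split.
- by case: h => [a [b [-> <-]]]; rewrite !size_cat /=; lia.
- by case: h => [a [b [-> <-]]]; rewrite nth_cat ltnn subnn.
- by have := @code_at_catr off [:: i] l h; rewrite addn1.
Qed.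

Lemma step_jump C pc s r p l :
  represents C pc s -> pc < size prog -> nth (goto 0) prog pc = Jump r p l ->
  r <= K -> l <= (size prog).+1 ->
  represents (tm_step C) (if p (ohead (s r)) then pc.+1 else l) s.
Proof.
move=> [hpc hs] lt_pc hj le_r le_l; rewrite /tm_step /= leqNgt hpc lt_pc /= hj.
split=> /=; last by move=> i; rewrite ffunE; have := hs i; case: (cfg_tape C i).
rewrite ffunE (stack_tape_cur (hs _)) inordK ?ltnS // inordK //.
by case: ifP => _; lia.
Qed.

Lemma step_act (C : config machine) pc r g :
  cfg_state C = pc :> nat -> pc < size prog -> nth (goto 0) prog pc = Act r g ->
  cfg_state (tm_step C) = pc.+1 :> nat /\
  forall i, cfg_tape (tm_step C) i =
    if val i == r then
      let: (x, m) := g (tape_cur (cfg_tape C i)) in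
      tape_move m (tape_write x (cfg_tape C i))
    else cfg_tape C i.
Proof.
move=> hpc lt_pc hj; rewrite /tm_step /= leqNgt hpc lt_pc /= hj.
split=> /=; first by rewrite inordK //; lia.
move=> i; rewrite ffunE; case: ifP => _; first by case: (g _).
by case: (cfg_tape C i).
Qed.

(** The factor [2] pays for the two instructions of a push, and for the test and the closing [goto]
    of a branch or a round of a loop. *)
Lemma compile_correct c s s' t : exec c s s' t ->
  forall off C, code_at off (compile c off) -> regs c <= K ->
    represents C off s ->
    exists n C', [/\ n <= 2 * t, iter n (@tm_step _ machine) C = C'
      & represents C' (off + size (compile c off)) s'].
Proof.
elim=> {c s s' t}.
- move=> r a s off C /= hc _ [hpc hs].
  have [lt1 h1 /code_at_cons[lt2 h2 _]] := code_at_cons hc.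
  have [q1 t1] := step_act hpc lt1 h1.
  have [q2 t2] := step_act q1 lt2 h2.
  exists 2, (tm_step (tm_step C)); split=> //; split; first by rewrite q2; lia.
  move=> i; rewrite t2 t1 /upd /=; case: eqP => // <-.
  exact: stack_tape_push.
- move=> r s off C /= hc _ [hpc hs].
  have [lt1 h1 _] := code_at_cons hc.
  have [q1 t1] := step_act hpc lt1 h1.
  exists 1, (tm_step C); split=> //; split; first by rewrite q1; lia.
  by move=> i; rewrite t1 /upd /=; case: eqP => // <-; apply: stack_tape_pop.
- move=> c1 c2 s1 s2 s3 t1 t2 _ ih1 _ ih2 off C /= hc hK hC.
  have [|n1 [C1 [le1 r1 h1]]] := ih1 _ _ (code_at_catl hc) _ hC; first by lia.
  have [|n2 [C2 [le2 r2 h2]]] := ih2 _ _ (code_at_catr hc) _ h1; first by lia.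
  exists (n2 + n1), C2; rewrite iterD r1 r2 size_cat addnA; split=> //; lia.
- move=> r p c1 c2 s s' t hp _ ih off C /= hc hK hC.
  have szp : off + (size (compile (If r p c1 c2) off)) <= size prog.
    by case: hc => a [b [-> <-]]; rewrite !size_cat /=; lia.
  rewrite /= size_cat /= in szp.
  have [lt0 h0 hc1] := code_at_cons hc.
  have := step_jump hC lt0 h0; rewrite hp => /(_ _ _) hC1.
  have [|||n1 [C1 [le1 r1 h1]]] := ih _ _ (code_at_catl hc1) _ (hC1 _ _); try lia.
  have [lt2 h2 _] := code_at_cons (code_at_catr hc1).
  rewrite addSn in h1 lt2 h2.
  have hC2 := step_jump h1 _ h2 _ _.
  exists n1.+2, (tm_step C1); split; first by lia.
    by rewrite iterS iterSr r1.
  rewrite /= in hC2.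
  have -> : off + (size (compile c1 off.+1 ++
     goto (off + (size (compile c1 off.+1)).+2 +
           size (compile c2 (off + (size (compile c1 off.+1)).+2)))
        :: compile c2 (off + (size (compile c1 off.+1)).+2))).+1 =
    off + (size (compile c1 off.+1)).+2 + size (compile c2 (off + (size (compile c1 off.+1)).+2)).
    by rewrite size_cat /=; lia.
  by apply: hC2; lia.
- move=> r p c1 c2 s s' t hp _ ih off C /= hc hK hC.
  have szp : off + (size (compile (If r p c1 c2) off)) <= size prog.
    by case: hc => a [b [-> <-]]; rewrite !size_cat /=; lia.
  rewrite /= size_cat /= in szp.
  have [lt0 h0 hc1] := code_at_cons hc.
  have := step_jump hC lt0 h0; rewrite (negbTE hp) => /(_ _ _) hC1.
  have [_ _] := code_at_cons (code_at_catr hc1).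
  rewrite addSn -!addnS => hc2.
  have [|||n1 [C1 [le1 r1 h1]]] := ih _ _ hc2 _ (hC1 _ _); try lia.
  exists n1.+1, C1; split; first by lia.
    by rewrite iterSr.
  by move: h1; congr represents; rewrite size_cat /=; lia.
- move=> r p c s1 s2 s3 t1 t2 hp _ ih1 _ ih2 off C /= hc hK hC.
  have szp : off + (size (compile (While r p c) off)) <= size prog.
    by case: hc => a [b [-> <-]]; rewrite !size_cat /=; lia.
  rewrite /= size_cat /= in szp.
  have [lt0 h0 hc1] := code_at_cons hc.
  have := step_jump hC lt0 h0; rewrite hp => /(_ _ _) hC1.
  have [|||n1 [C1 [le1 r1 h1]]] := ih1 _ _ (code_at_catl hc1) _ (hC1 _ _); try lia.
  have [lt2 h2 _] := code_at_cons (code_at_catr hc1).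
  have le_off : off <= (size prog).+1 by lia.
  have hC2 := step_jump h1 lt2 h2 (leq0n _) le_off.
  have [n2 [C2 [le2 r2 hC3]]] := ih2 _ _ hc hK hC2.
  exists (n2 + (n1.+2)), C2; split=> //; first by lia.
  by rewrite iterD iterS iterSr r1.
- move=> r p c s hp off C /= hc hK hC.
  have szp : off + (size (compile (While r p c) off)) <= size prog.
    by case: hc => a [b [-> <-]]; rewrite !size_cat /=; lia.
  rewrite /= size_cat /= in szp.
  have [lt0 h0 hc1] := code_at_cons hc.
  have := step_jump hC lt0 h0; rewrite (negbTE hp) => /(_ _ _) hC1.
  exists 1, (tm_step C); split=> //.
  have -> : off + (size (compile c off.+1 ++ [:: goto off])).+1 =
    off + (size (compile c off.+1)).+2 by rewrite size_cat /=; lia.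
  by apply: hC1; lia.
Qed.

End Machine.

Definition input_store (w : seq letter) : store := upd (fun=> [::]) 0 w.

Lemma machine_of_cmd (c : cmd) : exists M : turing_machine (option bool),
  forall w s t, exec c (input_store w) s t -> exists n,
    [/\ n <= 2 * t + 1, tm_halt (cfg_state (tm_run M n w)) &
        tm_accept (cfg_state (tm_run M n w)) = (ohead (s 0) == Some (Some true))].
Proof.
pose k := compile c 0.
(* The last jump falls through to the accepting state [(size k).+1] if the top of stack [0] is
   [Some true], and otherwise jumps to the rejecting state [(size k).+2]. *)
pose prog := k ++ [:: Jump 0 (pred1 (Some (Some true))) (size k).+2].
exists (machine prog (regs c) (size k).+1) => w s t he.
have ca : code_at prog 0 (k ++ [:: Jump 0 (pred1 (Some (Some true))) (size k).+2]).
  by exists [::], [::]; rewrite cats0.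
have h0 : represents (tm_init (machine prog (regs c) (size k).+1) w) 0 (input_store w).
  split=> // i; rewrite /= /input_store /upd -val_eqE /=.
  case: eqP => _; last by split; [exists 0 | exists 1].
  split; first by exists 0.
  by rewrite /input_tape; case: w {he} => [|a w] /=; [exists 1 | exists 0; rewrite cats0].
have [|n [C [len hn hC]]] := compile_correct he (code_at_catl ca) _ h0; first by [].
have [lt1 h1 _] := code_at_cons (code_at_catr ca).
have szp : size prog = (size k).+1 by rewrite size_cat addn1.
have [hq _] := step_jump hC lt1 h1 isT (leq_trans (leqnn _) (eq_leq (esym (congr1 S szp)))).
exists n.+1; rewrite /tm_run iterS hn; split; first by lia.
- by rewrite /= hq szp; case: ifP.
- by rewrite /= hq /= add0n -/k; case: (ohead _ == _); rewrite ?eqxx // gtn_eqF.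
Qed.

(** * Polynomial bounds *)

(** As the base is at least [2], constants and sums are absorbed by a larger exponent, and no
    coefficients are needed. *)
Definition polybound (g : nat -> nat) : Prop :=
  exists k, forall n, g n <= (n + 2) ^ k.

Lemma leq_add2_expn n k l : k <= l -> (n + 2) ^ k <= (n + 2) ^ l.
Proof. by move=> le_kl; rewrite leq_exp2l //; lia. Qed.

Lemma polybound_le f g : (forall n, f n <= g n) -> polybound g -> polybound f.
Proof. by move=> h [k hk]; exists k => n; apply: leq_trans (hk n). Qed.

Lemma polybound_const c : polybound (fun=> c).
Proof.
exists c => n; apply: (@leq_trans (2 ^ c)); first exact: ltnW (ltn_expl _ _).
by case: c => // c; rewrite leq_exp2r //; lia.
Qed.

Lemma polybound_id : polybound (fun n => n).
Proof. by exists 1 => n; rewrite expn1; lia. Qed.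

Lemma polybound_mul f g : polybound f -> polybound g -> polybound (fun n => f n * g n).
Proof. by move=> [k hk] [l hl]; exists (k + l) => n; rewrite expnD leq_mul. Qed.

Lemma polybound_add f g : polybound f -> polybound g -> polybound (fun n => f n + g n).
Proof.
move=> [k hk] [l hl]; exists (k + l).+1 => n.
have h1 : f n <= (n + 2) ^ (k + l) by rewrite (leq_trans (hk n)) // leq_add2_expn //; lia.
have h2 : g n <= (n + 2) ^ (k + l) by rewrite (leq_trans (hl n)) // leq_add2_expn //; lia.
by rewrite expnS; apply: (@leq_trans (2 * (n + 2) ^ (k + l))); [lia | rewrite leq_mul2r; lia].
Qed.

Lemma polybound_max f g : polybound f -> polybound g -> polybound (fun n => maxn (f n) (g n)).
Proof.
by move=> hf hg; apply: polybound_le (polybound_add hf hg) => n; lia.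
Qed.

Lemma polybound_exp f k : polybound f -> polybound (fun n => f n ^ k).
Proof. by move=> [l hl]; exists (l * k) => n; rewrite expnM; case: k => // k; rewrite leq_exp2r. Qed.

(** * Programs on binary trees *)

Definition runs (c : cmd) (s s' : store) (T : nat) : Prop :=
  exists2 t, t <= T & exec c s s' t.

Lemma runs_le c s s' T T' : T <= T' -> runs c s s' T -> runs c s s' T'.
Proof. by move=> h [t ht e]; exists t => //; apply: leq_trans h. Qed.

Lemma runs_seq c1 c2 s1 s2 s3 T1 T2 :
  runs c1 s1 s2 T1 -> runs c2 s2 s3 T2 -> runs (Seq c1 c2) s1 s3 (T1 + T2).
Proof. by move=> [t1 h1 e1] [t2 h2 e2]; exists (t1 + t2); [lia | exact: ExecSeq e1 e2]. Qed.

Lemma runs_if r (p : pred (option letter)) c1 c2 s s' T :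
  runs (if p (ohead (s r)) then c1 else c2) s s' T -> runs (If r p c1 c2) s s' T.+1.
Proof.
move=> [t ht e]; exists t.+1; first by lia.
by case: ifPn e => hp e; [exact: ExecIfT | exact: ExecIfF].
Qed.

Lemma runs_while r (p : pred (option letter)) c s1 s2 s3 T1 T2 :
  p (ohead (s1 r)) -> runs c s1 s2 T1 -> runs (While r p c) s2 s3 T2 ->
  runs (While r p c) s1 s3 (T1 + T2).+1.
Proof.
move=> hp [t1 h1 e1] [t2 h2 e2]; exists (t1 + t2).+1; first by lia.
exact: ExecWhileT e1 e2.
Qed.

Lemma runs_while_stop r (p : pred (option letter)) c s :
  ~~ p (ohead (s r)) -> runs (While r p c) s s 1.
Proof. by move=> h; exists 1 => //; exact: ExecWhileF. Qed.

(* The registers from [b] on hold [l]; those below [b] belong to the caller. *)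
Definition frame (b : nat) (s : store) (l : seq (seq letter)) : store :=
  fun i => if i < b then s i else nth [::] l (i - b).

Lemma frame_get b s l j : frame b s l (j + b) = nth [::] l j.
Proof. by rewrite /frame ltnNge leq_addl addnK. Qed.

Lemma frame_upd b s l j v : upd (frame b s l) (j + b) v = frame b s (set_nth [::] l j v).
Proof.
apply: functional_extensionality => i; rewrite /upd /frame nth_set_nth /=.
have [->|ne] := eqVneq i (j + b); first by rewrite ltnNge leq_addl addnK eqxx.
case: ltnP => // le_bi; case: eqP => // e.
by case/eqP: ne; lia.
Qed.

Lemma runs_push b s l j a :
  runs (Push (j + b) a) (frame b s l) (frame b s (set_nth [::] l j (a :: nth [::] l j))) 1.
Proof.
by exists 1 => //; have := ExecPush (j + b) a (frame b s l); rewrite frame_get frame_upd.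
Qed.

Lemma runs_pop b s l j :
  runs (Pop (j + b)) (frame b s l) (frame b s (set_nth [::] l j (behead (nth [::] l j)))) 1.
Proof.
by exists 1 => //; have := ExecPop (j + b) (frame b s l); rewrite frame_get frame_upd.
Qed.

Definition push_top (r1 r2 : nat) : cmd :=
  If r1 (pred1 (Some (Some true))) (Push r2 (Some true))
    (If r1 (pred1 (Some (Some false))) (Push r2 (Some false)) (Push r2 None)).

Lemma runs_push_top b s l i j a x : nth [::] l i = a :: x ->
  runs (push_top (i + b) (j + b)) (frame b s l)
    (frame b s (set_nth [::] l j (a :: nth [::] l j))) 3.
Proof.
move=> h; apply: (@runs_le _ _ _ (1.+2)) => //.
apply: runs_if; rewrite frame_get h /=.
case: a h => [[]|] h /=.
- by apply: (@runs_le _ _ _ 1) => //; exact: runs_push.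
- by apply: runs_if; rewrite frame_get h /=; exact: runs_push.
- by apply: runs_if; rewrite frame_get h /=; exact: runs_push.
Qed.

Definition transfer (r1 r2 : nat) : cmd :=
  While r1 isSome (Seq (push_top r1 r2) (Pop r1)).

Definition duplicate (r1 r2 r3 : nat) : cmd :=
  While r1 isSome (Seq (push_top r1 r2) (Seq (push_top r1 r3) (Pop r1))).

Definition clear (r : nat) : cmd := While r isSome (Pop r).

Lemma set_nth_id (l : seq (seq letter)) j v :
  nth [::] l j = v -> j < size l -> set_nth [::] l j v = l.
Proof.
move=> <- h; apply: (@eq_from_nth _ [::]); first by rewrite size_set_nth; lia.
by move=> i _; rewrite nth_set_nth /=; case: eqP => [->|].
Qed.

Lemma runs_transfer b s l i j : i != j -> i < size l -> j < size l ->
  runs (transfer (i + b) (j + b)) (frame b s l)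
    (frame b s (set_nth [::] (set_nth [::] l i [::]) j (rev (nth [::] l i) ++ nth [::] l j)))
    (5 * size (nth [::] l i) + 1).
Proof.
move=> ne_ij li lj; move ex: (nth _ l i) => x.
elim: x l li lj ex => [|a x ih] l li lj ex.
  have <- : l = set_nth [::] (set_nth [::] l i [::]) j (rev [::] ++ nth [::] l j).
    by rewrite (set_nth_id ex) // set_nth_id.
  by apply: runs_while_stop; rewrite frame_get ex.
pose l' := set_nth [::] (set_nth [::] l j (a :: nth [::] l j)) i x.
have sz : size l' = size l by rewrite !size_set_nth; lia.
apply: (@runs_le _ _ _ (3 + 1 + (5 * size x + 1)).+1); first by rewrite /=; lia.
apply: (@runs_while _ _ _ _ (frame b s l')); first by rewrite frame_get ex.
  apply: runs_seq; first by apply: runs_push_top ex.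
  have := @runs_pop b s (set_nth [::] l j (a :: nth [::] l j)) i.
  by rewrite nth_set_nth /= (negbTE ne_ij) ex.
have e' : nth [::] l' i = x by rewrite nth_set_nth /= eqxx.
have := ih l' _ _ e'; rewrite sz => /(_ li lj).
congr (runs _ _ (frame b s _) _).
have -> : nth [::] l' j = a :: nth [::] l j.
  by rewrite nth_set_nth /= eq_sym (negbTE ne_ij) nth_set_nth /= eqxx.
rewrite rev_cons cat_rcons /l'.
apply: (@eq_from_nth _ [::]); first by rewrite !size_set_nth; lia.
move=> m _; do 6! rewrite ?nth_set_nth /=.
by do ! case: eqP => //.
Qed.

Lemma runs_duplicate b s l i j k : i != j -> i != k -> j != k ->
  i < size l -> j < size l -> k < size l ->
  runs (duplicate (i + b) (j + b) (k + b)) (frame b s l)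
    (frame b s (set_nth [::] (set_nth [::] (set_nth [::] l i [::]) j
       (rev (nth [::] l i) ++ nth [::] l j)) k (rev (nth [::] l i) ++ nth [::] l k)))
    (8 * size (nth [::] l i) + 1).
Proof.
move=> ne_ij ne_ik ne_jk li lj lk; move ex: (nth _ l i) => x.
elim: x l li lj lk ex => [|a x ih] l li lj lk ex.
  have <- : l = set_nth [::] (set_nth [::] (set_nth [::] l i [::]) j
      (rev [::] ++ nth [::] l j)) k (rev [::] ++ nth [::] l k).
    by rewrite (set_nth_id ex) // !set_nth_id.
  by apply: runs_while_stop; rewrite frame_get ex.
pose l1 := set_nth [::] l j (a :: nth [::] l j).
pose l2 := set_nth [::] l1 k (a :: nth [::] l k).
pose l' := set_nth [::] l2 i x.
have sz : size l' = size l by rewrite !size_set_nth; lia.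
apply: (@runs_le _ _ _ (3 + (3 + 1) + (8 * size x + 1)).+1); first by rewrite /=; lia.
apply: (@runs_while _ _ _ _ (frame b s l')); first by rewrite frame_get ex.
  apply: runs_seq; first by apply: runs_push_top ex.
  have e1 : nth [::] l1 i = a :: x by rewrite nth_set_nth /= (negbTE ne_ij).
  have e2 : nth [::] l1 k = nth [::] l k by rewrite nth_set_nth /= eq_sym (negbTE ne_jk).
  apply: runs_seq; first by apply: runs_push_top e1.
  rewrite e2; have := @runs_pop b s l2 i.
  by rewrite {2}/l2 nth_set_nth /= (negbTE ne_ik) e1.
have e' : nth [::] l' i = x by rewrite nth_set_nth /= eqxx.
have := ih l' _ _ _ e'; rewrite sz => /(_ li lj lk).
congr (runs _ _ (frame b s _) _).
have -> : nth [::] l' j = a :: nth [::] l j.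
  rewrite nth_set_nth /= eq_sym (negbTE ne_ij) nth_set_nth /= (negbTE ne_jk).
  by rewrite nth_set_nth /= eqxx.
have -> : nth [::] l' k = a :: nth [::] l k.
  by rewrite nth_set_nth /= eq_sym (negbTE ne_ik) nth_set_nth /= eqxx.
rewrite rev_cons !cat_rcons /l' /l2 /l1.
apply: (@eq_from_nth _ [::]); first by rewrite !size_set_nth; lia.
move=> m _; do 6! rewrite ?nth_set_nth /=.
by do ! case: eqP => //.
Qed.

Lemma runs_clear b s l i : i < size l ->
  runs (clear (i + b)) (frame b s l) (frame b s (set_nth [::] l i [::]))
    (2 * size (nth [::] l i) + 1).
Proof.
move=> li; move ex: (nth _ l i) => x.
elim: x l li ex => [|a x ih] l li ex.
  by rewrite (set_nth_id ex) //; apply: runs_while_stop; rewrite frame_get ex.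
apply: (@runs_le _ _ _ (1 + (2 * size x + 1)).+1); first by rewrite /=; lia.
apply: runs_while; first by rewrite frame_get ex.
  exact: runs_pop.
have := ih (set_nth [::] l i (behead (nth [::] l i))).
rewrite size_set_nth nth_set_nth /= eqxx ex; case/(_ _ erefl); first by lia.
move=> t ht e; exists t => //; move: e; congr (exec _ _ (frame b s _) _).
by rewrite set_set_nth eqxx.
Qed.

Inductive data := Leaf | Node of data & data.

(** Prefix order makes the code self-delimiting: the end of a subtree is found by counting the
    subtrees still open. *)
Fixpoint code (d : data) : seq letter :=
  if d is Node l r then Some true :: code l ++ code r else [:: Some false].

(* Moves the (reversed) code of one tree from [r1] to [r2]; the height of the *)
(* stack [r3] is the number of subtrees that remain to be read.               *)
Definition split_loop (r1 r2 r3 : nat) : cmd :=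
  While r3 isSome
    (Seq (push_top r1 r2)
      (Seq (If r1 (pred1 (Some (Some true))) (Push r3 None) (Pop r3)) (Pop r1))).

Definition split_tree (r1 r2 r3 : nat) : cmd := Seq (Push r3 None) (split_loop r1 r2 r3).

(** This is in continuation form: what happens after the tree has been read is a hypothesis, so that
    the two subtrees of a node can be chained. *)
Lemma runs_split_loop b s d x y z w c s' T :
  runs (split_loop b (2 + b) (3 + b)) (frame b s [:: x; w; rev (code d) ++ y; z]) s' T ->
  runs (split_loop b (2 + b) (3 + b)) (frame b s [:: code d ++ x; w; y; c :: z]) s'
    (7 * size (code d) + T).
Proof.
elim: d x y z c T => [|l ihl r ihr] x y z c T h.
  apply: (@runs_le _ _ _ (3 + (1.+1 + 1) + T).+1) => //.
  apply: runs_while h; first by rewrite (@frame_get b s _ 3).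
  apply: runs_seq; first by apply: (@runs_push_top b s _ 0 2).
  apply: runs_seq.
    by apply: runs_if; rewrite (@frame_get b s _ 0) /=; exact: (@runs_pop b s [:: _; _; _; _] 3).
  exact: (@runs_pop b s [:: _; _; _; _] 0).
have h1 : runs (split_loop b (2 + b) (3 + b))
  (frame b s [:: code l ++ (code r ++ x); w; Some true :: y; None :: c :: z]) s'
    (7 * size (code l) + (7 * size (code r) + T)).
  apply: ihl; apply: ihr; move: h.
  by rewrite /= rev_cons rev_cat -cats1 -!catA.
apply: (@runs_le _ _ _ (3 + (1.+1 + 1) + (7 * size (code l) + (7 * size (code r) + T))).+1).
  by rewrite /= size_cat; lia.
apply: runs_while h1; first by rewrite (@frame_get b s _ 3).
apply: runs_seq; first by apply: (@runs_push_top b s _ 0 2).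
rewrite /= -!catA.
apply: runs_seq.
  by apply: runs_if; rewrite (@frame_get b s _ 0) /=; exact: (@runs_push b s [:: _; _; _; _] 3).
exact: (@runs_pop b s [:: _; _; _; _] 0).
Qed.

Lemma runs_split b s d x y w :
  runs (split_tree b (2 + b) (3 + b)) (frame b s [:: code d ++ x; w; y; [::]])
    (frame b s [:: x; w; rev (code d) ++ y; [::]]) (7 * size (code d) + 2).
Proof.
rewrite (_ : _ + 2 = 1 + (7 * size (code d) + 1)); last by lia.
apply: runs_seq; first exact: (@runs_push b s [:: _; _; _; _] 3).
by apply: runs_split_loop; apply: runs_while_stop; rewrite (@frame_get b s _ 3).
Qed.

(** * Polynomial-time functions *)

Class encodable (A : Type) := enc : A -> data.

Definition esize {A} {eA : encodable A} (a : A) : nat := size (code (enc a)).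

(* A program is given relative to a base register [b], which holds the        *)
(* argument and then the value; the registers above [b] are scratch, empty    *)
(* on entry and on exit, and those below [b] are not touched.                 *)
Definition computes {A B} {eA : encodable A} {eB : encodable B}
    (P : nat -> cmd) (f : A -> B) (k : nat) : Prop :=
  forall a b s, s b = code (enc a) -> (forall i, b < i -> s i = [::]) ->
    runs (P b) s (upd s b (code (enc (f a)))) ((esize a + 2) ^ k).

Definition poly {A B} {eA : encodable A} {eB : encodable B} (f : A -> B) : Prop :=
  exists P k, computes P f k.

Section Closure.
Context {A B C : Type} {eA : encodable A} {eB : encodable B} {eC : encodable C}.

(** Four registers suffice for every program written out below; a subprogram finds its scratch space
    above the register at which it is called. *)
Lemma poly_intro (f : A -> B) (P : nat -> cmd) (g : nat -> nat) :
  polybound g ->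
  (forall a b s, runs (P b) (frame b s [:: code (enc a); [::]; [::]; [::]])
    (frame b s [:: code (enc (f a)); [::]; [::]; [::]]) (g (esize a))) ->
  poly f.
Proof.
move=> [k hk] h; exists P, k => a b s sb s0.
have hf x : upd s b x = frame b s [:: x; [::]; [::]; [::]].
  apply: functional_extensionality => i; rewrite /upd /frame.
  case: (ltngtP i b) => [lt|lt|->]; rewrite ?subnn //.
  have : 0 < i - b by lia.
  by rewrite s0 //; case: (i - b) => [|[|[|[|[|]]]]].
have <- : upd s b (code (enc a)) = s.
  by apply: functional_extensionality => i; rewrite /upd; case: eqP => [->|].
rewrite hf.
have -> : upd (frame b s [:: code (enc a); [::]; [::]; [::]]) b (code (enc (f a))) =
  frame b s [:: code (enc (f a)); [::]; [::]; [::]] by apply: (@frame_upd b s _ 0).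
exact: runs_le (hk _) (h a b s).
Qed.

Lemma runs_call (f : A -> B) P k b s l j a : computes P f k ->
  nth [::] l j = code (enc a) -> (forall i, j < i -> nth [::] l i = [::]) ->
  runs (P (j + b)) (frame b s l) (frame b s (set_nth [::] l j (code (enc (f a)))))
    ((esize a + 2) ^ k).
Proof.
move=> hP hj hl; rewrite -frame_upd; apply: hP; first by rewrite frame_get.
by move=> i hi; rewrite /frame ifN; [apply: hl | ]; lia.
Qed.

Lemma computes_size (f : A -> B) P k a : computes P f k ->
  esize (f a) <= esize a + (esize a + 2) ^ k.
Proof.
move=> h; have [] := h a 0 (upd (fun=> [::]) 0 (code (enc a))) erefl.
  by move=> i; rewrite /upd; case: eqP => // ->.
by move=> t ht /exec_size /(_ 0) h2; apply: leq_trans h2 _; rewrite leq_add2l.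
Qed.

Lemma poly_size (f : A -> B) : poly f ->
  exists2 g, polybound g & forall a, esize (f a) <= g (esize a).
Proof.
move=> [P [k h]]; exists (fun n => n + (n + 2) ^ k); last by move=> a; apply: computes_size h.
by apply: polybound_add; [exact: polybound_id | exists k].
Qed.

(** Only encodings matter, so projections and constructors inherit the programs of the tree
    operations with the same effect. *)
Lemma poly_enc (f : A -> B) (g : A -> C) : (forall a, enc (f a) = enc (g a)) -> poly f -> poly g.
Proof. by move=> h [P [k hP]]; exists P, k => a b s; rewrite -h; apply: hP. Qed.

End Closure.

Lemma runs_skip b s x y z w : runs (Seq (Push (1 + b) None) (Pop (1 + b)))
  (frame b s [:: x; y; z; w]) (frame b s [:: x; y; z; w]) 2.
Proof.
rewrite -[2]/(1 + 1); apply: runs_seq; first exact: (@runs_push b s [:: _; _; _; _] 1).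
exact: (@runs_pop b s [:: _; _; _; _] 1).
Qed.

Ltac pb := repeat first
  [ exact: polybound_id | exact: polybound_const | assumption
  | apply: polybound_add | apply: polybound_mul | apply: polybound_max
  | apply: polybound_exp ].

Section Closure2.
Context {A B C : Type} {eA : encodable A} {eB : encodable B} {eC : encodable C}.

Lemma poly_id : poly (fun a : A => a).
Proof.
apply: (@poly_intro _ _ _ _ _ _ (fun=> 2)); first by pb.
by move=> a b s; apply: runs_skip.
Qed.

Lemma poly_comp (g : B -> C) (f : A -> B) : poly g -> poly f -> poly (fun a => g (f a)).
Proof.
move=> [Q [l hQ]] [P [k hP]].
apply: (@poly_intro _ _ _ _ _ (fun b => Seq (P b) (Q b))
  (fun n => (n + 2) ^ k + (n + (n + 2) ^ k + 2) ^ l)); first by pb.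
move=> a b s; apply: runs_seq.
  by apply: (@runs_call _ _ _ _ f _ _ b s [:: _; _; _; _] 0 a) => // -[|[|[|[|[|i]]]]].
apply: (@runs_le _ _ _ ((esize (f a) + 2) ^ l)).
  have h : esize (f a) <= esize a + (esize a + 2) ^ k by apply: computes_size hP.
  by case: (l) => // l'; rewrite leq_exp2r // leq_add2r.
by apply: (@runs_call _ _ _ _ g _ _ b s [:: _; _; _; _] 0 (f a)) => // -[|[|[|[|[|i]]]]].
Qed.

End Closure2.

Instance enc_data : encodable data := fun d => d.
Instance enc_bool : encodable bool := fun b => if b then Node Leaf Leaf else Leaf.
(* Natural numbers are written in unary; lists of bits serve for binary ones. *)
Instance enc_nat : encodable nat := fun n => iter n (Node Leaf) Leaf.
Instance enc_prod A B (eA : encodable A) (eB : encodable B) : encodable (A * B) :=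
  fun p => Node (enc p.1) (enc p.2).
Instance enc_seq A (eA : encodable A) : encodable (seq A) :=
  foldr (fun x => Node (enc x)) Leaf.
Instance enc_option A (eA : encodable A) : encodable (option A) :=
  fun x => if x is Some a then Node Leaf (enc a) else Leaf.

Definition dcar (d : data) : data := if d is Node l _ then l else Leaf.
Definition dcdr (d : data) : data := if d is Node _ r then r else Leaf.
Definition is_node (d : data) : bool := if d is Node _ _ then true else false.

Definition no_op (b : nat) : cmd := Seq (Push (1 + b) None) (Pop (1 + b)).

Fixpoint push_word (b : nat) (w : seq letter) : cmd :=
  if w is a :: w' then Seq (push_word b w') (Push b a) else no_op b.

Lemma runs_push_word b s w x y :
  runs (push_word b w) (frame b s [:: x; [::]; [::]; y])
    (frame b s [:: w ++ x; [::]; [::]; y]) (size w + 2).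
Proof.
elim: w => [|a w ih] /=; first exact: runs_skip.
rewrite addSn -addn1; apply: runs_seq ih _; exact: (@runs_push b s [:: _; _; _; _] 0).
Qed.

Definition top_is_node (b : nat) := If b (pred1 (Some (Some true))).

Lemma poly_dcar : poly dcar.
Proof.
apply: (@poly_intro _ _ _ _ _ (fun b => top_is_node b
   (Seq (Pop b) (Seq (split_tree b (2 + b) (3 + b)) (Seq (clear b) (transfer (2 + b) b))))
   (no_op b)) (fun n => 14 * n + 10)); first by pb.
move=> [|l r] b s.
  apply: (@runs_le _ _ _ 3) => //; apply: runs_if; rewrite (@frame_get b s _ 0) /=.
  exact: runs_skip.
apply: (@runs_le _ _ _ (1 + ((7 * size (code l) + 2) + ((2 * size (code r) + 1) +
   (5 * size (rev (code l) ++ [::]) + 1)))).+1).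
  by rewrite /esize /= !size_cat /= addn0 size_rev; lia.
apply: runs_if; rewrite (@frame_get b s _ 0) /=.
apply: runs_seq; first exact: (@runs_pop b s [:: _; _; _; _] 0).
apply: runs_seq; first exact: runs_split.
apply: runs_seq; first exact: (@runs_clear b s [:: _; _; _; _] 0).
have := @runs_transfer b s [:: [::]; [::]; rev (code l) ++ [::]; [::]] 2 0 isT isT isT.
by rewrite /= !cats0 revK.
Qed.

Lemma poly_dcdr : poly dcdr.
Proof.
apply: (@poly_intro _ _ _ _ _ (fun b => top_is_node b
   (Seq (Pop b) (Seq (split_tree b (2 + b) (3 + b)) (clear (2 + b))))
   (no_op b)) (fun n => 14 * n + 10)); first by pb.
move=> [|l r] b s.
  apply: (@runs_le _ _ _ 3) => //; apply: runs_if; rewrite (@frame_get b s _ 0) /=.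
  exact: runs_skip.
apply: (@runs_le _ _ _ (1 + ((7 * size (code l) + 2) +
   (2 * size (rev (code l) ++ [::]) + 1))).+1).
  by rewrite /esize /= !size_cat /= addn0 size_rev; lia.
apply: runs_if; rewrite (@frame_get b s _ 0) /=.
apply: runs_seq; first exact: (@runs_pop b s [:: _; _; _; _] 0).
apply: runs_seq; first exact: runs_split.
exact: (@runs_clear b s [:: _; _; _; _] 2).
Qed.

Section Closure3.
Context {A B C : Type} {eA : encodable A} {eB : encodable B} {eC : encodable C}.

Lemma poly_const (c : B) : poly (fun _ : A => c).
Proof.
apply: (@poly_intro _ _ _ _ _ (fun b => Seq (clear b) (push_word b (code (enc c))))
   (fun n => 2 * n + 1 + (size (code (enc c)) + 2))); first by pb.
move=> a b s; apply: runs_seq; first exact: (@runs_clear b s [:: _; _; _; _] 0).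
by have := @runs_push_word b s (code (@enc B eB c)) [::] [::]; rewrite cats0.
Qed.

Definition copy_up (b : nat) : cmd := Seq (transfer b (2 + b)) (duplicate (2 + b) b (1 + b)).

Lemma runs_copy_up b s x : runs (copy_up b) (frame b s [:: x; [::]; [::]; [::]])
  (frame b s [:: x; x; [::]; [::]]) (13 * size x + 2).
Proof.
rewrite (_ : _ + 2 = (5 * size x + 1) + (8 * size (rev x ++ [::]) + 1)); last first.
  by rewrite cats0 size_rev; lia.
apply: runs_seq; first exact: (@runs_transfer b s [:: _; _; _; _] 0 2).
have := @runs_duplicate b s [:: [::]; [::]; rev x ++ [::]; [::]] 2 0 1 isT isT isT isT isT isT.
by rewrite /= !cats0 revK.
Qed.

(** A transfer reverses a stack, so each move takes two. The value of [g] goes to the base first and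
    that of [f] on top of it; one more letter makes this the code of the pair. *)
Lemma poly_pair (f : A -> B) (g : A -> C) : poly f -> poly g -> poly (fun a => (f a, g a)).
Proof.
move=> [P [k hP]] [Q [l hQ]].
apply: (@poly_intro _ _ _ _ _ (fun b => Seq (copy_up b) (Seq (P (1 + b))
   (Seq (transfer b (3 + b)) (Seq (transfer (3 + b) (2 + b)) (Seq (Q (2 + b))
   (Seq (transfer (2 + b) (3 + b)) (Seq (transfer (3 + b) b)
   (Seq (transfer (1 + b) (3 + b)) (Seq (transfer (3 + b) b) (Push b (Some true)))))))))))
   (fun n => (13 * n + 2) + ((n + 2) ^ k + ((5 * n + 1) + ((5 * n + 1) + ((n + 2) ^ l +
      ((5 * (n + (n + 2) ^ l) + 1) + ((5 * (n + (n + 2) ^ l) + 1) +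
      ((5 * (n + (n + 2) ^ k) + 1) + ((5 * (n + (n + 2) ^ k) + 1) + 1))))))))));
  first by pb.
move=> a b s.
have hf : esize (f a) <= esize a + (esize a + 2) ^ k by apply: computes_size hP.
have hg : esize (g a) <= esize a + (esize a + 2) ^ l by apply: computes_size hQ.
apply: runs_seq; first exact: runs_copy_up.
apply: runs_seq.
  by apply: (@runs_call _ _ _ _ f _ _ b s [:: _; _; _; _] 1 a) => // -[|[|[|[|[|i]]]]].
rewrite /=.
apply: runs_seq; first exact: (@runs_transfer b s [:: _; _; _; _] 0 3).
rewrite /= cats0; apply: runs_seq.
  apply: runs_le; last exact: (@runs_transfer b s [:: _; _; _; _] 3 2).
  by rewrite /= size_rev.
rewrite /= cats0 revK; apply: runs_seq.
  by apply: (@runs_call _ _ _ _ g _ _ b s [:: _; _; _; _] 2 a) => // -[|[|[|[|[|i]]]]].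
rewrite /=; apply: runs_seq.
  apply: runs_le; last exact: (@runs_transfer b s [:: _; _; _; _] 2 3).
  by rewrite /= leq_add2r leq_mul2l.
rewrite /= cats0; apply: runs_seq.
  apply: runs_le; last exact: (@runs_transfer b s [:: _; _; _; _] 3 0).
  by rewrite /= size_rev leq_add2r leq_mul2l.
rewrite /= cats0 revK; apply: runs_seq.
  apply: runs_le; last exact: (@runs_transfer b s [:: _; _; _; _] 1 3).
  by rewrite /= leq_add2r leq_mul2l.
rewrite /= cats0; apply: runs_seq.
  apply: runs_le; last exact: (@runs_transfer b s [:: _; _; _; _] 3 0).
  by rewrite /= size_rev leq_add2r leq_mul2l.
rewrite /= revK; exact: (@runs_push b s [:: _; _; _; _] 0).
Qed.

End Closure3.

Section Closure4.
Context {A B : Type} {eA : encodable A} {eB : encodable B}.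

Lemma poly_cond (c : A -> data) (f g : A -> B) : poly c -> poly f -> poly g ->
  poly (fun a => if is_node (c a) then f a else g a).
Proof.
move=> [P [k hP]] [Q [l hQ]] [R [m hR]].
apply: (@poly_intro _ _ _ _ _ (fun b => Seq (copy_up b) (Seq (P (1 + b))
   (top_is_node (1 + b) (Seq (clear (1 + b)) (Q b)) (Seq (clear (1 + b)) (R b)))))
   (fun n => (13 * n + 2) + ((n + 2) ^ k +
     ((2 * (n + (n + 2) ^ k) + 1) + ((n + 2) ^ l + (n + 2) ^ m) + 1)))); first by pb.
move=> a b s.
have hc : esize (c a) <= esize a + (esize a + 2) ^ k by apply: computes_size hP.
apply: runs_seq; first exact: runs_copy_up.
apply: runs_seq.
  by apply: (@runs_call _ _ _ _ c _ _ b s [:: _; _; _; _] 1 a) => // -[|[|[|[|[|i]]]]].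
rewrite /= addn1; apply: runs_if; rewrite (@frame_get b s _ 1) /=.
have hcl : runs (clear (1 + b)) (frame b s [:: code (enc a); code (enc (c a)); [::]; [::]])
    (frame b s [:: code (enc a); [::]; [::]; [::]]) (2 * (esize a + (esize a + 2) ^ k) + 1).
  apply: runs_le; last exact: (@runs_clear b s [:: _; _; _; _] 1).
  by rewrite /= leq_add2r leq_mul2l.
rewrite (_ : ohead (code (enc (c a))) == _ = is_node (c a)); last by case: (c a).
case: (is_node _); apply: runs_seq hcl _.
  apply: (@runs_le _ _ _ ((esize a + 2) ^ l)); first by rewrite leq_addr.
  by apply: (@runs_call _ _ _ _ f _ _ b s [:: _; _; _; _] 0 a) => // -[|[|[|[|[|i]]]]].
apply: (@runs_le _ _ _ ((esize a + 2) ^ m)); first by rewrite leq_addl.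
by apply: (@runs_call _ _ _ _ g _ _ b s [:: _; _; _; _] 0 a) => // -[|[|[|[|[|i]]]]].
Qed.

(** The list in the base register is only a counter: a round strips one element from it and applies
    [P] to the register above. *)
Definition iter_loop (P : nat -> cmd) (b : nat) : cmd :=
  While b (pred1 (Some (Some true)))
    (Seq (Pop b) (Seq (split_tree b (2 + b) (3 + b)) (Seq (clear (2 + b)) (P (1 + b))))).

End Closure4.

Section Iteration.
Context {A B X : Type} {eA : encodable A} {eB : encodable B} {eX : encodable X}.

Lemma runs_iter_loop (h : B -> B) P k (G : nat) (l : seq X) (x : B) b s : computes P h k ->
  (forall i, i < size l -> esize (iter i h x) <= G) ->
  runs (iter_loop P b) (frame b s [:: code (enc l); code (enc x); [::]; [::]])
    (frame b s [:: [:: Some false]; code (enc (iter (size l) h x)); [::]; [::]])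
    (size l * ((G + 2) ^ k + 9 * esize l + 5) + 1).
Proof.
move=> hP; set E := (X in 9 * X); have : esize l <= E by [].
clearbody E; elim: l x => [|y l ih] x hE hG.
  by apply: runs_while_stop; rewrite (@frame_get b s _ 0).
have hE' : esize y + esize l <= E.
  by move: hE; rewrite {1}/esize /= size_cat -/(enc l) /esize; lia.
have hloop := ih (h x); rewrite -iterSr in hloop.
apply: (@runs_le _ _ _ ((1 + ((7 * esize y + 2) + ((2 * size (rev (code (enc y)) ++ [::]) + 1) +
  (esize x + 2) ^ k))) + (size l * ((G + 2) ^ k + 9 * E + 5) + 1)).+1).
  have : (esize x + 2) ^ k <= (G + 2) ^ k.
    by case: (k) => // k'; rewrite leq_exp2r // leq_add2r (hG 0).
  by rewrite /= mulSn cats0 size_rev -/(esize y); lia.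
apply: runs_while; last apply: hloop.
- by rewrite (@frame_get b s _ 0).
- apply: runs_seq; first exact: (@runs_pop b s [:: _; _; _; _] 0).
  apply: runs_seq; first exact: runs_split.
  apply: runs_seq; first exact: (@runs_clear b s [:: _; _; _; _] 2).
  by apply: (@runs_call _ _ _ _ h _ _ b s [:: _; _; _; _] 1 x) => // -[|[|[|[|[|i]]]]].
- by lia.
- by move=> i hi; rewrite -iterSr; apply: hG.
Qed.

Lemma leq_size_esize (l : seq X) : size l <= esize l.
Proof. by elim: l => // x l ih; rewrite /esize /= size_cat -/(enc l) -/(esize l); lia. Qed.

(** The bound [G] on the iterates keeps the time polynomial; a polynomial-time body could otherwise
    square the size in each round. *)
Lemma poly_iter_closed (h : B -> B) (l : A -> seq X) (x : A -> B) (G : nat -> nat) :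
  poly h -> poly l -> poly x -> polybound G ->
  (forall a i, i <= size (l a) -> esize (iter i h (x a)) <= G (esize a)) ->
  poly (fun a => iter (size (l a)) h (x a)).
Proof.
move=> [P [k hP]] pn px bG hG.
have [N bN hN] := poly_size pn.
have [Q [m hQ]] := poly_pair pn px.
apply: (@poly_intro _ _ _ _ _ (fun b => Seq (Q b) (Seq (Pop b)
   (Seq (split_tree b (2 + b) (3 + b))
   (Seq (transfer b (3 + b)) (Seq (transfer (2 + b) b) (Seq (transfer (3 + b) (1 + b))
   (Seq (iter_loop P b) (Seq (Pop b) (Seq (transfer (1 + b) (2 + b)) (transfer (2 + b) b))))))))))
   (fun n => (n + 2) ^ m + (1 + ((7 * N n + 2) + ((5 * G n + 1) + ((5 * N n + 1) +
     ((5 * G n + 1) + ((N n * ((G n + 2) ^ k + 9 * N n + 5) + 1) + (1 + ((5 * G n + 1) +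
     (5 * G n + 1))))))))))); first by pb.
move=> a b s.
have hN' := hN a; rewrite /esize in hN'.
have hG0 := hG a 0 isT; rewrite /esize /= in hG0.
have hGn := hG a (size (l a)) (leqnn _); rewrite /esize /= in hGn.
have hn : size (l a) <= N (esize a) by apply: leq_trans (leq_size_esize _) (hN a).
apply: runs_seq.
  by apply: (@runs_call _ _ _ _ _ _ _ b s [:: _; _; _; _] 0 a hQ) => // -[|[|[|[|[|i]]]]].
rewrite /=; apply: runs_seq; first exact: (@runs_pop b s [:: _; _; _; _] 0).
rewrite /=; apply: runs_seq.
  apply: runs_le; last exact: runs_split.
  by rewrite /= leq_add2r leq_mul2l.
rewrite /= cats0; apply: runs_seq.
  apply: runs_le; last exact: (@runs_transfer b s [:: _; _; _; _] 0 3).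
  by rewrite /= leq_add2r leq_mul2l.
rewrite /= cats0; apply: runs_seq.
  apply: runs_le; last exact: (@runs_transfer b s [:: _; _; _; _] 2 0).
  by rewrite /= size_rev leq_add2r leq_mul2l.
rewrite /= cats0 revK; apply: runs_seq.
  apply: runs_le; last exact: (@runs_transfer b s [:: _; _; _; _] 3 1).
  by rewrite /= size_rev leq_add2r leq_mul2l.
rewrite /= cats0 revK; apply: runs_seq.
  apply: runs_le; last first.
    by apply: (@runs_iter_loop h P k (G (esize a))) => // i hi; apply/hG/ltnW.
  by rewrite leq_add2r leq_mul // !leq_add // leq_mul2l hN'.
apply: runs_seq; first exact: (@runs_pop b s [:: _; _; _; _] 0).
rewrite /=; apply: runs_seq.
  apply: runs_le; last exact: (@runs_transfer b s [:: _; _; _; _] 1 2).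
  by rewrite /= leq_add2r leq_mul2l.
rewrite /= cats0.
apply: runs_le; last first.
  have := @runs_transfer b s
    [:: [::]; [::]; rev (code (@enc B eB (iter (size (l a)) h (x a)))); [::]] 2 0.
  by rewrite /= cats0 revK; apply.
by rewrite /= size_rev leq_add2r leq_mul2l.
Qed.

End Iteration.

(** * Deciding a problem with a polynomial-time function *)

Definition letter_word (a : letter) : seq letter := Some true :: code (enc a).

Definition encode_loop : cmd :=
  While 3 isSome
    (Seq (If 3 (pred1 (Some (Some true))) (push_word 0 (letter_word (Some true)))
           (If 3 (pred1 (Some (Some false))) (push_word 0 (letter_word (Some false)))
              (push_word 0 (letter_word None))))
         (Pop 3)).

(** The raw input becomes the code of a list of letters. The transfer reverses it, so that the
    letters are prepended to the list from the last to the first. *)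
Definition encode_input : cmd :=
  Seq (transfer 0 3) (Seq (Push 0 (Some false)) encode_loop).

Lemma size_letter_word a : size (letter_word a) <= 6.
Proof. by case: a => [[]|]. Qed.

Lemma esize_word (w : seq letter) : esize w <= 6 * size w + 1.
Proof.
elim: w => // a w ih; rewrite /esize /= size_cat -/(enc w) -/(esize w).
by have := size_letter_word a; rewrite /letter_word /=; lia.
Qed.

Lemma runs_push_letter (a : letter) v w s :
  runs (push_word 0 (letter_word a)) (frame 0 s [:: code (enc v); [::]; [::]; w])
    (frame 0 s [:: code (enc (a :: v)); [::]; [::]; w]) 8.
Proof.
apply: runs_le; last exact: runs_push_word.
by have := size_letter_word a; lia.
Qed.

Lemma runs_encode_loop (w v : seq letter) s :
  runs encode_loop (frame 0 s [:: code (enc v); [::]; [::]; w])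
    (frame 0 s [:: code (enc (rev w ++ v)); [::]; [::]; [::]]) (12 * size w + 1).
Proof.
elim: w v => [|a w ih] v; first exact: runs_while_stop.
rewrite rev_cons cat_rcons.
apply: (@runs_le _ _ _ ((8.+2 + 1) + (12 * size w + 1)).+1); first by rewrite /=; lia.
apply: runs_while; [by rewrite (@frame_get 0 s _ 3) | | exact: ih].
apply: (@runs_seq _ _ _ (frame 0 s [:: code (enc (a :: v)); [::]; [::]; a :: w])).
  apply: runs_if; rewrite (@frame_get 0 s _ 3).
  case: a => [[]|].
  - by apply: (@runs_le _ _ _ 8) => //; exact: (runs_push_letter (Some true)).
  - by apply: runs_if; rewrite (@frame_get 0 s _ 3); exact: (runs_push_letter (Some false)).
  - by apply: runs_if; rewrite (@frame_get 0 s _ 3); exact: (runs_push_letter None).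
exact: (@runs_pop 0 s [:: _; _; _; _] 3).
Qed.

Lemma runs_encode_input (w : seq letter) s :
  runs encode_input (frame 0 s [:: w; [::]; [::]; [::]])
    (frame 0 s [:: code (enc w); [::]; [::]; [::]]) (17 * size w + 3).
Proof.
rewrite (_ : _ + 3 = (5 * size w + 1) + (1 + (12 * size w + 1))); last by lia.
apply: runs_seq; first exact: (@runs_transfer 0 s [:: _; _; _; _] 0 3).
apply: runs_seq; first exact: (@runs_push 0 s [:: _; _; _; _] 0).
by have := runs_encode_loop (rev w) [::] s; rewrite /= revK !cats0 size_rev.
Qed.

Lemma polybound_poly g : polybound g -> exists p : {poly nat}, forall n, g n <= (p.[n])%R.
Proof.
move=> [k hk]; exists (('X + (2%N : nat)%:P) ^+ k)%R => n; apply: leq_trans (hk n) _.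
rewrite horner_exp hornerD hornerX hornerC.
by elim: (k) => // m ih; rewrite GRing.exprS expnS leq_mul2l ih orbT.
Qed.

(** The code of a Boolean starts with [Some true] exactly if it is true, and this is what the
    machine of [machine_of_cmd] tests at the end. *)
Theorem poly_solvable (X : Type) (e : X -> seq letter) (inst yes : X -> Prop)
    (f : seq letter -> bool) :
  poly f -> (forall x, inst x -> f (e x) <-> yes x) ->
  solvable_in_polynomial_time e inst yes.
Proof.
move=> [P [k hP]] hf.
have [M hM] := machine_of_cmd (Seq encode_input (P 0)).
have [p hp] : exists p : {poly nat},
    forall n, 2 * ((17 * n + 3) + (6 * n + 1 + 2) ^ k) + 1 <= (p.[n])%R.
  by apply: (@polybound_poly (fun n => 2 * ((17 * n + 3) + (6 * n + 1 + 2) ^ k) + 1)); pb.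
exists M, p => x hx; pose s : store := fun=> [::].
have [t ht he] : runs (Seq encode_input (P 0)) (input_store (e x))
    (frame 0 s [:: code (enc (f (e x))); [::]; [::]; [::]])
    ((17 * size (e x) + 3) + (6 * size (e x) + 1 + 2) ^ k).
  rewrite (_ : input_store (e x) = frame 0 s [:: e x; [::]; [::]; [::]]); last first.
    apply: functional_extensionality => i; rewrite /input_store /upd /frame /=.
    by case: i => [|[|[|[|[|i]]]]].
  apply: runs_seq; first exact: runs_encode_input.
  apply: (@runs_le _ _ _ ((esize (e x) + 2) ^ k)).
    by case: (k) => // k'; rewrite leq_exp2r // leq_add2r esize_word.
  by apply: (@runs_call _ _ _ _ f _ _ 0 s [:: _; _; _; _] 0 (e x)) => // -[|[|[|[|[|i]]]]].
have [n [hn hh ha]] := hM _ _ _ he.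
exists n; split=> //.
  by apply: leq_trans (hp _); apply: leq_trans hn _; rewrite leq_add2r leq_mul2l.
by rewrite ha; apply: iff_trans (hf x hx); rewrite /frame /=; case: (f (e x)).
Qed.

(** * A library of polynomial-time functions *)

Section Basic.
Context {A B : Type} {eA : encodable A} {eB : encodable B}.

Lemma poly_to_data (f : A -> B) : poly f -> poly (fun a => enc (f a) : data).
Proof. exact: poly_enc. Qed.

End Basic.

Section Structures.
Context {A B C D : Type} {eA : encodable A} {eB : encodable B} {eC : encodable C}
  {eD : encodable D}.

Lemma poly_comp2 (g : B -> C -> D) (f1 : A -> B) (f2 : A -> C) :
  poly (fun p : B * C => g p.1 p.2) -> poly f1 -> poly f2 -> poly (fun a => g (f1 a) (f2 a)).
Proof. by move=> pg p1 p2; apply: (poly_comp pg (poly_pair p1 p2)). Qed.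

Lemma poly_fst (f : A -> B * C) : poly f -> poly (fun a => (f a).1).
Proof.
by move=> pf; apply: (poly_enc _ (poly_comp poly_dcar (poly_to_data pf))) => a.
Qed.

Lemma poly_snd (f : A -> B * C) : poly f -> poly (fun a => (f a).2).
Proof.
by move=> pf; apply: (poly_enc _ (poly_comp poly_dcdr (poly_to_data pf))) => a.
Qed.

Lemma poly_if (b : A -> bool) (f g : A -> B) : poly b -> poly f -> poly g ->
  poly (fun a => if b a then f a else g a).
Proof.
move=> pb' pf pg; apply: (poly_enc _ (poly_cond (poly_to_data pb') pf pg)) => a.
by case: (b a).
Qed.

Lemma poly_cons (x : A -> B) (l : A -> seq B) : poly x -> poly l -> poly (fun a => x a :: l a).
Proof. by move=> px pl; apply: (poly_enc _ (poly_pair px pl)). Qed.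

Lemma poly_behead (l : A -> seq B) : poly l -> poly (fun a => behead (l a)).
Proof.
move=> pl; apply: (poly_enc _ (poly_comp poly_dcdr (poly_to_data pl))) => a.
by case: (l a).
Qed.

Lemma poly_head (x0 : B) (l : A -> seq B) : poly l -> poly (fun a => head x0 (l a)).
Proof.
move=> pl; have pd := poly_to_data pl.
apply: (poly_enc _ (poly_cond pd (poly_comp poly_dcar pd) (poly_const (enc x0)))) => a.
by case: (l a).
Qed.

Lemma poly_nilp (l : A -> seq B) : poly l -> poly (fun a => nilp (l a)).
Proof.
move=> pl; apply: (poly_enc _ (poly_cond (poly_to_data pl) (poly_const false) (poly_const true))).
by move=> a; case: (l a).
Qed.

Lemma poly_succ (n : A -> nat) : poly n -> poly (fun a => (n a).+1).
Proof. by move=> pn; apply: (poly_enc _ (poly_pair (poly_const Leaf) pn)). Qed.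

Lemma poly_pred (n : A -> nat) : poly n -> poly (fun a => (n a).-1).
Proof.
move=> pn; apply: (poly_enc _ (poly_comp poly_dcdr (poly_to_data pn))) => a.
by case: (n a).
Qed.

Lemma poly_eq0 (n : A -> nat) : poly n -> poly (fun a => n a == 0).
Proof.
move=> pn; apply: (poly_enc _ (poly_cond (poly_to_data pn) (poly_const false) (poly_const true))).
by move=> a; case: (n a).
Qed.

Lemma poly_is_some (x : A -> option B) : poly x -> poly (fun a => isSome (x a)).
Proof.
move=> px; apply: (poly_enc _ (poly_cond (poly_to_data px) (poly_const true) (poly_const false))).
by move=> a; case: (x a).
Qed.

Lemma poly_odflt (x0 : B) (x : A -> option B) : poly x -> poly (fun a => odflt x0 (x a)).
Proof.
move=> px; have pd := poly_to_data px.
apply: (poly_enc _ (poly_cond pd (poly_comp poly_dcdr pd) (poly_const (enc x0)))).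
by move=> a; case: (x a).
Qed.

End Structures.

Section Boolean.
Context {A : Type} {eA : encodable A}.
Implicit Types f g : A -> bool.

Lemma poly_negb f : poly f -> poly (fun a => ~~ f a).
Proof.
move=> pf; apply: (poly_enc _ (poly_if pf (poly_const false) (poly_const true))) => a.
by case: (f a).
Qed.

Lemma poly_andb f g : poly f -> poly g -> poly (fun a => f a && g a).
Proof. by move=> pf pg; apply: (poly_enc _ (poly_if pf pg (poly_const false))). Qed.

Lemma poly_orb f g : poly f -> poly g -> poly (fun a => f a || g a).
Proof. by move=> pf pg; apply: (poly_enc _ (poly_if pf (poly_const true) pg)). Qed.

Lemma poly_addb f g : poly f -> poly g -> poly (fun a => f a (+) g a).
Proof.
move=> pf pg; apply: (poly_enc _ (poly_if pf (poly_negb pg) pg)) => a.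
by case: (f a).
Qed.

End Boolean.

Lemma esize_pair A B {eA : encodable A} {eB : encodable B} (p : A * B) :
  esize p = (esize p.1 + esize p.2).+1.
Proof. by rewrite /esize /= size_cat. Qed.

Lemma esize_cons B {eB : encodable B} (x : B) (l : seq B) :
  esize (x :: l) = (esize x + esize l).+1.
Proof. by rewrite /esize /= size_cat. Qed.

Lemma esize_gt0 B {eB : encodable B} (x : B) : 0 < esize x.
Proof. by rewrite /esize; case: (enc x). Qed.

Lemma esize_nil B {eB : encodable B} : esize ([::] : seq B) = 1.
Proof. by []. Qed.

Lemma esize_cat B {eB : encodable B} (l1 l2 : seq B) :
  esize (l1 ++ l2) = (esize l1 + esize l2).-1.
Proof.
elim: l1 => [|x l1 ih]; first by rewrite cat0s.
by rewrite cat_cons !esize_cons ih; pose proof (esize_gt0 l1); lia.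
Qed.

Lemma esize_rev B {eB : encodable B} (l : seq B) : esize (rev l) = esize l.
Proof.
elim: l => // x l ih; rewrite rev_cons -cats1 esize_cat ih !esize_cons.
by rewrite esize_nil; lia.
Qed.

Lemma esize_bool (b : bool) : esize b <= 3.
Proof. by case: b. Qed.

Lemma esize_bits (l : seq bool) : esize l <= 4 * size l + 1.
Proof. by elim: l => // x l ih; rewrite esize_cons /=; pose proof (esize_bool x); lia. Qed.

Lemma esize_filter B {eB : encodable B} (p : pred B) (l : seq B) : esize (filter p l) <= esize l.
Proof. by elim: l => // x l ih; rewrite /= esize_cons; case: (p x); rewrite ?esize_cons; lia. Qed.

Lemma esize_mem (B : eqType) {eB : encodable B} (x : B) (l : seq B) : x \in l -> esize x < esize l.
Proof.
elim: l => // y l ih; rewrite inE esize_cons => /orP[/eqP->|/ih]; first by lia.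
by lia.
Qed.

Lemma esize_seq_le B {eB : encodable B} (l : seq B) m :
  (forall i, i < size l -> forall x0, esize (nth x0 l i) <= m) -> esize l <= size l * m.+1 + 1.
Proof.
elim: l => // x l ih h; rewrite esize_cons /= mulSn.
have := h 0 isT x; have := ih (fun i hi => h i.+1 hi); rewrite /=; lia.
Qed.

Section Iterate.
Context {A S X Y : Type} {eA : encodable A} {eS : encodable S} {eX : encodable X}
  {eY : encodable Y}.

(** The body of a loop sees nothing but the state, so the parameter [a] is carried along in it. *)
Lemma poly_iter_size (h : A -> S -> S) (l : A -> seq X) (x : A -> S) (G : nat -> nat) :
  polybound G ->
  (forall a i, i <= size (l a) -> esize (iter i (h a) (x a)) <= G (esize a)) ->
  poly (fun z : A * S => h z.1 z.2) -> poly l -> poly x ->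
  poly (fun a => iter (size (l a)) (h a) (x a)).
Proof.
move=> bG hG ph pl px.
pose H (z : A * S) := (z.1, h z.1 z.2).
have HE a n y : iter n H (a, y) = (a, iter n (h a) y) by elim: n => //= n ->.
have pH : poly H by apply: poly_pair ph; apply: poly_fst poly_id.
have := @poly_iter_closed _ _ _ _ _ _ H l (fun a => (a, x a)) (fun n => n + G n + 1) pH pl.
case/(_ (poly_pair poly_id px)).
- by pb.
- by move=> a i hi; rewrite HE esize_pair /= addn1 ltnS leq_add2l hG.
move=> P [k hP]; have p2 : poly (fun a => iter (size (l a)) H (a, x a)) by exists P, k.
by apply: (poly_enc _ (poly_snd p2)) => a; rewrite HE.
Qed.

End Iterate.

Section Iterate2.
Context {A S X Y : Type} {eA : encodable A} {eS : encodable S} {eX : encodable X}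
  {eY : encodable Y}.

Lemma poly_iter (h : A -> S -> S) (n : A -> nat) (x : A -> S) (G : nat -> nat) :
  polybound G ->
  (forall a i, i <= n a -> esize (iter i (h a) (x a)) <= G (esize a)) ->
  poly (fun z : A * S => h z.1 z.2) -> poly n -> poly x ->
  poly (fun a => iter (n a) (h a) (x a)).
Proof.
move=> bG hG ph pn px.
have pl : poly (fun a => nseq (n a) false).
  apply: (poly_enc _ pn) => a; elim: (n a) => // m ih.
  exact: (congr1 (Node Leaf) ih).
have := @poly_enc _ _ _ _ _ _ (fun a => iter (size (nseq (n a) false)) (h a) (x a)).
apply; first by move=> a; rewrite size_nseq.
by apply: (poly_iter_size bG _ ph pl px) => a i; rewrite size_nseq; apply: hG.
Qed.

End Iterate2.

Lemma poly_size_exp A B {eA : encodable A} {eB : encodable B} (f : A -> B) : poly f ->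
  exists k, forall a, esize (f a) <= (esize a + 2) ^ k.
Proof. by move=> /poly_size[g [k hk] hg]; exists k => a; apply: leq_trans (hk _). Qed.

Lemma esize_nat n : esize n = n.*2.+1.
Proof. by elim: n => // n ih; rewrite doubleS -ih. Qed.

Lemma esize_take B {eB : encodable B} (l : seq B) i : esize (take i l) <= esize l.
Proof. by elim: l i => [|x l ih] [|i] //=; rewrite !esize_cons; have := ih i; lia. Qed.

Lemma esize_drop B {eB : encodable B} (l : seq B) i : esize (drop i l) <= esize l.
Proof. by elim: l i => [|x l ih] [|i] //=; rewrite !esize_cons; have := ih i; lia. Qed.

Lemma esize_flatten B {eB : encodable B} (l : seq (seq B)) : esize (flatten l) <= esize l.
Proof. by elim: l => //= x l ih; rewrite esize_cat esize_cons; lia. Qed.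

Lemma poly_comp3 {A B C D E : Type} {eA : encodable A} {eB : encodable B}
    {eC : encodable C} {eD : encodable D} {eE : encodable E}
    (g : B -> C -> D -> E) (f1 : A -> B) (f2 : A -> C) (f3 : A -> D) :
  poly (fun p : (B * C) * D => g p.1.1 p.1.2 p.2) -> poly f1 -> poly f2 -> poly f3 ->
  poly (fun a => g (f1 a) (f2 a) (f3 a)).
Proof.
by move=> pg p1 p2 p3; apply: (poly_comp pg (poly_pair (poly_pair p1 p2) p3)).
Qed.

Section Fold.
Context {A S X : Type} {eA : encodable A} {eS : encodable S} {eX : encodable X}.

Definition fold_step (st : A -> S -> X -> S) (a : A) (z : seq X * S) : seq X * S :=
  if z.1 is y :: l then (l, st a z.2 y) else z.

Lemma iter_fold_step st a i l s :
  iter i (fold_step st a) (l, s) = (drop i l, foldl (st a) s (take i l)).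
Proof.
elim: i l s => [|i ih] l s; first by rewrite drop0 take0.
rewrite iterSr; case: l => [|y l]; last by rewrite ih.
by rewrite /fold_step /= ih; case: i {ih}.
Qed.

(** The intermediate states are the folds over the prefixes of the list, and these are what [G] has
    to bound. *)
Lemma poly_foldl (y0 : X) (st : A -> S -> X -> S) (l : A -> seq X) (x : A -> S)
    (G : nat -> nat) :
  polybound G ->
  (forall a i, esize (foldl (st a) (x a) (take i (l a))) <= G (esize a)) ->
  poly (fun z : (A * S) * X => st z.1.1 z.1.2 z.2) -> poly l -> poly x ->
  poly (fun a => foldl (st a) (x a) (l a)).
Proof.
move=> bG hG pst pl px.
have [N bN hN] := poly_size pl.
have pstep : poly (fun z : A * (seq X * S) => fold_step st z.1 z.2).
  pose f (z : A * (seq X * S)) :=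
    if nilp z.2.1 then z.2 else (behead z.2.1, st z.1 z.2.2 (head y0 z.2.1)).
  apply: (@poly_enc _ _ _ _ _ _ f).
    by move=> [a [[|y l'] s]].
  have p2 : poly (fun z : A * (seq X * S) => z.2) by apply: poly_snd poly_id.
  have p21 : poly (fun z : A * (seq X * S) => z.2.1) by apply: poly_fst p2.
  apply: poly_if => //; first exact: poly_nilp.
  apply: poly_pair; first exact: poly_behead.
  apply: (poly_comp3 pst); [exact: poly_fst poly_id | exact: poly_snd | exact: poly_head].
have h : poly (fun a => iter (size (l a)) (fold_step st a) (l a, x a)).
  apply: (@poly_iter_size _ _ _ _ _ _ (fold_step st) l _ (fun n => (N n + G n).+1)) => //.
  - by apply: polybound_le (polybound_add (polybound_const 1) (polybound_add bN bG)).
  - move=> a i _; rewrite iter_fold_step esize_pair /= ltnS leq_add //.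
    exact: leq_trans (esize_drop _ _) (hN a).
  - exact: poly_pair.
by apply: (poly_enc _ (poly_snd h)) => a; rewrite iter_fold_step take_size.
Qed.

End Fold.

Section SeqFunctions.
Context {A X Y : Type} {eA : encodable A} {eX : encodable X} {eY : encodable Y}.

Lemma foldl_cons (l s : seq X) : foldl (fun s x => x :: s) s l = catrev l s.
Proof. by elim: l s => //= x l ih s. Qed.

Lemma poly_rev_closed (y0 : X) : poly (fun l : seq X => rev l).
Proof.
have h : poly (fun l : seq X => foldl (fun s x => x :: s) [::] l).
  apply: (@poly_foldl _ _ _ _ _ _ y0 (fun _ s x => x :: s) id (fun=> [::]) id).
  - by pb.
  - by move=> l i; rewrite foldl_cons -/(rev _) esize_rev esize_take.
  - apply: poly_cons; first by apply: poly_snd poly_id.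
    by apply: poly_snd; apply: poly_fst poly_id.
  - exact: poly_id.
  - exact: poly_const.
by apply: (poly_enc _ h) => l; rewrite foldl_cons.
Qed.

Lemma poly_rev (y0 : X) (l : A -> seq X) : poly l -> poly (fun a => rev (l a)).
Proof. by apply: (poly_comp (poly_rev_closed y0)). Qed.

End SeqFunctions.

Section SeqFunctions2.
Context {A X Y : Type} {eA : encodable A} {eX : encodable X} {eY : encodable Y}.

Lemma poly_cat (y0 : X) (l1 l2 : A -> seq X) : poly l1 -> poly l2 ->
  poly (fun a => l1 a ++ l2 a).
Proof.
move=> p1 p2.
apply: (@poly_comp2 _ _ _ _ _ _ _ _ (fun l1 l2 : seq X => l1 ++ l2)) => //.
have h : poly (fun p : seq X * seq X => foldl (fun s x => x :: s) p.2 (rev p.1)).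
  apply: (@poly_foldl _ _ _ _ _ _ y0 (fun _ s x => x :: s) _ _ (fun n => n)).
  - by pb.
  - move=> p i; rewrite foldl_cons catrevE esize_cat esize_rev esize_pair.
    by pose proof (esize_take (rev p.1) i) as h; rewrite esize_rev in h; lia.
  - apply: poly_cons; first by apply: poly_snd poly_id.
    by apply: poly_snd; apply: poly_fst poly_id.
  - by apply: (poly_rev y0); apply: poly_fst poly_id.
  - by apply: poly_snd poly_id.
by apply: (poly_enc _ h) => p; rewrite foldl_cons catrevE revK.
Qed.

Lemma poly_map (y0 : X) (z0 : Y) (g : A -> X -> Y) (l : A -> seq X) :
  poly (fun z : A * X => g z.1 z.2) -> poly l -> poly (fun a => [seq g a x | x <- l a]).
Proof.
move=> pg pl; have [k hk] := poly_size_exp pg; have [N bN hN] := poly_size pl.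
have E a i : foldl (fun s x => g a x :: s) [::] (take i (l a)) = rev (map (g a) (take i (l a))).
  by rewrite /rev; elim: (take i (l a)) [::] => //= x l' ih s.
have h : poly (fun a => foldl (fun s x => g a x :: s) [::] (l a)).
  apply: (@poly_foldl _ _ _ _ _ _ y0 (fun a s x => g a x :: s) _ _
    (fun n => N n * ((n + N n + 1 + 2) ^ k + 1) + 1)).
  - by pb.
  - move=> a i; rewrite E esize_rev.
    have hs : size (take i (l a)) <= N (esize a).
      by apply: leq_trans (hN a); apply: leq_trans (esize_take _ i); apply: leq_size_esize.
    apply: leq_trans (@esize_seq_le _ _ _ ((esize a + N (esize a) + 1 + 2) ^ k) _) _.
      move=> j; rewrite size_map => hj z; rewrite (nth_map y0) //.
      apply: leq_trans (hk (a, _)) _.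
      case: (k) => // k'; rewrite leq_exp2r // leq_add2r esize_pair /= addn1 ltnS leq_add2l.
      apply: leq_trans (hN a); apply: leq_trans (esize_take _ i).
      elim: (take i (l a)) j hj => // x' l' ih [|j] hj; rewrite esize_cons /=; first by lia.
      by have := ih j hj; lia.
    by rewrite size_map leq_add2r [_ ^ k + 1]addn1 leq_mul.
  - apply: poly_cons; last by apply: poly_snd; apply: poly_fst poly_id.
    apply: (poly_comp2 pg); last by apply: poly_snd poly_id.
    by do 2! apply: poly_fst; apply: poly_id.
  - by [].
  - exact: poly_const.
by apply: (poly_enc _ (poly_rev z0 h)) => a; rewrite -(take_size (l a)) E revK.
Qed.

Lemma poly_filter (y0 : X) (p : A -> X -> bool) (l : A -> seq X) :
  poly (fun z : A * X => p z.1 z.2) -> poly l -> poly (fun a => [seq x <- l a | p a x]).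
Proof.
move=> pp pl; have [N bN hN] := poly_size pl.
have E a l' s : foldl (fun s x => if p a x then x :: s else s) s l' = catrev (filter (p a) l') s.
  by elim: l' s => //= x l' ih s; rewrite ih; case: (p a x).
have h : poly (fun a => foldl (fun s x => if p a x then x :: s else s) [::] (l a)).
  apply: (@poly_foldl _ _ _ _ _ _ y0 (fun a s x => if p a x then x :: s else s) _ _ N) => //.
  - move=> a i; rewrite E -/(rev _) esize_rev.
    by apply: leq_trans (hN a); apply: leq_trans (esize_filter _ _) (esize_take _ _).
  - have p12 : poly (fun z : A * seq X * X => z.1.2) by apply: poly_snd; apply: poly_fst poly_id.
    have p2 : poly (fun z : A * seq X * X => z.2) by apply: poly_snd poly_id.
    apply: poly_if => //; last by apply: poly_cons.
    apply: (poly_comp2 pp) => //.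
    by do 2! apply: poly_fst; apply: poly_id.
  - exact: poly_const.
by apply: (poly_enc _ (poly_rev y0 h)) => a; rewrite E -/(rev _) revK.
Qed.

Lemma poly_all (y0 : X) (p : A -> X -> bool) (l : A -> seq X) :
  poly (fun z : A * X => p z.1 z.2) -> poly l -> poly (fun a => all (p a) (l a)).
Proof.
move=> pp pl.
have E a b l' : foldl (fun b x => b && p a x) b l' = b && all (p a) l'.
  by elim: l' b => [|x l' ih] b /=; rewrite ?andbT // ih andbA.
have h : poly (fun a => foldl (fun b x => b && p a x) true (l a)).
  apply: (@poly_foldl _ _ _ _ _ _ y0 (fun a b x => b && p a x) _ _ (fun=> 3)) => //.
  - exact: polybound_const.
  - by move=> a i; apply: esize_bool.
  - apply: poly_andb; first by apply: poly_snd; apply: poly_fst poly_id.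
    apply: (poly_comp2 pp); last by apply: poly_snd poly_id.
    by do 2! apply: poly_fst; apply: poly_id.
  - exact: poly_const.
by apply: (poly_enc _ h) => a; rewrite E.
Qed.

Lemma poly_has (y0 : X) (p : A -> X -> bool) (l : A -> seq X) :
  poly (fun z : A * X => p z.1 z.2) -> poly l -> poly (fun a => has (p a) (l a)).
Proof.
move=> pp pl.
have h : poly (fun a => ~~ all (fun x => ~~ p a x) (l a)).
  by apply: poly_negb; apply: (@poly_all y0 (fun a x => ~~ p a x)) => //; apply: poly_negb.
by apply: (poly_enc _ h) => a; congr enc; rewrite -has_predC; apply: eq_has => x /=; rewrite negbK.
Qed.

End SeqFunctions2.

Section SeqFunctions3.
Context {A X Y : Type} {eA : encodable A} {eX : encodable X} {eY : encodable Y}.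

Lemma poly_flatten (y0 : X) (l : A -> seq (seq X)) : poly l -> poly (fun a => flatten (l a)).
Proof.
move=> pl; have [N bN hN] := poly_size pl.
have E s l' : foldl (fun s x => s ++ x) s l' = s ++ flatten l' :> seq X.
  by elim: l' s => [|x l' ih] s /=; rewrite ?cats0 // ih catA.
have h : poly (fun a => foldl (fun s x => s ++ x) [::] (l a)).
  apply: (@poly_foldl _ _ _ _ _ _ [::] (fun a s x => s ++ x) _ _ N) => //.
  - move=> a i; rewrite E cat0s; apply: leq_trans (hN a).
    exact: leq_trans (esize_flatten _) (esize_take _ _).
  - apply: (poly_cat y0); last by apply: poly_snd poly_id.
    by apply: poly_snd; apply: poly_fst poly_id.
  - exact: poly_const.
by apply: (poly_enc _ h) => a; rewrite E.
Qed.

Lemma poly_seq_size (y0 : X) (l : A -> seq X) : poly l -> poly (fun a => size (l a)).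
Proof.
move=> pl; have h : poly (fun a => [seq false | x <- l a]).
  by apply: (@poly_map _ _ _ _ _ _ y0 false (fun _ _ => false)) => //; apply: poly_const.
apply: (poly_enc _ h) => a; elim: (l a) => // x l' ih.
exact: (congr1 (Node Leaf) ih).
Qed.

Lemma poly_drop (n : A -> nat) (l : A -> seq X) : poly n -> poly l ->
  poly (fun a => drop (n a) (l a)).
Proof.
move=> pn pl; have [N bN hN] := poly_size pl.
have E i l' : iter i behead l' = drop i l' :> seq X.
  by elim: i => [|i ih]; rewrite ?drop0 //= ih -drop1 drop_drop.
have h : poly (fun a => iter (n a) behead (l a)).
  apply: (@poly_iter _ _ _ _ (fun _ => behead) n l N) => //.
  - by move=> a i _; rewrite E; apply: leq_trans (hN a); apply: esize_drop.
  - by apply: poly_behead; apply: poly_snd poly_id.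
by apply: (poly_enc _ h) => a; rewrite E.
Qed.

Lemma poly_nth (x0 : X) (l : A -> seq X) (n : A -> nat) : poly l -> poly n ->
  poly (fun a => nth x0 (l a) (n a)).
Proof.
move=> pl pn; apply: (poly_enc _ (poly_head x0 (poly_drop pn pl))) => a.
by rewrite -nth0 nth_drop addn0.
Qed.

Lemma poly_subn (m n : A -> nat) : poly m -> poly n -> poly (fun a => m a - n a).
Proof.
move=> pm pn; have [N bN hN] := poly_size pm.
have E i k : iter i predn k = k - i by elim: i => [|i ih]; rewrite ?subn0 //= ih subnS.
have h : poly (fun a => iter (n a) predn (m a)).
  apply: (@poly_iter _ _ _ _ (fun _ => predn) n m N) => //.
  - by move=> a i _; rewrite E; apply: leq_trans (hN a); rewrite !esize_nat; lia.
  - by apply: poly_pred; apply: poly_snd poly_id.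
by apply: (poly_enc _ h) => a; rewrite E.
Qed.

Lemma poly_addn (m n : A -> nat) : poly m -> poly n -> poly (fun a => m a + n a).
Proof.
move=> pm pn; have [N bN hN] := poly_size pn; have [M bM hM] := poly_size pm.
have E i k : iter i succn k = i + k by elim: i => [|i ih] //=; rewrite ih.
have h : poly (fun a => iter (m a) succn (n a)).
  apply: (@poly_iter _ _ _ _ (fun _ => succn) m n (fun k => M k + N k)) => //; first by pb.
  - move=> a i hi; rewrite E; have := hN a; have := hM a; rewrite !esize_nat; lia.
  - by apply: poly_succ; apply: poly_snd poly_id.
by apply: (poly_enc _ h) => a; rewrite E.
Qed.

End SeqFunctions3.

Section Arithmetic.
Context {A : Type} {eA : encodable A}.
Implicit Types m n : A -> nat.

Lemma poly_leq m n : poly m -> poly n -> poly (fun a => m a <= n a).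
Proof. by move=> pm pn; apply: poly_eq0; apply: poly_subn. Qed.

Lemma poly_eqn m n : poly m -> poly n -> poly (fun a => m a == n a).
Proof.
move=> pm pn; apply: (poly_enc _ (poly_andb (poly_leq pm pn) (poly_leq pn pm))) => a.
by rewrite eqn_leq.
Qed.

Lemma poly_muln m n : poly m -> poly n -> poly (fun a => m a * n a).
Proof.
move=> pm pn; have [N bN hN] := poly_size pn; have [M bM hM] := poly_size pm.
have E i k : iter i (addn k) 0 = i * k by elim: i => [|i ih] //=; rewrite ih mulSn.
have h : poly (fun a => iter (m a) (addn (n a)) 0).
  apply: (@poly_iter _ _ _ _ (fun a => addn (n a)) m _ (fun k => 2 * (M k * N k) + 1)) => //.
  - by pb.
  - move=> a i hi; rewrite E; have := hN a; have := hM a; rewrite !esize_nat => h1 h2.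
    have : i * n a <= M (esize a) * N (esize a) by apply: leq_mul; lia.
    by lia.
  - apply: poly_addn; last by apply: poly_snd poly_id.
    by apply: (poly_comp pn); apply: poly_fst poly_id.
  - exact: poly_const.
by apply: (poly_enc _ h) => a; rewrite E.
Qed.

Lemma poly_maxn m n : poly m -> poly n -> poly (fun a => maxn (m a) (n a)).
Proof. by move=> pm pn; apply: poly_if => //; apply: poly_leq => //; apply: poly_succ. Qed.

Lemma poly_iota0 n : poly n -> poly (fun a => iota 0 (n a)).
Proof.
move=> pn; have [N bN hN] := poly_size pn.
have E i : iter i (fun s => size s :: s) [::] = rev (iota 0 i).
  by elim: i => // i ih; rewrite iterS ih size_rev size_iota -addn1 iotaD rev_cat.
have h : poly (fun a => iter (n a) (fun s => size s :: s) [::]).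
  apply: (@poly_iter _ _ _ _ (fun _ s => size s :: s) n _
     (fun k => N k * (2 * N k + 1 + 1) + 1)) => //.
  - by pb.
  - move=> a i hi; rewrite E esize_rev.
    have hn : n a <= N (esize a) by apply: leq_trans (hN a); rewrite esize_nat; lia.
    apply: leq_trans (@esize_seq_le _ _ _ (2 * N (esize a) + 1) _) _.
      by move=> j; rewrite size_iota => hj x0; rewrite nth_iota // esize_nat; lia.
    by rewrite size_iota leq_add2r -addn1 leq_mul //; lia.
  - have p2 : poly (fun z : A * seq nat => z.2) by apply: poly_snd poly_id.
    by apply: poly_cons => //; apply: (poly_seq_size 0).
  - exact: poly_const.
by apply: (poly_enc _ (poly_rev 0 h)) => a; rewrite E revK.
Qed.

End Arithmetic.

Import Order.TTheory GRing.Theory Num.Theory.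

(** * Binary numbers *)

Definition bval (l : seq bool) : nat := foldr (fun (b : bool) m => b + 2 * m) 0 l.

Definition pad (a b : seq bool) : seq (bool * bool) :=
  [seq (nth false a i, nth false b i) | i <- iota 0 (maxn (size a) (size b))].

Definition add_step (s : bool * seq bool) (p : bool * bool) : bool * seq bool :=
  ((p.1 && p.2) || (s.1 && (p.1 || p.2)), (p.1 (+) p.2 (+) s.1) :: s.2).

Definition badd (a b : seq bool) : seq bool :=
  let r := foldl add_step (false, [::]) (pad a b) in rev (r.1 :: r.2).

(** The bits come least significant first, so the last position at which they differ decides. *)
Definition ble_step (r : bool) (p : bool * bool) : bool := if p.1 (+) p.2 then p.2 else r.

Definition ble (a b : seq bool) : bool := foldl ble_step true (pad a b).

Lemma bval_cat a b : bval (a ++ b) = bval a + 2 ^ size a * bval b.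
Proof. by elim: a => [|x a ih] /=; rewrite ?mul1n // ih expnS; lia. Qed.

Lemma bval_mkseq a m : size a <= m -> bval (mkseq (nth false a) m) = bval a.
Proof.
elim: a m => [|x a ih] m /=.
  by move=> _; rewrite /mkseq; elim: (iota 0 m) => //= i s ->; rewrite nth_nil.
case: m => // m; rewrite ltnS => /ih <-.
by rewrite /mkseq /= -[1]/(1 + 0) iotaDl -map_comp.
Qed.

Lemma unzip1_pad a b : bval (unzip1 (pad a b)) = bval a.
Proof. by rewrite /unzip1 -map_comp bval_mkseq // leq_maxl. Qed.

Lemma unzip2_pad a b : bval (unzip2 (pad a b)) = bval b.
Proof. by rewrite /unzip2 -map_comp bval_mkseq // leq_maxr. Qed.

Lemma bval_badd a b : bval (badd a b) = bval a + bval b.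
Proof.
rewrite /badd -[in RHS](unzip1_pad a b) -[in RHS](unzip2_pad a b).
(* The carry [c] has the weight of the next bit to be written, [2 ^ size o]. *)
have h c o l : let r := foldl add_step (c, o) l in
    bval (rev (r.1 :: r.2)) = bval (rev o) + 2 ^ size o * (c + bval (unzip1 l) + bval (unzip2 l)).
  elim: l c o => [|[x y] l ih] c o /=.
    by rewrite rev_cons -cats1 bval_cat size_rev /=; lia.
  rewrite ih rev_cons -cats1 bval_cat size_rev /= expnS -!addnA; congr (_ + _).
  by case: x; case: y; case: c => /=; lia.
by rewrite h /= mul1n.
Qed.

Lemma size_badd a b : size (badd a b) = (maxn (size a) (size b)).+1.
Proof.
rewrite /badd size_rev /=; congr _.+1.
have h s l : size (foldl add_step s l).2 = size s.2 + size l.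
  by elim: l s => [|p l ih] s /=; rewrite ?addn0 // ih /= addSnnS.
by rewrite h /= size_map size_iota.
Qed.

Lemma bleE a b : ble a b = (bval a <= bval b).
Proof.
rewrite /ble -[in RHS](unzip1_pad a b) -[in RHS](unzip2_pad a b).
(* A negative verdict [r] on the lower bits acts as a borrow of [1]. *)
have h r l : foldl ble_step r l = (bval (unzip1 l) + ~~ r <= bval (unzip2 l)).
  elim: l r => [|[x y] l ih] r /=; first by case: r.
  by rewrite ih /ble_step /=; case: x; case: y; case: r => /=; lia.
by rewrite h /= addn0.
Qed.

Lemma bval_binary m : bval (binary m) = m.
Proof.
(* Generalised to the [k] digits from position [i] on. *)
have h k i : bval (mkseq (fun j => odd (m %/ 2 ^ (i + j))) k) = m %/ 2 ^ i %% 2 ^ k.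
  elim: k i => [|k ih] i; first by rewrite expn0 modn1.
  have -> : mkseq (fun j => odd (m %/ 2 ^ (i + j))) k.+1 =
     odd (m %/ 2 ^ i) :: mkseq (fun j => odd (m %/ 2 ^ (i.+1 + j))) k.
    rewrite /mkseq /= addn0 -[1]/(1 + 0) iotaDl -map_comp.
    by congr (_ :: _); apply: eq_map => j /=; rewrite addnS.
  rewrite /= ih [2 ^ i.+1]expnSr divnMA [2 ^ k.+1]expnSr; set x := m %/ 2 ^ i.
  rewrite -modn2; set q := x %/ 2 %/ 2 ^ k; set r := x %/ 2 %% 2 ^ k.
  have lt_r : r < 2 ^ k by rewrite ltn_mod expn_gt0.
  have lt_s : x %% 2 < 2 by rewrite ltn_mod.
  have ex : x = q * (2 ^ k * 2) + (x %% 2 + 2 * r).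
    by rewrite {1}(divn_eq x 2) {1}(divn_eq (x %/ 2) (2 ^ k)) -/q -/r; lia.
  rewrite [in RHS]ex modnMDl [RHS]modn_small //.
  by move: lt_r lt_s; move: (x %% 2) (r) (2 ^ k) => a b c; lia.
rewrite /binary -(@eq_mkseq _ (fun j => odd (m %/ 2 ^ (0 + j)))) // h.
rewrite expn0 divn1 modn_small //.
by apply: trunc_log_ltn.
Qed.

(** * Fundamental cuts *)

(* An item is an arc [(u, v)] with its weight; a row is a tree arc with the   *)
(* characteristic vector of one side of its fundamental cut.                  *)
Definition item : Type := ((nat * nat) * seq bool)%type.
Definition row : Type := (item * seq bool)%type.

Definition tl (f : item) : nat := f.1.1.
Definition hd (f : item) : nat := f.1.2.
Definition crossing (X : nat -> bool) (f : item) : bool := X (tl f) (+) X (hd f).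
Definition cross (X : seq bool) (f : item) : bool := nth false X (tl f) (+) nth false X (hd f).
Definition same_arc (e f : item) : bool := (tl e == tl f) && (hd e == hd f).

(** The new arc [f] takes over the cut of the removed arc. This cut is added over F_2 to every other
    cut that [f] crosses, after which [f] crosses only its own. *)
Definition pivot_row (n : nat) (r0 : row) (f : item) (r : row) : row :=
  if same_arc r.1 r0.1 then (f, r0.2) else
  if cross r.2 f then (r.1, [seq nth false r.2 i (+) nth false r0.2 i | i <- iota 0 n])
  else r.

Definition pivot (n : nat) (rows : seq row) (r0 : row) (f : item) : seq row :=
  [seq pivot_row n r0 f r | r <- rows].

Section Core.
Variables (n : nat) (E : seq item).
Hypothesis E_lt : forall f : item, f \in E -> [/\ tl f < n, hd f < n & tl f != hd f].
Hypothesis E_ex : forall u v, u < n -> v < n -> u != v ->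
  exists2 f : item, f \in E & f.1 = (u, v).
Hypothesis E_inj : {in E &, injective fst}.

(** [tree_dual]: a fundamental cut meets the tree only in its own arc. [tree_span]: the arc [f] and
    the tree arcs whose cuts it crosses meet every cut evenly, that is, they form the fundamental
    cycle of [f]. *)
Record is_tree (rows : seq row) : Prop := IsTree {
  tree_uniq : uniq (map fst rows);
  tree_sub : forall r : row, r \in rows -> r.1 \in E;
  tree_dual : forall r r' : row, r \in rows -> r' \in rows -> cross r.2 r'.1 = (r.1 == r'.1);
  tree_span : forall (X : nat -> bool) (f : item), f \in E ->
    crossing X f = \big[addb/false]_(r <- rows) (crossing X r.1 && cross r.2 f);
  tree_size : size rows = n.-1
}.

Definition optimal (w : item -> int) (F : seq item) (rows : seq row) : Prop :=
  forall (r : row) (g : item), r \in rows -> g \in F -> cross r.2 g -> (w g <= w r.1)%R.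

Lemma same_arcE e f : e \in E -> f \in E -> same_arc e f = (e == f).
Proof.
move=> eE fE; apply/idP/eqP => [|->]; last by rewrite /same_arc !eqxx.
case/andP=> /eqP h1 /eqP h2; apply: E_inj => //.
by move: h1 h2; rewrite /tl /hd; case: (e.1) (f.1) => [a b] [c d] /= -> ->.
Qed.

Lemma tree_row_inj rows r r' : is_tree rows -> r \in rows -> r' \in rows -> r.1 = r'.1 -> r = r'.
Proof.
move=> tr hr hr' e.
have := tree_uniq tr.
elim: (rows) hr hr' => //= a s ih; rewrite !inE => /orP[/eqP ra|h1] /orP[/eqP rb|h2].
- by rewrite ra rb.
- by case/andP=> /negP[]; rewrite -ra e map_f.
- by case/andP=> /negP[]; rewrite -rb -e map_f.
- by case/andP=> _; apply: ih.
Qed.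

Section Pivot.
Variables (rows : seq row) (r0 : row) (f : item).
Hypotheses (tr : is_tree rows) (r0_in : r0 \in rows) (fE : f \in E) (cr : cross r0.2 f).

Let tE := tree_sub tr.

Lemma pivot_row_item r : r \in rows -> (pivot_row n r0 f r).1 = if r == r0 then f else r.1.
Proof.
move=> hr; rewrite /pivot_row same_arcE ?tE //.
have [->|ne] := eqVneq r r0; first by rewrite eqxx.
case: eqP => [e|_]; first by case/eqP: ne; apply: (tree_row_inj tr).
by case: ifP.
Qed.

Lemma pivot_row_cross r g : r \in rows -> g \in E ->
  cross (pivot_row n r0 f r).2 g =
  if r == r0 then cross r0.2 g else cross r.2 g (+) (cross r.2 f && cross r0.2 g).
Proof.
move=> hr gE; rewrite /pivot_row same_arcE ?tE //.
have [->|ne] := eqVneq r r0; first by rewrite eqxx.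
case: eqP => [e|_]; first by case/eqP: ne; apply: (tree_row_inj tr).
case: (cross r.2 f) => /=; last by rewrite addbF.
have [h1 h2 _] := E_lt gE.
rewrite /cross !(nth_map 0) ?size_iota // !nth_iota // !add0n.
by rewrite -!addbA; congr addb; rewrite addbCA.
Qed.

Lemma pivot_tree : is_tree (pivot n rows r0 f).
Proof.
have f_notin r : r \in rows -> r != r0 -> r.1 != f.
  move=> hr ne; apply: contraTneq cr => <-.
  rewrite (tree_dual tr) //; apply/eqP => e.
  by case/eqP: ne; apply: (tree_row_inj tr).
have urows : uniq rows by apply: map_uniq (tree_uniq tr).
split.
- rewrite -map_comp map_inj_in_uniq // => r r' hr hr' /=.
  rewrite !pivot_row_item //.
  case: (eqVneq r r0) => [->|ne]; case: (eqVneq r' r0) => [->|ne'] //.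
  + by move=> e; have := f_notin _ hr' ne'; rewrite e eqxx.
  + by move=> e; have := f_notin _ hr ne; rewrite e eqxx.
  + by apply: (tree_row_inj tr).
- by move=> _ /mapP[r hr ->]; rewrite pivot_row_item //; case: ifP => // _; apply: tE.
- move=> _ _ /mapP[r hr ->] /mapP[r' hr' ->].
  rewrite !pivot_row_item // pivot_row_cross //; last by case: ifP => // _; apply: tE.
  case: (eqVneq r r0) => [_|ne]; case: (eqVneq r' r0) => [_|ne'].
  + by rewrite eqxx.
  + rewrite (tree_dual tr) // [f == _]eq_sym (negbTE (f_notin _ hr' ne')).
    by apply/eqP => e; case/eqP: ne'; apply: (tree_row_inj tr).
  + by rewrite cr andbT addbb (negbTE (f_notin _ hr ne)).
  + rewrite !(tree_dual tr) // (_ : r0.1 == r'.1 = false) ?andbF ?addbF //.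
    by apply/eqP => e; case/eqP: ne'; apply: (tree_row_inj tr).
- move=> X g gE; rewrite big_map (bigD1_seq r0) //=.
  rewrite pivot_row_item // pivot_row_cross // eqxx.
  rewrite (tree_span tr X gE) (bigD1_seq r0) //=.
  (* Once [f] itself is expanded, the terms that the pivot added to the other cuts cancel. *)
  have := tree_span tr X fE; rewrite (bigD1_seq r0) //= cr andbT => hf.
  have -> : \big[addb/false]_(r <- rows | r != r0)
      (crossing X (pivot_row n r0 f r).1 && cross (pivot_row n r0 f r).2 g) =
    \big[addb/false]_(r <- rows | r != r0) ((crossing X r.1 && cross r.2 g) (+)
      ((crossing X r.1 && cross r.2 f) && cross r0.2 g)).
    rewrite big_seq_cond [RHS]big_seq_cond; apply: eq_bigr => r /andP[hr ne].
    rewrite pivot_row_item // pivot_row_cross // (negbTE ne).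
    by case: (crossing X r.1).
  rewrite big_split /= -big_distrl /= hf.
  by do 2! case: (\big[_/_]_(_ <- _ | _) _); case: (crossing X r0.1); case: (cross r0.2 g).
- by rewrite size_map (tree_size tr).
Qed.

(** The row of [r0] keeps its cut and gets a heavier arc. If [g] is new in the cut of another row
    [r], then [r] crosses [f] and [r0] crosses [g], so the weight of [r0.1] lies between those of
    [g] and [r.1]. *)
Lemma pivot_optimal (w : item -> int) F : {subset F <= E} -> optimal w F rows ->
  (forall r : row, r \in rows -> cross r.2 f -> (w r0.1 <= w r.1)%R) -> (w r0.1 <= w f)%R ->
  optimal w (f :: F) (pivot n rows r0 f).
Proof.
move=> sF opt hmin hf _ g /mapP[r hr ->] gF.
have gE : g \in E by case/predU1P: gF => [->|/sF].
rewrite pivot_row_cross // pivot_row_item //.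
case: (eqVneq r r0) => [_|ne].
  by case/predU1P: gF => [->|gF] // c0; apply: le_trans hf; apply: opt.
case/predU1P: gF => [->|gF]; first by rewrite cr andbT addbb.
have [c1|c1] := boolP (cross r.2 g); first by move=> _; apply: opt.
by case/andP=> c2 c3; apply: le_trans (hmin r hr c2); apply: opt.
Qed.

End Pivot.
End Core.

(** * Optimal trees against arbitrary forests *)

Section Forests.
Variables (n : nat) (E : seq item).

(** Each arc has a cut that no other arc of [J] crosses. This is linear independence over F_2, hence
    acyclicity expressed without paths. *)
Definition independent (J : seq item) : Prop :=
  forall f, f \in J -> exists X : nat -> bool, forall g, g \in J -> crossing X g = (g == f).

Lemma crossing_addb (X Y : nat -> bool) c g :
  crossing (fun v => X v (+) (c && Y v)) g = crossing X g (+) (c && crossing Y g).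
Proof.
by rewrite /crossing; case: c => /=; rewrite ?addbF // -!addbA; congr addb; rewrite addbCA.
Qed.

(* An arc [f] of [J] outside the tree crosses the fundamental cut of some tree *)
(* arc [e] that crosses the cut of [f] in [J]; replacing [f] by [e] does not   *)
(* decrease the weight.                                                        *)
Lemma forest_weight_le rows (w : item -> int) J :
  is_tree n E rows -> optimal w E rows -> (forall r, r \in rows -> 0 <= w r.1)%R ->
  uniq J -> {subset J <= E} -> independent J ->
  (\sum_(f <- J) w f <= \sum_(r <- rows) w r.1)%R.
Proof.
move=> tr opt w0; rewrite -(big_map fst xpredT w); set T := map fst rows.
have uT : uniq T := tree_uniq tr.
move ek: (count (fun f => f \notin T) J) => k.
elim: k J ek => [|k ih] J ek uJ sJ iJ.
  have JT f : f \in J -> f \in T.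
    move=> fJ; apply: contraT => fT.
    have : has (fun f => f \notin T) J by apply/hasP; exists f.
    by rewrite has_count ek.
  (* Once [J] lies inside the tree, the tree has only non-negative weights in addition. *)
  rewrite [leRHS](bigID (fun f => f \in J)) /=.
  rewrite -[X in (_ <= X + _)%R]big_filter -[leLHS]addr0.
  apply: lerD; last first.
    by rewrite big_seq_cond sumr_ge0 // => f /andP[/mapP[r hr ->] _]; apply: w0.
  rewrite (perm_big [seq f <- T | f \in J]) //=; apply: uniq_perm => //.
    exact: filter_uniq.
  by move=> f; rewrite mem_filter; case fJ: (f \in J) => //=; rewrite JT.
have /hasP[f fJ fT] : has (fun f => f \notin T) J by rewrite has_count ek.
have [X hX] := iJ f fJ.
have cXf : crossing X f by rewrite hX.
(* The cut [X] separates the ends of [f], hence those of some arc on the tree path between them. *)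
have [r hr /andP[cXr crf]] : exists2 r, r \in rows & crossing X r.1 && cross r.2 f.
  apply/hasP; apply: contraTT cXf => /hasPn h.
  rewrite (tree_span tr X (sJ _ fJ)) big1_seq // => r /andP[_ hr].
  exact/negbTE/h.
have eT : r.1 \in T by apply: map_f.
have eJ : r.1 \notin J.
  by apply/negP => eJ; move: cXr fT; rewrite hX // => /eqP <-; rewrite eT.
have permJ := perm_to_rem fJ.
have remJ g : g \in rem f J -> (g \in J) && (g != f).
  by rewrite mem_rem_uniq // !inE andbC.
rewrite (perm_big _ permJ) big_cons.
apply: (@le_trans _ _ (\sum_(g <- r.1 :: rem f J) w g)%R).
  by rewrite big_cons lerD2r; apply: opt => //; apply: sJ.
apply: ih.
- by move: ek; rewrite (permP permJ) /= eT fT => -[].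
- by rewrite /= rem_uniq // andbT; apply/negP => /remJ /andP[] /(negP eJ).
- move=> g; rewrite inE => /predU1P[->|/remJ/andP[/sJ]//]; exact: (tree_sub tr).
move=> f'; rewrite inE => /predU1P[->|f'J].
  exists X => g; rewrite inE => /predU1P[->|/remJ/andP[gJ gf]]; first by rewrite cXr eqxx.
  rewrite hX // (negbTE gf); apply/esym/negbTE; apply: contraNneq eJ => <-.
  exact: gJ.
have /andP[f'J' f'f] := remJ _ f'J.
have [Y hY] := iJ f' f'J'.
(* If the new arc [r.1] crosses the old cut [Y] of [f'], adding [X] repairs this; among the other
   remaining arcs [X] is crossed by none. *)
exists (fun v => Y v (+) (crossing Y r.1 && X v)) => g.
rewrite crossing_addb inE => /predU1P[->|/remJ/andP[gJ gf]].
  rewrite cXr andbT addbb; apply/esym/negbTE; apply: contraNneq eJ => ->.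
  exact: f'J'.
by rewrite hX // (negbTE gf) andbF addbF hY.
Qed.

End Forests.

(** * Maximum-weight spanning trees *)

Lemma has_minimum (T : eqType) (le : rel T) (s : seq T) : total le -> transitive le ->
  s != [::] -> has (fun x => all (le x) s) s.
Proof.
move=> tot trans; elim: s => // x [|y s] ih _.
  by rewrite /= !orbF andbT; have := tot x x; rewrite orbb.
have /hasP[z zs /allP hz] := ih isT.
have [lexz|lezx] := orP (tot x z).
  apply/hasP; exists x; first exact: mem_head.
  apply/allP => t; rewrite inE => /predU1P[->|/hz]; last exact: trans.
  by have := tot x x; rewrite orbb.
apply/hasP; exists z; first by rewrite inE zs orbT.
by apply/allP => t; rewrite inE => /predU1P[->|/hz].
Qed.

Definition row0 : row := (((0, 0), [::]), [::]).

(** [cs] is the tree part of the cycle closed by [f], and [ms] its lightest arcs; one of them gives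
    way to [f] if it is lighter. *)
Definition insert (n : nat) (rows : seq row) (f : item) : seq row :=
  let cs := [seq r <- rows | cross r.2 f] in
  let ms := [seq r <- cs | all (fun r' : row => ble r.1.2 r'.1.2) cs] in
  if nilp ms then rows else
  if ble f.2 (head row0 ms).1.2 then rows else pivot n rows (head row0 ms) f.

(** The arcs out of vertex [0] form a spanning tree, in which the fundamental cut of [(0, v)] is the
    singleton of [v]. *)
Definition star (n : nat) (E : seq item) : seq row :=
  [seq (f, [seq i == hd f | i <- iota 0 n]) | f <- E & tl f == 0].

Definition max_tree (n : nat) (E : seq item) : seq row := foldl (insert n) (star n E) E.

Definition weight (f : item) : int := Posz (bval f.2).

Section MaxTree.
Variables (n : nat) (E : seq item).
Hypothesis n_gt0 : 0 < n.
Hypothesis E_lt : forall f : item, f \in E -> [/\ tl f < n, hd f < n & tl f != hd f].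
Hypothesis E_ex : forall u v, u < n -> v < n -> u != v ->
  exists2 f : item, f \in E & f.1 = (u, v).
Hypothesis E_inj : {in E &, injective fst}.
Hypothesis E_uniq : uniq E.

Let E0 := [seq f <- E | tl f == 0].

Lemma E0P f : f \in E0 -> [/\ f \in E, tl f = 0, 0 < hd f & hd f < n].
Proof.
rewrite mem_filter => /andP[/eqP t0 fE]; have [_ h1 h2] := E_lt fE.
by split=> //; rewrite lt0n eq_sym -t0.
Qed.

Lemma cross_star f e : e \in E ->
  cross [seq i == hd f | i <- iota 0 n] e = (tl e == hd f) (+) (hd e == hd f).
Proof.
move=> eE; have [h1 h2 _] := E_lt eE.
by rewrite /cross !(nth_map 0) ?size_iota // !nth_iota.
Qed.

Lemma perm_star_heads : perm_eq (map hd E0) (iota 1 n.-1).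
Proof.
apply: uniq_perm; [|exact: iota_uniq|].
  rewrite map_inj_in_uniq ?filter_uniq // => f g /E0P[fE tf _ _] /E0P[gE tg _ _] e.
  apply: E_inj => //; move: tf tg e; rewrite /tl /hd.
  by case: (f.1) (g.1) => a b [c d] /= -> -> ->.
move=> v; rewrite mem_iota add1n prednK //; apply/mapP/andP.
  by case=> f /E0P[_ _ h1 h2] ->.
case=> v0 vn; have [|f fE e] := E_ex n_gt0 vn; first by rewrite eq_sym -lt0n.
by exists f; rewrite ?mem_filter ?fE /tl /hd e.
Qed.

Lemma star_tree : is_tree n E (star n E).
Proof.
have fstE : map fst (star n E) = E0 by rewrite -map_comp map_id.
split.
- by rewrite fstE filter_uniq.
- by move=> r /mapP[f /E0P[fE _ _ _] ->].
- move=> _ _ /mapP[f fE ->] /mapP[g gE ->] /=.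
  have [fE' tf hf _] := E0P fE; have [gE' tg _ _] := E0P gE.
  rewrite cross_star // tg [0 == _]eq_sym -leqn0 leqNgt hf /=.
  apply/eqP/eqP => [e|-> //]; apply: E_inj => //; move: tf tg e; rewrite /tl /hd.
  by case: (f.1) (g.1) => a b [c d] /= -> -> ->.
- move=> X f fE; have [h1 h2 _] := E_lt fE.
  rewrite big_map (eq_big_seq (fun g => ((X 0 (+) X (hd g)) && (tl f == hd g)) (+)
     ((X 0 (+) X (hd g)) && (hd f == hd g)))); last first.
    move=> g /E0P[gE tg _ _] /=; rewrite cross_star // {1}/crossing tg.
    by case: (_ (+) X (hd g)).
  rewrite -(big_map hd xpredT (fun v => ((X 0 (+) X v) && (tl f == v)) (+)
     ((X 0 (+) X v) && (hd f == v)))) (perm_big _ perm_star_heads) big_split /=.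
  have h u : u < n -> \big[addb/false]_(v <- iota 1 n.-1) ((X 0 (+) X v) && (u == v)) =
      X 0 (+) X u.
    move=> un; case: (posnP u) => [->|u0].
      rewrite addbb big1_seq // => v; rewrite mem_iota => /andP[_ /andP[v0 _]].
      by rewrite eq_sym -leqn0 leqNgt v0 andbF.
    rewrite (bigD1_seq u) ?iota_uniq //=; last by rewrite mem_iota; lia.
    rewrite eqxx andbT big1 ?addbF // => v; rewrite eq_sym => /negbTE->.
    by rewrite andbF.
  by rewrite !h // /crossing addbACA addbb.
- by rewrite size_map -(size_map hd) (perm_size perm_star_heads) size_iota.
Qed.

Lemma insert_tree G rows f : f \in E -> {subset G <= E} ->
  is_tree n E rows -> optimal weight G rows ->
  is_tree n E (insert n rows f) /\ optimal weight (f :: G) (insert n rows f).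
Proof.
move=> fE sG tr opt; rewrite /insert.
set cs := [seq r <- rows | cross r.2 f]; set ms := filter _ cs.
have optf : (forall r, r \in cs -> weight f <= weight r.1)%R -> optimal weight (f :: G) rows.
  move=> h r g hr; rewrite inE => /predU1P[->|gG]; last exact: opt.
  by move=> c; apply: h; rewrite mem_filter c.
have ms_cs : nilp ms -> cs = [::].
  move=> h; apply/eqP; apply: contraTT h => cs0; rewrite /nilp -lt0n size_filter -has_count.
  apply: (@has_minimum _ (fun r r' : row => ble r.1.2 r'.1.2)) => //.
    by move=> r r'; rewrite !bleE leq_total.
  by move=> r r' r''; rewrite !bleE; apply: leq_trans.
case: ifPn => [/ms_cs cs0|ms0]; first by split=> //; apply: optf; rewrite cs0.
have : head row0 ms \in ms by move: ms0; case: (ms) => // a s _; apply: mem_head.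
set r0 := head row0 ms; rewrite mem_filter => /andP[/allP hmin].
rewrite mem_filter => /andP[c0 r0in].
case: ifPn; rewrite bleE => hle.
  split=> //; apply: optf => r hr; rewrite lez_nat; apply: leq_trans hle _.
  by have := hmin r hr; rewrite bleE.
split; first exact: pivot_tree.
apply: (@pivot_optimal n E) => //.
  by move=> r hr c; rewrite lez_nat; have := hmin r; rewrite bleE mem_filter c; apply.
by rewrite lez_nat; lia.
Qed.

Lemma max_tree_optimal : is_tree n E (max_tree n E) /\ optimal weight E (max_tree n E).
Proof.
have h F G rows : {subset F <= E} -> {subset G <= E} -> is_tree n E rows ->
    optimal weight G rows ->
    is_tree n E (foldl (insert n) rows F) /\ optimal weight (catrev F G) (foldl (insert n) rows F).
  elim: F G rows => //= f F ih G rows sF sG tr opt.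
  have fE : f \in E by apply: sF; rewrite mem_head.
  have [tr' opt'] := insert_tree fE sG tr opt.
  apply: ih => // g; first by move=> gF; apply: sF; rewrite inE gF orbT.
  by rewrite inE => /predU1P[->|/sG].
have [|||tr opt] := h E [::] _ _ _ star_tree; [by [] | by [] | by [] |].
split=> // r g hr gE; apply: opt => //.
by rewrite catrevE cats0 mem_rev.
Qed.

End MaxTree.

(** * The primal-dual algorithm *)

Definition price (y : seq (seq bool)) (v : nat) : seq bool := nth [::] y v.

(* Compares the reduced weights of [e] and [f], both sides moved so that no    *)
(* subtraction occurs.                                                         *)
Definition reduced_le (y : seq (seq bool)) (e f : item) : bool :=
  ble (badd e.2 (price y (hd f))) (badd f.2 (price y (hd e))).

Definition indeg (rows : seq row) (v : nat) : nat := size [seq r <- rows | hd r.1 == v].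

Definition exchanges (rows : seq row) (E : seq item) : seq (row * item) :=
  flatten [seq [seq (r, f) | f <- [seq f <- E | cross r.2 f]] | r <- rows].

Definition tight (y : seq (seq bool)) (ps : seq (row * item)) : seq (row * item) :=
  [seq p <- ps | reduced_le y p.1.1 p.2].

Definition deficient (q n : nat) (rows : seq row) : seq nat :=
  [seq v <- iota 0 n | indeg rows v < q].

(** An exchange [(r, f)] acts as an edge from [hd r.1], which loses an arc, to [hd f], which gains
    one. The search runs backwards along these edges. *)
Definition expand (n : nat) (ts : seq (row * item)) (D : seq nat) : seq nat :=
  [seq v <- iota 0 n | (v \in D) ||
     has (fun p : row * item => (hd p.2 \in D) && (hd p.1.1 == v)) ts].

Definition candidates (q : nat) (rows : seq row) (ts : seq (row * item)) (D : seq nat) :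
    seq (row * item) :=
  [seq p <- ts | (hd p.2 \in D) && (q < indeg rows (hd p.1.1))].

(** Stopping at the first level with a candidate makes the path of exchanges a shortest one, on
    which [exchange_candidate] relies. *)
Definition grow (q n : nat) (rows : seq row) (ts : seq (row * item)) (D : seq nat) : seq nat :=
  if nilp (candidates q rows ts D) then expand n ts D else D.

Definition leaving (ps : seq (row * item)) (D : seq nat) : seq (row * item) :=
  [seq p <- ps | (hd p.1.1 \notin D) && (hd p.2 \in D)].

(* The slack of the exchange [p] is [gain y p - loss y p]. *)
Definition gain (y : seq (seq bool)) (p : row * item) : seq bool :=
  badd p.1.1.2 (price y (hd p.2)).
Definition loss (y : seq (seq bool)) (p : row * item) : seq bool :=
  badd p.2.2 (price y (hd p.1.1)).
Definition slack_le (y : seq (seq bool)) (p p' : row * item) : bool :=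
  ble (badd (gain y p) (loss y p')) (badd (gain y p') (loss y p)).

(* Raising the prices outside [D] by the slack of [p], up to a global shift. *)
Definition raise (n : nat) (y : seq (seq bool)) (D : seq nat) (p : row * item) :
    seq (seq bool) :=
  [seq badd (price y v) (if v \in D then loss y p else gain y p) | v <- iota 0 n].

Definition pair0 : row * item := (row0, ((0, 0), [::])).

Definition state : Type := (seq row * seq (seq bool))%type.

Definition finished (q n : nat) (st : state) : bool :=
  all (fun v => indeg st.1 v <= q) (iota 0 n).

Definition step (q n : nat) (E : seq item) (st : state) : state :=
  if finished q n st then st else
  let ps := exchanges st.1 E in
  let ts := tight st.2 ps in
  let D := iter n (grow q n st.1 ts) (deficient q n st.1) in
  let cs := candidates q st.1 ts D in
  if nilp cs then
    let ls := leaving ps D in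
    let ms := [seq p <- ls | all (slack_le st.2 p) ls] in
    (st.1, raise n st.2 D (head pair0 ms))
  else (pivot n st.1 (head pair0 cs).1 (head pair0 cs).2, st.2).

Definition reduced (y : seq (seq bool)) (f : item) : int :=
  (weight f - Posz (bval (price y (hd f))))%R.

Lemma reduced_leE y e f : reduced_le y e f = (reduced y e <= reduced y f)%R.
Proof. by rewrite /reduced_le bleE !bval_badd /reduced /weight; lia. Qed.

Lemma mem_exchanges rows E r f :
  ((r, f) \in exchanges rows E) = [&& r \in rows, f \in E & cross r.2 f].
Proof.
apply/flatten_mapP/and3P.
  by case=> r' hr' /mapP[f']; rewrite mem_filter => /andP[c fE] [-> ->].
by case=> hr hf c; exists r => //; apply/mapP; exists f; rewrite // mem_filter c.
Qed.

Lemma indegE rows v : indeg rows v = \sum_(r <- rows) (hd r.1 == v).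
Proof.
by rewrite /indeg size_filter -sum1_count big_mkcond; apply: eq_bigr => r _; case: eqP.
Qed.

(** * Correctness and termination of the primal-dual method *)

Section Progress.
Variables (q n : nat) (E : seq item).
Hypothesis q_gt0 : 0 < q.
Hypothesis n_gt0 : 0 < n.
Hypothesis E_lt : forall f : item, f \in E -> [/\ tl f < n, hd f < n & tl f != hd f].
Hypothesis E_ex : forall u v, u < n -> v < n -> u != v ->
  exists2 f : item, f \in E & f.1 = (u, v).
Hypothesis E_inj : {in E &, injective fst}.

(* Complementary slackness: a price above the minimum [m] is only paid at     *)
(* vertices whose in-degree has reached [q].                                  *)
Record invariant (st : state) : Prop := Invariant {
  inv_tree : is_tree n E st.1;
  inv_opt : optimal (reduced st.2) E st.1;
  inv_slack : exists m, forall v, v < n -> m <= bval (price st.2 v) /\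
    (m < bval (price st.2 v) -> q <= indeg st.1 v)
}.

Definition excess (st : state) : nat := \sum_(v <- iota 0 n) (indeg st.1 v - q).

(** The vertices from which at most [i] tight exchanges lead to a deficient vertex. *)
Definition level (st : state) (i : nat) : seq nat :=
  iter i (expand n (tight st.2 (exchanges st.1 E))) (deficient q n st.1).

Definition has_candidate (st : state) (i : nat) : bool :=
  ~~ nilp (candidates q st.1 (tight st.2 (exchanges st.1 E)) (level st i)).

Definition is_tight (st : state) (r : row) (f : item) : bool :=
  [&& r \in st.1, f \in E, cross r.2 f & reduced st.2 r.1 <= reduced st.2 f]%R.

Lemma mem_tight st r f : ((r, f) \in tight st.2 (exchanges st.1 E)) = is_tight st r f.
Proof.
by rewrite /tight mem_filter mem_exchanges reduced_leE andbC /is_tight /= -!andbA.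
Qed.

Lemma expandP st D v :
  reflect (v < n /\ (v \in D \/ exists r f, [/\ is_tight st r f, hd f \in D & hd r.1 = v]))
    (v \in expand n (tight st.2 (exchanges st.1 E)) D).
Proof.
rewrite mem_filter mem_iota add0n andbC; apply: (iffP andP) => -[vn].
  case/orP=> [vD|/hasP[[r f]]]; first by split; last left.
  by rewrite mem_tight /= => t /andP[fD /eqP e]; split=> //; right; exists r, f.
case=> [->//|[r [f [t fD e]]]]; split=> //; apply/orP; right.
by apply/hasP; exists (r, f); rewrite ?mem_tight //= fD e eqxx.
Qed.

Lemma has_candidateP st i :
  reflect (exists r f, [/\ is_tight st r f, hd f \in level st i & q < indeg st.1 (hd r.1)])
    (has_candidate st i).
Proof.
rewrite /has_candidate /nilp -lt0n size_filter -has_count.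
apply: (iffP hasP) => [[[r f]]|[r [f [t fD o]]]].
  by rewrite mem_tight => t /andP[fD o]; exists r, f.
by exists (r, f); rewrite ?mem_tight //= fD o.
Qed.

Lemma level_lt st i v : v \in level st i -> v < n.
Proof. by case: i => [|i]; rewrite mem_filter mem_iota => /andP[_ /andP[]]. Qed.

Lemma level_uniq st i : uniq (level st i).
Proof. by case: i => [|i]; rewrite filter_uniq ?iota_uniq. Qed.

Lemma level_sub st i : {subset level st i <= level st i.+1}.
Proof. by move=> v h; apply/expandP; split; [apply: level_lt h | left]. Qed.

Lemma level_le st i j : i <= j -> {subset level st i <= level st j}.
Proof.
move=> /subnKC <-; elim: (j - i) => [|k ih] v h; first by rewrite addn0.
by rewrite addnS; apply/level_sub/ih.
Qed.

Lemma has_candidate_le st i j : i <= j -> has_candidate st i -> has_candidate st j.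
Proof.
move=> ij /has_candidateP[r [f [t fD o]]]; apply/has_candidateP; exists r, f; split=> //.
exact: (level_le ij).
Qed.

(** Starting from a non-empty set, the levels gain a vertex each time until they are stable, and
    there are only [n] vertices. *)
Lemma level_closed st : deficient q n st.1 != [::] ->
  {subset level st n.+1 <= level st n}.
Proof.
move=> d0.
have h i : {subset level st i.+1 <= level st i} \/ i < size (level st i).
  elim: i => [|i [ih|ih]]; first by right; rewrite lt0n size_eq0.
    left=> v /expandP[vn [//|[r [f [t fD e]]]]].
    by apply/expandP; split=> //; right; exists r, f; split=> //; apply: ih.
  case h: (all (mem (level st i)) (level st i.+1)).
    move/allP: h => h; left=> v /expandP[vn [//|[r [f [t fD e]]]]].
    by apply/expandP; split=> //; right; exists r, f; split=> //; apply: h.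
  right; apply: leq_ltn_trans ih _.
  have /allPn[v hv nv] := negbT h.
  apply: (@uniq_leq_size _ (v :: level st i)); first by rewrite /= nv level_uniq.
  by move=> u; rewrite inE => /predU1P[->|/level_sub].
case: (h n) => // lt.
have : size (level st n) <= size (iota 0 n).
  by apply: uniq_leq_size (level_uniq _ _) _ => v /level_lt; rewrite mem_iota.
by rewrite size_iota leqNgt lt.
Qed.

Lemma growP st m : exists i, [/\ i <= m,
  iter m (grow q n st.1 (tight st.2 (exchanges st.1 E))) (deficient q n st.1) = level st i,
  (forall j, j < i -> ~~ has_candidate st j) & i = m \/ has_candidate st i].
Proof.
elim: m => [|m [i [le_im e no ic]]]; first by exists 0; split=> //; left.
rewrite iterS e /grow; have := erefl (has_candidate st i); rewrite {1}/has_candidate.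
case: nilp => /= c.
  have em : i = m by case: ic => //; rewrite -c.
  exists i.+1; split; rewrite ?ltnS // ; [|by left; rewrite em].
  by move=> j; rewrite ltnS leq_eqVlt => /predU1P[->|/no//]; rewrite -c.
by exists i; split=> //; first [exact: leqW | right; rewrite -c].
Qed.

Lemma sum_eq_iota u : u < n -> \sum_(v <- iota 0 n) (u == v) = 1.
Proof.
move=> un; rewrite (bigD1_seq u) ?iota_uniq ?mem_iota //= eqxx big1 // => v.
by rewrite eq_sym => /negbTE->.
Qed.

Lemma sum_indeg rows : is_tree n E rows -> \sum_(v <- iota 0 n) indeg rows v = n.-1.
Proof.
move=> tr; rewrite -(tree_size tr) -sum1_size.
under eq_bigr => v _ do rewrite indegE.
rewrite exchange_big /=; apply: eq_big_seq => r hr.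
have [_ h _] := E_lt (tree_sub tr hr); exact: sum_eq_iota.
Qed.

(** A tree has [n - 1] arcs, whereas in-degrees of at least [q >= 1] everywhere would require
    [n]. *)
Lemma deficient_neq0 rows : is_tree n E rows -> deficient q n rows != [::].
Proof.
move=> tr; rewrite -size_eq0 -lt0n size_filter -has_count; apply: contraT => /hasPn h.
have : \sum_(v <- iota 0 n) q <= \sum_(v <- iota 0 n) indeg rows v.
  by rewrite big_seq [leqRHS]big_seq leq_sum // => v /h; rewrite -leqNgt.
rewrite sum_indeg // big_const_seq count_predT size_iota iter_addn_0 mulnC => hle.
have : n * 1 <= n * q by rewrite leq_mul2l q_gt0 orbT.
by lia.
Qed.

Lemma indeg_pivot rows r0 f v : is_tree n E rows -> r0 \in rows -> f \in E ->
  indeg (pivot n rows r0 f) v + (hd r0.1 == v) = indeg rows v + (hd f == v).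
Proof.
move=> tr hr0 fE; rewrite !indegE big_map.
have urows : uniq rows by apply: map_uniq (tree_uniq tr).
rewrite !(bigD1_seq r0 hr0 urows) /= (pivot_row_item E_inj _ tr hr0) // eqxx.
have -> : \sum_(r <- rows | r != r0) (hd (pivot_row n r0 f r).1 == v) =
          \sum_(r <- rows | r != r0) (hd r.1 == v).
  rewrite big_seq_cond [RHS]big_seq_cond; apply: eq_bigr => r /andP[hr ne].
  by rewrite (pivot_row_item E_inj _ tr hr0) // (negbTE ne).
by rewrite [RHS]addnC addnA addnAC.
Qed.

Lemma level_mono st st' i :
  (forall v, v < n -> indeg st.1 v < q -> indeg st'.1 v < q) ->
  (forall j r f, j < i -> is_tight st r f -> hd f \in level st j ->
     exists r', is_tight st' r' f /\ hd r'.1 = hd r.1) ->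
  forall j, j <= i -> {subset level st j <= level st' j}.
Proof.
move=> hd ht; elim=> [|j ih] ji v.
  by rewrite !mem_filter mem_iota => /andP[h1 h2]; rewrite h2 andbT; apply: hd.
case/expandP=> vn h; apply/expandP; split=> //.
case: h => [vD|[r [f [t fD e]]]]; first by left; apply: ih; rewrite 1?ltnW.
have [r' [t' e']] := ht j r f ji t fD.
by right; exists r', f; split; rewrite ?e' //; apply: ih; rewrite 1?ltnW.
Qed.

Section Exchange.
Variables (st : state) (r0 : row) (f0 : item) (i : nat).
Hypothesis inv : invariant st.
Hypothesis t0 : is_tight st r0 f0.
Hypothesis f0D : hd f0 \in level st i.
Hypothesis over0 : q < indeg st.1 (hd r0.1).
Hypothesis no_cand : forall j, j < i -> ~~ has_candidate st j.

Let st' : state := (pivot n st.1 r0 f0, st.2).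

Lemma indeg_exchange v :
  indeg (pivot n st.1 r0 f0) v + (hd r0.1 == v) = indeg st.1 v + (hd f0 == v).
Proof. by case/and4P: t0 => h1 h2 _ _; apply: indeg_pivot (inv_tree inv) h1 h2. Qed.

(** Tightness makes [r0.1] a lightest tree arc on the cycle of [f0], no heavier than [f0], so the
    tree stays optimal. The vertex that loses an arc had more than [q] of them. *)
Lemma exchange_invariant : invariant st'.
Proof.
case/and4P: t0 => r0in f0E c0 le0; have tr : is_tree n E st.1 := inv_tree inv; have opt := inv_opt inv.
split.
- exact: (pivot_tree E_lt E_inj tr r0in f0E c0).
- have h : optimal (reduced st.2) (f0 :: E) (pivot n st.1 r0 f0).
    apply: (pivot_optimal E_lt E_inj tr r0in f0E c0 _ opt _ le0) => // r hr c.
    by apply: le_trans le0 _; apply: opt.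
  by move=> r g hr gE; apply: h => //; rewrite inE gE orbT.
- have [m hm] := inv_slack inv; exists m => v vn; have [h1 h2] := hm v vn.
  split=> // /h2 h3; have := indeg_exchange v; rewrite /=.
  by case: eqP => [e|_]; [move: over0; rewrite e|]; lia.
Qed.

(** At level [0] the new arc enters a deficient vertex, which does not become overfull. *)
Lemma exchange_excess : i = 0 -> excess st' < excess st.
Proof.
move=> i0; move: f0D; rewrite i0 mem_filter => /andP[d0 _].
have hn : hd r0.1 \in iota 0 n.
  case/and4P: t0 => r0in _ _ _; rewrite mem_iota.
  by have [_ h _] := E_lt (tree_sub (inv_tree inv) r0in).
rewrite /excess !(bigD1_seq (hd r0.1)) ?iota_uniq //=.
have e0 := indeg_exchange (hd r0.1); rewrite eqxx in e0.
have ne : hd f0 != hd r0.1 by apply: contraTneq over0 => <-; rewrite -leqNgt ltnW.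
rewrite (negbTE ne) in e0.
rewrite -addSn leq_add //; first by move: over0; lia.
apply: leq_sum => v vne; have := indeg_exchange v; rewrite eq_sym (negbTE vne).
by case: eqP => [<-|_]; move: d0; lia.
Qed.

(** The head of [f0] has in-degree exactly [q], so it becomes overfull in place of one unit at
    [hd r0.1], and it is one exchange closer to a deficient vertex. That the rest of the path
    survives the pivot is where its minimal length is used. *)
Lemma exchange_candidate : 0 < i ->
  excess st' <= excess st /\ has_candidate st' i.-1.
Proof.
move=> i_gt0; have opt := inv_opt inv; have tr := inv_tree inv.
case/and4P: (t0) => r0in f0E c0 le0.
have nc : ~~ has_candidate st i.-1 by apply: no_cand; lia.
have f0n : ~~ (hd f0 \in level st i.-1).
  by apply: contra nc => h; apply/has_candidateP; exists r0, f0.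
have [r1 [f1 [t1 f1D e1]]] :
    exists r f, [/\ is_tight st r f, hd f \in level st i.-1 & hd r.1 = hd f0].
  by move: f0D; rewrite -{1}(prednK i_gt0) => /expandP[_ [h|//]]; rewrite h in f0n.
(* Above [q], the pair [(r1, f1)] would be a candidate at level [i.-1]; below [q], the vertex would
   be deficient and thus in level [0]. *)
have eq_q : indeg st.1 (hd f0) = q.
  apply/eqP; rewrite eqn_leq; apply/andP; split; rewrite leqNgt.
    by apply: contra nc => h; apply/has_candidateP; exists r1, f1; rewrite e1.
  apply: contra f0n => h; apply: (level_le (leq0n _)); rewrite mem_filter h mem_iota.
  by have [_ -> _] := E_lt f0E.
have ne : hd r0.1 != hd f0 by apply: contraTneq over0 => ->; rewrite eq_q ltnn.
have keep j r f : j <= i.-1 -> is_tight st r f -> hd f \in level st j ->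
    exists r', is_tight st' r' f /\ hd r'.1 = hd r.1.
  move=> ji t fD; case/and4P: (t) => rin fE c le.
  have rr0 : r != r0.
    apply: contra nc => /eqP e; apply/has_candidateP; exists r0, f; rewrite -{1}e.
    by split=> //; apply: (level_le ji).
  have item_r : (pivot_row n r0 f0 r).1 = r.1.
    by rewrite (pivot_row_item E_inj _ tr r0in) // (negbTE rr0).
  exists (pivot_row n r0 f0 r); split; last by rewrite item_r.
  rewrite /is_tight map_f //= fE item_r le andbT.
  rewrite (pivot_row_cross E_lt E_inj _ tr r0in) // (negbTE rr0) c /=.
  (* Only in this case does [f] leave the cut of [r]. But then the reduced weights of [r0.1], [f0],
     [r.1], [f] are non-decreasing in this order, so [(r0, f)] is tight and a candidate below level
     [i]. *)
  apply/negP => /andP[crf0 c0f].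
  have h1 := opt _ _ rin f0E crf0.
  have h2 : ~~ (reduced st.2 r0.1 <= reduced st.2 f)%R.
    apply: contra nc => h; apply/has_candidateP; exists r0, f; split=> //.
      by rewrite /is_tight r0in fE c0f h.
    exact: (level_le ji).
  by case/negP: h2; apply: le_trans le0 (le_trans h1 le).
have r0n : hd r0.1 < n by have [] := E_lt (tree_sub tr r0in).
have f0n' : hd f0 < n by have [] := E_lt f0E.
have indeg_f0 : indeg (pivot n st.1 r0 f0) (hd f0) = q.+1.
  by have := indeg_exchange (hd f0); rewrite (negbTE ne) eqxx eq_q; clear; lia.
split.
  rewrite -(leq_add2r 1) -{1}(sum_eq_iota r0n) -(sum_eq_iota f0n') /excess -!big_split /=.
  apply: leq_sum => v _; have := indeg_exchange v.
  have [<-|_] := eqVneq (hd r0.1) v.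
    by rewrite eq_sym (negbTE ne) /=; move: over0; clear; lia.
  by have [<-|_] := eqVneq (hd f0) v; rewrite /= ?eq_q; clear; lia.
have sub : forall j, j <= i -> {subset level st j <= level st' j}.
  apply: level_mono => [v vn hv|j r f ji] /=.
    have := indeg_exchange v; have [e|_] := eqVneq (hd r0.1) v.
      by move: over0 hv; rewrite e; clear; lia.
    have [e|_] := eqVneq (hd f0) v; last by move: hv; clear; lia.
    by move: hv; rewrite -e eq_q ltnn.
  by apply: keep; move: ji; clear; lia.
have [r' [t' e']] := keep i.-1 r1 f1 (leqnn _) t1 f1D.
apply/has_candidateP; exists r', f1; split=> //.
  by apply: sub => //; exact: leq_pred.
by rewrite e' e1 /= indeg_f0.
Qed.

End Exchange.

(** All arcs are available, so a vertex on the other side of the cut from [u] sends one to [u]. *)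
Lemma cut_arc rows r u : is_tree n E rows -> r \in rows -> u < n ->
  exists f, [/\ f \in E, cross r.2 f & hd f = u].
Proof.
move=> tr hr un; have [h1 h2 _] := E_lt (tree_sub tr hr).
have c : cross r.2 r.1 by rewrite (tree_dual tr) // eqxx.
have [a an ca] : exists2 a, a < n & nth false r.2 a (+) nth false r.2 u.
  case c1: (nth false r.2 (tl r.1) (+) nth false r.2 u); first by exists (tl r.1).
  by exists (hd r.1) => //; move: c c1; rewrite /cross; do 3! case: (nth _ _ _).
have ne : a != u by apply: contraTneq ca => ->; rewrite addbb.
have [f fE ef] := E_ex an un ne.
by exists f; split=> //; rewrite /cross /tl /hd ef.
Qed.

Section Raise.
Variables (st : state).
Hypothesis inv : invariant st.
Hypothesis unfinished : ~~ finished q n st.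
Hypothesis no_cand : ~~ has_candidate st n.

Let D := level st n.
Let ls := leaving (exchanges st.1 E) D.

Lemma mem_leaving r f : ((r, f) \in ls) =
  [&& r \in st.1, f \in E, cross r.2 f, hd r.1 \notin D & hd f \in D].
Proof. by rewrite mem_filter mem_exchanges /= andbC -!andbA. Qed.

Lemma slack_leE y x x' : slack_le y x x' =
  (bval (gain y x) + bval (loss y x') <= bval (gain y x') + bval (loss y x)).
Proof. by rewrite /slack_le bleE !bval_badd. Qed.

Lemma level_deficient v : v < n -> v \notin D -> q <= indeg st.1 v.
Proof.
move=> vn vD; rewrite leqNgt; apply: contra vD => h.
by apply: (level_le (leq0n _)); rewrite mem_filter h mem_iota.
Qed.

(** An overfull vertex lies outside [D], since on entering it would have given a candidate. The cut
    of a tree arc into it is crossed by an arc into a deficient vertex, so some exchange leads into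
    [D], and one of least slack exists. *)
Lemma raise_pairP (p := head pair0 [seq p <- ls | all (slack_le st.2 p) ls]) :
  [/\ p.1 \in st.1, p.2 \in E, cross p.1.2 p.2, hd p.1.1 \notin D &
  hd p.2 \in D /\ forall r f, (r, f) \in ls -> slack_le st.2 p (r, f)].
Proof.
have tr := inv_tree inv.
have ls0 : ls != [::].
  have /allPn[v hv] := unfinished; rewrite -ltnNge => ov.
  have vn : v < n by rewrite mem_iota in hv.
  have vD : v \notin D.
    apply/negP => /(level_sub (i := n)).
    have : deficient q n st.1 != [::] by apply: deficient_neq0.
    move=> d0 /expandP[_ [vD|[r [f [t fD e]]]]]; last first.
      by case/negP: no_cand; apply/has_candidateP; exists r, f; rewrite e.
    have hlev i : v \in level st i -> i <= n -> False.
      elim: i => [|i ih]; first by rewrite mem_filter ltnNge (ltnW ov).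
      case/expandP=> _ [h /ltnW|[r [f [t fD e]]]] hi; first exact: ih.
      case/negP: no_cand; apply: (has_candidate_le (ltnW hi)).
      by apply/has_candidateP; exists r, f; rewrite e.
    exact: hlev vD (leqnn n).
  have [r hr er] : exists2 r, r \in st.1 & hd r.1 = v.
    have : 0 < indeg st.1 v by lia.
    by rewrite /indeg size_filter -has_count => /hasP[r hr /eqP e]; exists r.
  have : deficient q n st.1 != [::] by apply: deficient_neq0.
  case ed : (deficient q n st.1) => [//|u d] _.
  have uD : u \in D by apply: (level_le (leq0n _)); rewrite /level /= ed mem_head.
  have [f [fE c ef]] := cut_arc tr hr (level_lt uD).
  have : (r, f) \in ls by rewrite mem_leaving hr fE c er vD ef uD.
  by case: (ls).
have : has (fun x => all (slack_le st.2 x) ls) ls.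
  apply: has_minimum => //; first by move=> x x'; rewrite !slack_leE; lia.
  by move=> x x' x''; rewrite !slack_leE; lia.
rewrite has_filter => h0.
have : p \in [seq p <- ls | all (slack_le st.2 p) ls].
  by rewrite /p; case: (filter _ _) h0 => // a s _; apply: mem_head.
rewrite mem_filter => /andP[/allP hmin]; case: p hmin => r f hmin; rewrite mem_leaving.
by case/and5P=> *; split=> //; split=> // *; apply: hmin.
Qed.

Variable p : row * item.
Hypothesis hp : [/\ p.1 \in st.1, p.2 \in E, cross p.1.2 p.2, hd p.1.1 \notin D &
  hd p.2 \in D /\ forall r f, (r, f) \in ls -> slack_le st.2 p (r, f)].
Let st' : state := (st.1, raise n st.2 D p).
Let cost (f : item) := bval f.2.
Let pay (v : nat) := bval (price st.2 v).
Let G := cost p.1.1 + pay (hd p.2).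
Let L := cost p.2 + pay (hd p.1.1).

Lemma reducedE f : reduced st.2 f = (Posz (cost f) - Posz (pay (hd f)))%R.
Proof. by []. Qed.

Lemma reduced_raise f : hd f < n -> reduced st'.2 f =
  (Posz (cost f) - Posz (pay (hd f)) - Posz (if hd f \in D then L else G))%R.
Proof.
move=> fn; rewrite /reduced {1}/price (nth_map 0) ?size_iota // nth_iota //.
rewrite bval_badd add0n PoszD opprD addrA.
by case: ifP => _; rewrite bval_badd.
Qed.

Lemma raise_min r f : (r, f) \in ls ->
  G + (cost f + pay (hd r.1)) <= cost r.1 + pay (hd f) + L.
Proof.
by have [_ _ _ _ [_ h]] := hp; move/h; rewrite slack_leE /gain /loss !bval_badd.
Qed.

Lemma loss_le_gain : L <= G.
Proof.
have [h1 h2 h3 _ _] := hp; have := inv_opt inv h1 h2 h3.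
by rewrite !reducedE /L /G; move: (cost _) (cost _) (pay _) (pay _) => a b c d; lia.
Qed.

(** Heads outside [D] lose [G] in reduced weight and those inside lose [L <= G]. This can only harm
    exchanges in [ls], which have at least the slack [G - L] of [p]. *)
Lemma raise_invariant : invariant st'.
Proof.
have [h1 h2 h3 h4 [h5 _]] := hp; have hlg := loss_le_gain.
have tr := inv_tree inv; have opt := inv_opt inv.
split=> //.
- move=> r g hr gE c; have := opt _ _ hr gE c.
  have [_ rn _] := E_lt (tree_sub tr hr); have [_ gn _] := E_lt gE.
  rewrite !reducedE !reduced_raise //; have := @raise_min r g.
  rewrite mem_leaving hr gE c; move: hlg.
  move: (cost g) (cost r.1) (pay (hd g)) (pay (hd r.1)) (L) (G) => a b c' d l k.
  clear; case: (hd r.1 \in D); case: (hd g \in D) => /=.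
  + by lia.
  + by lia.
  + by move=> _ /(_ isT); lia.
  + by lia.
(* Every price grows by at least [L]. It grows by more only outside [D], where no vertex is
   deficient. *)
- have [m hm] := inv_slack inv; exists (m + L) => v vn.
  have -> : bval (price st'.2 v) = pay v + (if v \in D then L else G).
    rewrite {1}/price (nth_map 0) ?size_iota // nth_iota // bval_badd add0n.
    by case: ifP => _; rewrite bval_badd.
  have [hm1 hm2] := hm v vn; rewrite -/(pay v) in hm1 hm2; case: ifPn => [vD|vD].
    by rewrite leq_add2r ltn_add2r.
  by split; [apply: leq_add | move=> _; apply: level_deficient].
Qed.

(** Tight exchanges between heads in [D] stay tight, as both reduced weights drop by [L]. The
    exchange [p] becomes tight and brings in [hd p.1.1]. *)
Lemma raise_level : size (level st n) < size (level st' n).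
Proof.
have [h1 h2 h3 h4 [h5 _]] := hp.
have tr := inv_tree inv.
have sub : forall j, j <= n -> {subset level st j <= level st' j}.
  apply: level_mono => // j r f jn t fD; exists r; split=> //.
  have fD' : hd f \in D by apply: (level_le (ltnW jn)).
  case/and4P: (t) => rin fE c le.
  have [_ rn _] := E_lt (tree_sub tr rin); have [_ fn _] := E_lt fE.
  have rD' : hd r.1 \in D.
    by apply: (level_le jn); apply/expandP; split=> //; right; exists r, f.
  rewrite /is_tight rin fE c /= !reduced_raise // rD' fD'.
  by rewrite !lerD2r -!reducedE.
apply: (@uniq_leq_size _ (hd p.1.1 :: level st n)); first by rewrite /= h4 level_uniq.
have [_ rn _] := E_lt (tree_sub tr h1); have [_ fn _] := E_lt h2.
move=> v; rewrite inE => /predU1P[->|/(sub n (leqnn _))//].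
apply: level_closed; first exact: deficient_neq0.
apply/expandP; split=> //; right; exists p.1, p.2; split=> //; last exact: (sub n).
rewrite /is_tight h1 h2 h3 /= !reduced_raise // h5 (negbTE h4) /L /G.
by move: (cost p.1.1) (cost p.2) (pay (hd p.1.1)) (pay (hd p.2)) => a b c d; clear; lia.
Qed.

End Raise.

(** A bound on the steps until the excess drops: a candidate at level [i] needs at most [i] further
    exchanges before that. Without a candidate each price change enlarges the last level; the
    summand [n.+1] ranks this situation above every level. *)
Definition near (st : state) (k : nat) : Prop :=
  (exists i, [/\ i <= k, i <= n & has_candidate st i]) \/ n.+1 + (n - size (level st n)) <= k.

Lemma near_max st : near st n.*2.+1.
Proof. by right; rewrite -addnn; lia. Qed.

Lemma step_progress st k : invariant st -> ~~ finished q n st -> near st k ->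
  invariant (step q n E st) /\
  (excess (step q n E st) < excess st \/
   (excess (step q n E st) <= excess st /\ exists2 k', k' < k & near (step q n E st) k')).
Proof.
move=> inv unf nr; rewrite /step (negbTE unf).
have [i [le_in -> no ic]] := growP st n.
case: ifPn => [nc|c].
  have ei : i = n by case: ic => //; rewrite /has_candidate nc.
  have nc' : ~~ has_candidate st n by rewrite -ei /has_candidate nc.
  rewrite ei; have hp := raise_pairP inv unf nc'.
  split; first exact: raise_invariant.
  right; split=> //.
  have hk : n.+1 + (n - size (level st n)) <= k.
    by case: nr => // -[j [_ jn cj]]; rewrite (has_candidate_le jn cj) in nc'.
  have lt := raise_level inv hp; set st' := (X in near X).
  have le_n : size (level st' n) <= n.
    rewrite -[leqRHS](size_iota 0 n); apply: uniq_leq_size (level_uniq _ _) _.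
    by move=> v /level_lt; rewrite mem_iota.
  exists (n.+1 + (n - size (level st' n))); last by right.
  by apply: leq_trans hk; rewrite -/st' in lt; lia.
set x := head pair0 _.
have : x \in candidates q st.1 (tight st.2 (exchanges st.1 E)) (level st i).
  by rewrite /x; case: (candidates _ _ _ _) c => // a s _; apply: mem_head.
rewrite mem_filter; case: x => r0 f0; rewrite mem_tight /= => /andP[/andP[f0D ov] t0].
split; first exact: (exchange_invariant inv t0 f0D ov).
case: (posnP i) => [i0|i_gt0]; first by left; apply: (exchange_excess inv t0 f0D ov i0).
right; have [h1 h2] := exchange_candidate inv t0 f0D ov no i_gt0.
split=> //; exists k.-1.
  by case: nr => [[j [jk _ cj]]|]; [|lia]; case: (ltnP j i) => [/no|]; [rewrite cj | lia].
left; exists i.-1; split=> //; last by lia.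
by case: nr => [[j [jk _ cj]]|]; [|lia]; case: (ltnP j i) => [/no|]; [rewrite cj | lia].
Qed.

(** Lexicographic descent: when the excess drops, the potential is reset to at most [n.*2.+1] by
    [near_max]. *)
Lemma iter_step_finished N e k st : invariant st -> excess st <= e -> near st k ->
  e * n.*2.+2 + k < N ->
  invariant (iter N (step q n E) st) /\ finished q n (iter N (step q n E) st).
Proof.
elim: N e k st => // N ih e k st inv ex nr lt; rewrite iterSr.
have [fin|unf] := boolP (finished q n st).
  have -> : step q n E st = st by rewrite /step fin.
  have -> : iter N (step q n E) st = st by elim: (N) => //= m ->; rewrite /step fin.
  by [].
have [inv' [lt'|[le' [k' kk' nr']]]] := step_progress inv unf nr.
  case: e ex lt => [|e] ex lt; first by move: lt'; lia.
  by apply: (ih e n.*2.+1) => //; [lia | exact: near_max | rewrite mulSn in lt; lia].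
by apply: (ih e k') => //; lia.
Qed.

(** The initial excess is at most [n], and each unit of it lasts at most [n.*2.+2] steps. The empty
    list of prices is read as zero everywhere. *)
Definition run : state :=
  iter (n.+1 * n.*2.+2) (step q n E) (max_tree n E, [::]).

Hypothesis E_uniq : uniq E.

Lemma run_finished : invariant run /\ finished q n run.
Proof.
have [tr opt] := max_tree_optimal n_gt0 E_lt E_ex E_inj E_uniq.
have pr v : price [::] v = [::] by rewrite /price nth_nil.
apply: (@iter_step_finished _ n n.*2.+1); [ | | exact: near_max | by lia].
  split=> //=; last by exists 0 => v _; rewrite pr.
  by move=> r g hr gE c; rewrite /reduced !pr /= !subr0; apply: opt.
apply: leq_trans (leq_pred n); rewrite -(sum_indeg tr) /excess /=.
by apply: leq_sum => v _; lia.
Qed.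

Lemma run_max J : uniq J -> {subset J <= E} -> independent J ->
  (forall v, v < n -> \sum_(f <- J) (hd f == v) <= q) ->
  \sum_(f <- J) bval f.2 <= \sum_(r <- run.1) bval r.1.2.
Proof.
move=> uJ sJ iJ dJ; have [inv fin] := run_finished.
have [m hm] := inv_slack inv; have tr := inv_tree inv; have opt := inv_opt inv.
pose z v := bval (price run.2 v) - m.
pose w f : int := (weight f - Posz (z (hd f)))%R.
have wE f : f \in E -> w f = (reduced run.2 f + Posz m)%R.
  move=> fE; have [_ fn _] := E_lt fE; have [h _] := hm _ fn.
  by rewrite /w /reduced /z; lia.
have opt' : optimal w E run.1.
  move=> r g hr gE c; rewrite !wE // ?(tree_sub tr) // lerD2r; exact: opt.
(* A deficient vertex [u] has [z u = 0], and every fundamental cut is crossed by an arc into [u], of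
   non-negative weight. *)
have w0 r : r \in run.1 -> (0 <= w r.1)%R.
  move=> hr; have := deficient_neq0 tr.
  case ed: (deficient q n run.1) => [//|u d] _.
  have : u \in deficient q n run.1 by rewrite ed mem_head.
  rewrite mem_filter mem_iota => /andP[uq /andP[_ un]].
  have [f [fE c ef]] := cut_arc tr hr un.
  apply: le_trans (opt' _ _ hr fE c); rewrite /w ef /z.
  have [h1 h2] := hm u un; have : ~~ (m < bval (price run.2 u)).
    by apply/negP => /h2; rewrite leqNgt uq.
  by rewrite /weight; lia.
have hw := forest_weight_le tr opt' w0 uJ sJ iJ.
have zsum (I : eqType) (s : seq I) (h : I -> nat) : (forall i, i \in s -> h i < n) ->
    \sum_(i <- s) z (h i) = \sum_(v <- iota 0 n) z v * (\sum_(i <- s) (h i == v)).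
  move=> hs; under [RHS]eq_bigr => v _ do rewrite big_distrr /=.
  rewrite exchange_big /=; apply: eq_big_seq => i /hs hi.
  rewrite (bigD1_seq (h i)) ?iota_uniq ?mem_iota //= eqxx muln1 big1 ?addn0 // => v.
  by rewrite eq_sym => /negbTE->; rewrite muln0.
(* Where [z v > 0], the forest has in-degree at most [q] and the tree at least [q]. *)
have hz : \sum_(f <- J) z (hd f) <= \sum_(r <- run.1) z (hd r.1).
  rewrite !zsum; [| by move=> r /(tree_sub tr) /E_lt[] | by move=> f /sJ /E_lt[]].
  rewrite big_seq [leqRHS]big_seq; apply: leq_sum => v; rewrite mem_iota => /andP[_ vn].
  have [h1 h2] := hm v vn; rewrite -indegE /z.
  case: (ltnP m (bval (price run.2 v))) => [/h2 h3|]; last by rewrite -subn_eq0 => /eqP->.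
  by rewrite leq_mul2l (leq_trans (dJ v vn)) ?orbT.
have wsum (I : Type) (s : seq I) (h : I -> item) :
    (\sum_(i <- s) w (h i) = Posz (\sum_(i <- s) bval (h i).2) -
       Posz (\sum_(i <- s) z (hd (h i))))%R.
  by elim: s => [|i s ih]; rewrite ?big_nil // !big_cons ih /w /weight; lia.
move: hw hz; rewrite (wsum _ J (fun f => f)) (wsum _ _ fst).
move: (\sum_(f <- J) bval _) (\sum_(f <- J) z _) (\sum_(r <- run.1) z _).
by move: (\sum_(r <- run.1) _) => a b c d; clear; lia.
Qed.

End Progress.

(** * Polynomial running time of the algorithm *)

(** The list lemmas read elements with [head] and need a default; this class lets [poly_auto] supply
    it. *)
Class default (A : Type) := dflt : A.
Instance default_bool : default bool := false.
Instance default_nat : default nat := 0.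
Instance default_seq A : default (seq A) := [::].
Instance default_option A : default (option A) := None.
Instance default_prod A B (dA : default A) (dB : default B) : default (A * B) := (dflt, dflt).

Lemma poly_mem_nat A {eA : encodable A} (v : A -> nat) (D : A -> seq nat) :
  poly v -> poly D -> poly (fun a => v a \in D a).
Proof.
move=> pv pD.
have h : poly (fun a => has (fun u => u == v a) (D a)).
  apply: (@poly_has _ _ _ _ 0 (fun a u => u == v a)) => //.
  apply: poly_eqn; first exact: poly_snd poly_id.
  by apply: (poly_comp pv); apply: poly_fst poly_id.
by apply: (poly_enc _ h) => a; congr enc; rewrite has_pred1.
Qed.

Ltac poly_hook := fail.

Ltac poly_eta := match goal with
  |- @poly ?A ?B ?eA ?eB ?f => change (@poly A B eA eB (fun x => f x)); cbv beta end.

Ltac poly_step := poly_eta; first [exact poly_id | exact (poly_const _) | lazymatch goal with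
  | |- poly (fun x => (@?f x, @?g x)) => eapply (@poly_pair _ _ _ _ _ _ f g)
  | |- poly (fun x => (@?f x).1) => eapply (@poly_fst _ _ _ _ _ _ f)
  | |- poly (fun x => (@?f x).2) => eapply (@poly_snd _ _ _ _ _ _ f)
  | |- poly (fun x => @?f x && @?g x) => eapply (@poly_andb _ _ f g)
  | |- poly (fun x => @?f x || @?g x) => eapply (@poly_orb _ _ f g)
  | |- poly (fun x => @?f x (+) @?g x) => eapply (@poly_addb _ _ f g)
  | |- poly (fun x => ~~ @?f x) => eapply (@poly_negb _ _ f)
  | |- poly (fun x => @?f x :: @?g x) => eapply (@poly_cons _ _ _ _ f g)
  | |- poly (fun x => @?f x ++ @?g x) => eapply (@poly_cat _ _ _ _ dflt f g)
  | |- poly (fun x => rev (@?f x)) => eapply (@poly_rev _ _ _ _ dflt f)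
  | |- poly (fun x => behead (@?f x)) => eapply (@poly_behead _ _ _ _ f)
  | |- poly (fun x => head ?d (@?f x)) => eapply (@poly_head _ _ _ _ d f)
  | |- poly (fun x => nth ?d (@?f x) (@?g x)) => eapply (@poly_nth _ _ _ _ d f g)
  | |- poly (fun x => drop (@?f x) (@?g x)) => eapply (@poly_drop _ _ _ _ f g)
  | |- poly (fun x => nilp (@?f x)) => eapply (@poly_nilp _ _ _ _ f)
  | |- poly (fun x => flatten (@?f x)) => eapply (@poly_flatten _ _ _ _ dflt f)
  | |- poly (fun x => size (@?f x)) => eapply (@poly_seq_size _ _ _ _ dflt f)
  | |- poly (fun x => map (@?f x) (@?g x)) => eapply (@poly_map _ _ _ _ _ _ dflt dflt f g)
  | |- poly (fun x => filter (@?f x) (@?g x)) => eapply (@poly_filter _ _ _ _ dflt f g)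
  | |- poly (fun x => all (@?f x) (@?g x)) => eapply (@poly_all _ _ _ _ dflt f g)
  | |- poly (fun x => has (@?f x) (@?g x)) => eapply (@poly_has _ _ _ _ dflt f g)
  | |- poly (fun x => iota 0 (@?f x)) => eapply (@poly_iota0 _ _ f)
  | |- poly (fun x => maxn (@?f x) (@?g x)) => eapply (@poly_maxn _ _ f g)
  | |- poly (fun x => (@?f x).+1) => eapply (@poly_succ _ _ f)
  | |- poly (fun x => (@?f x).-1) => eapply (@poly_pred _ _ f)
  | |- poly (fun x => @?f x + @?g x) => eapply (@poly_addn _ _ f g)
  | |- poly (fun x => @?f x * @?g x) => eapply (@poly_muln _ _ f g)
  | |- poly (fun x => @?f x - @?g x) => eapply (@poly_subn _ _ f g)
  | |- poly (fun x => @?f x <= @?g x) => eapply (@poly_leq _ _ f g)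
  | |- poly (fun x => @eq_op _ (@?f x) (@?g x)) => eapply (@poly_eqn _ _ f g)
  | |- poly (fun x => @in_mem _ (@?f x) (mem (@?g x))) => eapply (@poly_mem_nat _ _ f g)
  | |- poly (fun x => isSome (@?f x)) => eapply (@poly_is_some _ _ _ _ f)
  | |- poly (fun x => odflt ?d (@?f x)) => eapply (@poly_odflt _ _ _ _ d f)
  | |- poly _ => first [poly_hook | apply: poly_if]
  end].

Ltac poly_auto := repeat (assumption || poly_step).

Section Bits.
Context {A : Type} {eA : encodable A}.
Implicit Types a b : A -> seq bool.

Lemma poly_pad a b : poly a -> poly b -> poly (fun x => pad (a x) (b x)).
Proof. by apply: (@poly_comp2 _ _ _ _ _ _ _ _ pad); rewrite /pad; poly_auto. Qed.

End Bits.

Section Bits2.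
Context {A : Type} {eA : encodable A}.
Implicit Types a b : A -> seq bool.

Lemma poly_badd a b : poly a -> poly b -> poly (fun x => badd (a x) (b x)).
Proof.
apply: (@poly_comp2 _ _ _ _ _ _ _ _ badd).
have h : poly (fun p : seq bool * seq bool => foldl add_step (false, [::]) (pad p.1 p.2)).
  apply: (@poly_foldl _ _ _ _ _ _ dflt (fun _ => add_step) _ _ (fun n => 4 * (2 * n) + 1 + 4)).
  - by pb.
  - move=> p i.
    have hs s l : size (foldl add_step s l).2 = size s.2 + size l.
      by elim: l s => [|x l ih] s /=; rewrite ?addn0 // ih /= addSnnS.
    rewrite esize_pair.
    pose proof (esize_bool (foldl add_step (false, [::]) (take i (pad p.1 p.2))).1) as h1.
    pose proof (esize_bits (foldl add_step (false, [::]) (take i (pad p.1 p.2))).2) as h2.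
    rewrite hs /= add0n size_take_min in h2.
    have h3 : size (pad p.1 p.2) <= esize p.
      rewrite size_map size_iota esize_pair.
      pose proof (leq_size_esize p.1); pose proof (leq_size_esize p.2); lia.
    by lia.
  - by rewrite /add_step; poly_auto.
  - by apply: poly_pad; poly_auto.
  - exact: poly_const.
by rewrite /badd; poly_auto.
Qed.

Lemma poly_ble a b : poly a -> poly b -> poly (fun x => ble (a x) (b x)).
Proof.
apply: (@poly_comp2 _ _ _ _ _ _ _ _ ble); rewrite /ble.
apply: (@poly_foldl _ _ _ _ _ _ dflt (fun _ => ble_step) _ _ (fun n => 3)).
- by pb.
- by move=> p i; apply: esize_bool.
- by rewrite /ble_step; poly_auto.
- by apply: poly_pad; poly_auto.
- exact: poly_const.
Qed.

End Bits2.

Ltac poly_hook ::= first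
  [ apply: poly_badd | apply: poly_ble ].

Section Algorithm.
Context {A : Type} {eA : encodable A}.

Lemma poly_cross (X : A -> seq bool) (f : A -> item) : poly X -> poly f ->
  poly (fun a => cross (X a) (f a)).
Proof. by move=> pX pf; rewrite /cross /tl /hd; poly_auto. Qed.

Lemma poly_pivot (n : A -> nat) (rows : A -> seq row) (r0 : A -> row) (f : A -> item) :
  poly n -> poly rows -> poly r0 -> poly f ->
  poly (fun a => pivot (n a) (rows a) (r0 a) (f a)).
Proof.
move=> pn prows pr0 pf.
apply: (@poly_comp2 _ _ _ _ _ _ _ _ (fun (p : nat * seq row) (q : row * item) =>
  pivot p.1 p.2 q.1 q.2) (fun a => (n a, rows a)) (fun a => (r0 a, f a))); try by poly_auto.
by rewrite /pivot /pivot_row /same_arc /cross /tl /hd; poly_auto.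
Qed.

End Algorithm.

Ltac poly_hook ::= first
  [ apply: poly_badd | apply: poly_ble | apply: poly_cross | apply: poly_pivot ].

(** Arcs and vectors are bounded separately: a pivot only reuses given arcs and makes vectors of
    length [n], so these bounds survive any number of pivots. *)
Definition rows_bounded (k m : nat) (rows : seq row) : Prop :=
  size rows <= k /\ forall r, r \in rows -> esize r.1 <= m /\ esize r.2 <= m.

Lemma esize_rows k m rows : rows_bounded k m rows -> esize rows <= k * (m + m + 2) + 1.
Proof.
case=> hk h; apply: leq_trans (@esize_seq_le _ _ rows (m + m + 1) _) _.
  move=> i hi r; have [h1 h2] := h _ (mem_nth r hi); rewrite esize_pair.
  by rewrite addn1 ltnS leq_add.
by rewrite leq_add2r -[(m + m + 1).+1]addnS leq_mul.
Qed.

Lemma pivot_bounded k m n rows r0 f : rows_bounded k m rows -> r0 \in rows ->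
  esize f <= m -> 4 * n + 1 <= m -> rows_bounded k m (pivot n rows r0 f).
Proof.
move=> [hk h] hr0 hf hn; split; first by rewrite size_map.
move=> _ /mapP[r hr ->]; have [h1 h2] := h _ hr; have [h3 h4] := h _ hr0.
rewrite /pivot_row; case: ifP => _ //; case: ifP => _ //; split=> //=.
by apply: leq_trans (esize_bits _) _; rewrite size_map size_iota.
Qed.

Lemma head_mem (T : eqType) (x0 : T) (s : seq T) : ~~ nilp s -> head x0 s \in s.
Proof. by case: s => //= x s _; rewrite mem_head. Qed.

Lemma insert_bounded k m n rows f : rows_bounded k m rows ->
  esize f <= m -> 4 * n + 1 <= m -> rows_bounded k m (insert n rows f).
Proof.
move=> hb hf hn; rewrite /insert; set ms := filter _ _.
case: ifPn => // /(head_mem row0); rewrite 2!mem_filter => /and3P[_ _ h].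
by case: ifP => // _; apply: pivot_bounded.
Qed.

Lemma star_bounded n E m : esize E <= m -> 4 * n + 1 <= m -> rows_bounded m m (star n E).
Proof.
move=> hE hn; split.
  rewrite size_map; apply: leq_trans hE; apply: leq_trans (leq_size_esize _).
  by rewrite size_filter count_size.
move=> r /mapP[f]; rewrite mem_filter => /andP[_ fE] -> /=; split.
  by apply: leq_trans (ltnW (esize_mem fE)) hE.
by apply: leq_trans (esize_bits _) _; rewrite size_map size_iota.
Qed.

Lemma foldl_insert_bounded k m n rows F : rows_bounded k m rows ->
  (forall f, f \in F -> esize f <= m) -> 4 * n + 1 <= m ->
  rows_bounded k m (foldl (insert n) rows F).
Proof.
elim: F rows => //= f F ih rows hb hF hn; apply: ih => //; last first.
  by move=> g gF; apply: hF; rewrite inE gF orbT.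
by apply: insert_bounded => //; apply: hF; rewrite mem_head.
Qed.

Lemma esize_env (a : nat * seq item) : 4 * a.1 + 1 <= 2 * esize a /\ esize a.2 <= 2 * esize a.
Proof. by rewrite esize_pair esize_nat; split; lia. Qed.

Lemma max_tree_bounded (a : nat * seq item) :
  rows_bounded (2 * esize a) (2 * esize a) (max_tree a.1 a.2).
Proof.
have [h1 h2] := esize_env a.
apply: foldl_insert_bounded => //; first exact: star_bounded.
by move=> f fE; apply: leq_trans (ltnW (esize_mem fE)) h2.
Qed.

Lemma poly_max_tree : poly (fun a : nat * seq item => max_tree a.1 a.2).
Proof.
rewrite /max_tree.
apply: (@poly_foldl _ _ _ _ _ _ dflt (fun a : nat * seq item => insert a.1) snd _
  (fun n => 2 * n * (2 * n + 2 * n + 2) + 1)).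
- by pb.
- move=> a i; have [h1 h2] := esize_env a.
  apply: esize_rows; apply: foldl_insert_bounded => //; first exact: star_bounded.
  by move=> f /mem_take fE; apply: leq_trans (ltnW (esize_mem fE)) h2.
- rewrite /insert.
  have pcs : poly (fun z : nat * seq item * seq row * item =>
    [seq r <- z.1.2 | cross r.2 z.2]) by poly_auto.
  have pms : poly (fun z : nat * seq item * seq row * item =>
    [seq r <- [seq r <- z.1.2 | cross r.2 z.2]
     | all (fun r' : row => ble r.1.2 r'.1.2) [seq r <- z.1.2 | cross r.2 z.2]]).
    apply: (@poly_comp _ _ _ _ _ _ (fun cs : seq row =>
      [seq r <- cs | all (fun r' : row => ble r.1.2 r'.1.2) cs])) => //; poly_auto.
  by poly_auto.
- by poly_auto.
- by rewrite /star /tl /hd; poly_auto.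
Qed.

Section Step.
Variable q : nat.

Lemma esize_iter_grow n rows ts i :
  esize (iter i (grow q n rows ts) (deficient q n rows)) <= n * (2 * n + 2) + 1.
Proof.
have h : esize (iota 0 n) <= n * (2 * n + 2) + 1.
  apply: leq_trans (@esize_seq_le _ _ (iota 0 n) (2 * n + 1) _) _.
    by move=> j; rewrite size_iota => hj x; rewrite nth_iota // esize_nat; lia.
  by rewrite size_iota leq_add2r leq_mul //; lia.
apply: leq_trans h; elim: i => [|i ih]; first exact: esize_filter.
by rewrite iterS /grow; case: ifP => // _; apply: esize_filter.
Qed.

Lemma poly_grow : poly (fun z : nat * seq row * seq (row * item) =>
  iter z.1.1 (grow q z.1.1 z.1.2 z.2) (deficient q z.1.1 z.1.2)).
Proof.
apply: (@poly_iter _ _ _ _ (fun z : nat * seq row * seq (row * item) =>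
  grow q z.1.1 z.1.2 z.2) (fun z => z.1.1) _ (fun n => n * (2 * n + 2) + 1)).
- by pb.
- move=> z i _; apply: leq_trans (esize_iter_grow _ _ _ _) _.
  have h : z.1.1 <= esize z by rewrite !esize_pair esize_nat; lia.
  by rewrite leq_add2r leq_mul // leq_add2r leq_mul2l h orbT.
- by rewrite /grow /candidates /expand /indeg /hd; poly_auto.
- by poly_auto.
- by rewrite /deficient /indeg /hd; poly_auto.
Qed.

Lemma poly_step_state : poly (fun z : nat * seq item * state => step q z.1.1 z.1.2 z.2).
Proof.
pose Z : Type := (nat * seq item * state)%type.
have p1 : poly (fun z : Z => z.1.1) by poly_auto.
have p2 : poly (fun z : Z => z.2.1) by poly_auto.
have p3 : poly (fun z : Z => z.2.2) by poly_auto.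
have pps : poly (fun z : Z => exchanges z.2.1 z.1.2) by rewrite /exchanges; poly_auto.
have pts : poly (fun z : Z => tight z.2.2 (exchanges z.2.1 z.1.2)).
  apply: (@poly_comp2 _ _ _ _ _ _ _ _ tight) => //.
  by rewrite /tight /reduced_le /price /hd; poly_auto.
have pD : poly (fun z : Z => iter z.1.1 (grow q z.1.1 z.2.1 (tight z.2.2 (exchanges z.2.1 z.1.2)))
    (deficient q z.1.1 z.2.1)).
  exact: (poly_comp poly_grow (poly_pair (poly_pair p1 p2) pts)).
rewrite /step; move: pD; set D := (fun z : Z => iter _ _ _) => pD.
have pcs : poly (fun z : Z => candidates q z.2.1 (tight z.2.2 (exchanges z.2.1 z.1.2)) (D z)).
  apply: (@poly_comp3 _ _ _ _ _ _ _ _ _ _ (candidates q)) => //.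
  by rewrite /candidates /indeg /hd; poly_auto.
have pls : poly (fun z : Z => leaving (exchanges z.2.1 z.1.2) (D z)).
  apply: (@poly_comp2 _ _ _ _ _ _ _ _ leaving) => //.
  by rewrite /leaving /hd; poly_auto.
have pms : poly (fun z : Z => [seq p <- leaving (exchanges z.2.1 z.1.2) (D z)
    | all (slack_le z.2.2 p) (leaving (exchanges z.2.1 z.1.2) (D z))]).
  apply: (@poly_comp2 _ _ _ _ _ _ _ _ (fun y ls => [seq p <- ls | all (slack_le y p) ls])) => //.
  by rewrite /slack_le /gain /loss /price /hd; poly_auto.
apply: poly_if; first by rewrite /finished /indeg /hd; poly_auto.
  by poly_auto.
apply: poly_if; first exact: poly_nilp pcs.
  apply: poly_pair => //.
  have pr : poly (fun z : Z => (z.1.1, z.2.2)) by poly_auto.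
  have := @poly_comp3 _ _ _ _ _ _ _ _ _ _
    (fun x D p => raise x.1 x.2 D (head pair0 p)) _ _ _ _ pr pD pms.
  apply; rewrite /raise /gain /loss /price /hd; poly_auto.
apply: poly_pair => //.
apply: poly_pivot => //.
- by poly_auto.
- by poly_auto.
Qed.

Definition prices_bounded (n b : nat) (y : seq (seq bool)) : Prop :=
  size y <= n /\ forall v, size (price y v) <= b.

Lemma esize_prices n b y : prices_bounded n b y -> esize y <= n * (4 * b + 2) + 1.
Proof.
move=> [h1 h2]; apply: leq_trans (@esize_seq_le _ _ y (4 * b + 1) _) _.
  move=> i hi x; apply: leq_trans (esize_bits _) _; rewrite (set_nth_default [::]) //.
  by have := h2 i; rewrite /price; lia.
by rewrite leq_add2r -addnS leq_mul.
Qed.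

Lemma size_weight (f : item) : size f.2 <= esize f.
Proof. by apply: leq_trans (leq_size_esize _) _; rewrite esize_pair; lia. Qed.

(** [gain] and [loss] have at most [b.+1] bits, and adding one of them to a price costs one bit
    more. *)
Lemma step_bounded k m b n E (st : state) : rows_bounded k m st.1 -> prices_bounded n b st.2 ->
  (forall f, f \in E -> esize f <= m) -> 4 * n + 1 <= m -> m <= b ->
  rows_bounded k m (step q n E st).1 /\ prices_bounded n b.+2 (step q n E st).2.
Proof.
move=> hr hy hE hn hm; have hy2 : prices_bounded n b.+2 st.2.
  by case: hy => h1 h2; split=> // v; have := h2 v; lia.
rewrite /step; case: ifP => // _; set D := iter _ _ _; set cs := candidates _ _ _ _.
case: ifPn => [_|/(head_mem pair0)]; last first.
  case: (head pair0 cs) => r f; rewrite !mem_filter mem_exchanges => /and5P[_ _ h1 h2 _].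
  by split=> //=; apply: pivot_bounded => //; apply: hE.
set ms := filter _ _; split=> //=.
have hp : size (head pair0 ms).1.1.2 <= b /\ size (head pair0 ms).2.2 <= b.
  case nms: (nilp ms); first by move: nms; case: (ms).
  have := head_mem pair0 (negbT nms).
  case: (head pair0 ms) => r f; rewrite !mem_filter mem_exchanges => /and5P[_ _ h1 h2 _].
  split; apply: leq_trans (size_weight _) _; apply: leq_trans hm.
    by have [_ /(_ r h1)[]] := hr.
  exact: hE.
have [hp1 hp2] := hp; have [hy3 hy4] := hy.
split; first by rewrite size_map size_iota.
move=> v; rewrite /price; case: (ltnP v n) => vn; last by rewrite nth_default // size_map size_iota.
rewrite (nth_map 0) ?size_iota // size_badd nth_iota // ltnS geq_max.
apply/andP; split; first by have := hy4 v; rewrite /price add0n; lia.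
by case: ifP => _; rewrite size_badd ltnS geq_max hy4 ?hp1 ?hp2.
Qed.

Lemma poly_run : poly (fun a : nat * seq item => run q a.1 a.2).
Proof.
rewrite /run.
(* [N] bounds the number of steps; after [i] steps a price has at most [2 * esize a + 2 * i]
   bits. *)
pose N n := (n + 1) * (n + n + 2).
apply: (@poly_iter _ _ _ _ (fun a : nat * seq item => step q a.1 a.2)
  (fun a => a.1.+1 * a.1.*2.+2) _
  (fun n => 2 * n * (2 * n + 2 * n + 2) + 1 + (n * (4 * (2 * n + 2 * N n) + 2) + 1) + 1)).
- by rewrite /N; pb.
- move=> a i hi; have [h1 h2] := esize_env a.
  have hn : a.1 <= esize a by rewrite esize_pair esize_nat; lia.
  have [hr hy] : let st := iter i (step q a.1 a.2) (max_tree a.1 a.2, [::]) in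
      rows_bounded (2 * esize a) (2 * esize a) st.1 /\
      prices_bounded a.1 (2 * esize a + 2 * i) st.2.
    elim: (i) => [|j [ih1 ih2]].
      split; first exact: max_tree_bounded.
      by split=> // v; rewrite /price nth_nil.
    rewrite iterS mulnSr addnA addn2; apply: step_bounded => //; last exact: leq_addr.
    by move=> f fE; apply: leq_trans (ltnW (esize_mem fE)) h2.
  rewrite [leqLHS]esize_pair [X in _ < X]addn1 ltnS leq_add //; first exact: esize_rows hr.
  apply: leq_trans (esize_prices hy) _; rewrite leq_add2r leq_mul //.
  rewrite leq_add2r leq_mul2l /= leq_add2l leq_mul2l /=; apply: leq_trans hi _.
  by rewrite /N addn1 addn2 -addnn leq_mul // !ltnS leq_add.
- exact: poly_step_state.
- apply: (@poly_enc _ _ _ _ _ _ (fun a : nat * seq item => a.1.+1 * (a.1 + a.1).+2)).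
    by move=> a; rewrite addnn.
  by poly_auto.
- by apply: poly_pair; [exact: poly_max_tree | exact: poly_const].
Qed.

End Step.

(** * Polytrees and cuts *)

Section Polytree.
Variable V : finType.
Implicit Types (A : {set V * V}) (a b : V * V) (X : V -> bool).

Definition cut_independent A : Prop :=
  forall a, a \in A -> exists X, forall b, b \in A -> X b.1 (+) X b.2 = (b == a).

Lemma underlying_sym A : symmetric (underlying A).
Proof. by move=> x y; rewrite /underlying orbC. Qed.

(** The cut of [(u, v)] is the component of [u] once this arc is removed. If it contained [v], a
    path from [u] to [v] would close a cycle. *)
Lemma polytree_cut_independent A : polytree A -> cut_independent A.
Proof.
move=> [anti acyc] [u v] uvA; pose e' := underlying (A :\ (u, v)).
have sym' : connect_sym e' by apply: sym_connect_sym; exact: underlying_sym.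
exists (connect e' u) => -[x y] xyA /=; case: eqVneq => [[-> ->]|ne].
  rewrite connect0 /=; apply/negP => /connectP[p0 hp0 ev].
  case/shortenP: hp0 ev => p hp up _ ev.
  apply: (acyc (u :: p)).
    (* A path of length one would consist of the opposite arc [(v, u)], so the cycle has at least
       three vertices. *)
    case: p hp up ev => [_ _ e|w [|w' p]] //=; first by move: uvA (anti _ _ uvA); rewrite e /= => ->.
    move=> + _ e; rewrite -e andbT /e' /underlying !inE eqxx /=.
    by case/andP=> _ h; have := anti _ _ uvA; rewrite h.
  rewrite /ucycle up andbT /= rcons_path -ev; apply/andP; split.
    by apply: sub_path hp => x' y'; rewrite /e' /underlying !inE => /orP[]/andP[_ ->]; rewrite ?orbT.
  by rewrite /underlying uvA orbT.
have exy : e' x y by rewrite /e' /underlying !inE ne xyA.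
by rewrite (same_connect_r sym' (connect1 exy)) addbb.
Qed.

(** A cut cannot be crossed by just one arc of a cycle: walking around the rest of the cycle, one
    stays on the same side. *)
Lemma cut_independent_polytree A : cut_independent A -> polytree A.
Proof.
move=> ind; split.
  move=> u v uvA; apply/negP => vuA; have [X hX] := ind _ uvA.
  have := hX _ uvA; have := hX _ vuA; rewrite /= eqxx addbC => -> /eqP [eu ev].
  by have := hX _ uvA; rewrite /= eu addbb eqxx.
case=> [|x [|y [|z s]]] // _ /andP[/=]; set e := underlying A.
case/and3P=> exy eyz hp /andP[xs /andP[ys us]].
have [a aA axy] : exists2 a, a \in A & (a == (x, y)) || (a == (y, x)).
  by case/orP: exy => h; [exists (x, y) | exists (y, x)]; rewrite ?eqxx ?orbT.
have [X hX] := ind _ aA.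
(* Of the edges of the cycle only the one between [x] and [y] crosses; the side conditions exclude
   it. *)
have step p q : e p q -> p != x -> (p != y) || (q != x) -> X p = X q.
  move=> epq px hpq.
  have [b bA bpq] : exists2 b, b \in A & (b == (p, q)) || (b == (q, p)).
    by case/orP: epq => h; [exists (p, q) | exists (q, p)]; rewrite ?eqxx ?orbT.
  have ne : b != a.
    apply: contraNneq px => e'; move: axy bpq hpq; rewrite e'.
    by case/orP=> /eqP-> /orP[]/eqP[-> ->]; rewrite ?eqxx.
  have := hX _ bA; rewrite (negbTE ne).
  by case/orP: bpq => /eqP-> /=; case: (X p); case: (X q).
have walk p t : path e p t -> x \notin belast p t -> y \notin belast p t -> X p = X (last p t).
  elim: t p => //= q t ih p /andP[epq hp'].
  rewrite !inE !negb_or => /andP[xp xt] /andP[yp yt].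
  by rewrite (step _ _ epq) 1?eq_sym // ?[p == y]eq_sym ?yp // (ih q).
have neq : z != x by apply: contraNneq xs => <-; rewrite !inE eqxx orbT.
have eX : X y = X x.
  rewrite (step y z) //; last by rewrite neq orbT.
    rewrite (walk z (rcons s x)) ?last_rcons //= belast_rcons.
      by move: xs; rewrite inE negb_or => /andP[].
    exact: ys.
  by apply: contraNneq xs => <-; rewrite inE eqxx.
have := hX _ aA; rewrite eqxx.
by case/orP: axy => /eqP-> /=; rewrite eX addbb.
Qed.

End Polytree.

(** * The items of an instance *)

(** The order is that of the weights in the encoding, so that arcs and words match by position. *)
Definition arcs (n : nat) : seq (nat * nat) :=
  [seq (u, v) | v <- iota 0 n, u <- [seq u <- iota 0 n | u != v]].

Definition items (n : nat) (ws : seq (seq bool)) : seq item :=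
  [seq (nth (0, 0) (arcs n) i, nth [::] ws i) | i <- iota 0 (size ws)].

Lemma mem_arcs n u v : ((u, v) \in arcs n) = [&& u < n, v < n & u != v].
Proof.
apply/allpairsPdep/and3P => [[v' [u' []]]|[un vn ne]].
  by rewrite mem_filter !mem_iota => /andP[_ ?] /and3P[? _ ?] [-> ->].
by exists v, u; rewrite mem_filter !mem_iota un vn ne.
Qed.

Lemma uniq_arcs n : uniq (arcs n).
Proof.
apply: allpairs_uniq_dep; first exact: iota_uniq.
  by move=> v _; rewrite filter_uniq ?iota_uniq.
by move=> [v u] [v' u'] _ _ /= [-> ->].
Qed.

Lemma size_arcs n : size (arcs n) = n * n.-1.
Proof.
have h : {in iota 0 n, (fun v => size [seq u <- iota 0 n | u != v]) =1 fun=> n.-1}.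
  move=> v; rewrite mem_iota => /andP[_ vn] /=.
  have := count_predC (pred1 v) (iota 0 n); rewrite size_iota size_filter.
  by rewrite count_uniq_mem ?iota_uniq // mem_iota leq0n vn => h; rewrite -[in RHS]h.
rewrite size_allpairs_dep; move/eq_in_map: h => ->.
by rewrite sumnE big_map big_const_seq count_predT size_iota iter_addn_0 mulnC.
Qed.

Lemma items_map n (g : nat * nat -> seq bool) :
  items n (map g (arcs n)) = [seq (a, g a) | a <- arcs n].
Proof.
rewrite /items size_map -[in RHS](mkseq_nth (0, 0) (arcs n)) /mkseq -map_comp.
apply/eq_in_map => i; rewrite mem_iota => /andP[_ hi] /=.
by rewrite (nth_map (0, 0)).
Qed.

(** * From numbered items to digraphs on [V] *)

Section Link.
Variables (V : finType) (f : V -> {set V} -> nat) (x0 : V).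
Hypothesis additive : additive_scores f.

Let n := #|V|.
Let vtx (i : nat) : V := nth x0 (enum V) i.
Let rk (v : V) : nat := index v (enum V).
Let g (a : nat * nat) : seq bool := binary (f (vtx a.2) [set vtx a.1]).
Let E : seq item := [seq (a, g a) | a <- arcs n].

Lemma rk_lt v : rk v < n.
Proof. by rewrite /n cardE index_mem mem_enum. Qed.

Lemma rkK v : vtx (rk v) = v.
Proof. by rewrite /vtx nth_index // mem_enum. Qed.

Lemma vtxK i : i < n -> rk (vtx i) = i.
Proof. by move=> h; rewrite /rk index_uniq ?enum_uniq // -cardE. Qed.

Lemma enum_vtx : enum V = map vtx (iota 0 n).
Proof. by rewrite /n cardE -/(mkseq vtx _) mkseq_nth. Qed.

Lemma E_P h : h \in E -> [/\ tl h < n, hd h < n, tl h != hd h & h.2 = g h.1].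
Proof. by case/mapP=> -[u v]; rewrite mem_arcs => /and3P[h1 h2 h3] ->. Qed.

Lemma mem_E u v : u < n -> v < n -> u != v -> ((u, v), g (u, v)) \in E.
Proof. by move=> h1 h2 h3; apply/mapP; exists (u, v); rewrite // mem_arcs h1 h2 h3. Qed.

Lemma link_lt h : h \in E -> [/\ tl h < n, hd h < n & tl h != hd h].
Proof. by case/E_P. Qed.

Lemma link_ex u v : u < n -> v < n -> u != v -> exists2 h : item, h \in E & h.1 = (u, v).
Proof. by move=> h1 h2 h3; exists ((u, v), g (u, v)) => //; apply: mem_E. Qed.

Lemma link_inj : {in E &, injective fst}.
Proof.
move=> h h' /E_P[_ _ _ e1] /E_P[_ _ _ e2] e.
by rewrite [h]surjective_pairing [h']surjective_pairing e1 e2 e.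
Qed.

Lemma link_uniq : uniq E.
Proof. by rewrite map_inj_uniq ?uniq_arcs // => a b []. Qed.

Definition ends (h : item) : V * V := (vtx (tl h), vtx (hd h)).

Lemma ends_inj : {in E &, injective ends}.
Proof.
move=> h h' hE hE' [e1 e2]; apply: link_inj => //.
have [h1 h2 _] := link_lt hE; have [h3 h4 _] := link_lt hE'.
rewrite [h.1]surjective_pairing [h'.1]surjective_pairing.
by move: (congr1 rk e1) (congr1 rk e2); rewrite !vtxK // /tl /hd => -> ->.
Qed.

Definition arc_set (s : seq item) : {set V * V} := [set a in map ends s].

Section ArcSet.
Variable s : seq item.
Hypotheses (us : uniq s) (sE : {subset s <= E}).

Lemma sum_arc_set (F : V -> V -> nat) :
  \sum_(h <- s) F (vtx (tl h)) (vtx (hd h)) =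
  \sum_v \sum_(u in parents (arc_set s) v) F u v.
Proof.
rewrite -(big_map ends xpredT (fun a => F a.1 a.2)).
rewrite (perm_big (enum (arc_set s))); last first.
  apply: uniq_perm; [|exact: enum_uniq|by move=> a; rewrite mem_enum inE].
  by rewrite map_inj_in_uniq // => h h' /sE ? /sE ?; apply: ends_inj.
rewrite big_enum /= [RHS](exchange_big_dep xpredT) //= pair_big_dep /=.
by apply: eq_bigl => -[u v]; rewrite /= !inE.
Qed.

Lemma arc_set_parents v : \sum_(h <- s) (hd h == rk v) = #|parents (arc_set s) v|.
Proof.
have -> : \sum_(h <- s) (hd h == rk v) = \sum_(h <- s) (vtx (hd h) == v).
  apply: eq_big_seq => h /sE hE; congr nat_of_bool; have [_ h1 _] := link_lt hE.
  by apply/eqP/eqP => [->|<-]; rewrite ?rkK ?vtxK.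
rewrite (sum_arc_set (fun _ v' => v' == v)) (bigD1 v) //= eqxx sum1_card big1 ?addn0 //.
by move=> u ne; rewrite big1 // (negbTE ne).
Qed.

(** Without loops a parent set does not contain its vertex, so additivity applies to it. *)
Lemma arc_set_score : (forall v, (v, v) \notin arc_set s) ->
  \sum_(h <- s) bval h.2 = score f (arc_set s).
Proof.
move=> loopless; rewrite (eq_big_seq (fun h => f (vtx (hd h)) [set vtx (tl h)])); last first.
  by move=> h /sE /E_P[_ _ _ ->]; rewrite /g bval_binary.
rewrite (sum_arc_set (fun u v => f v [set u])); apply: eq_bigr => v _.
by rewrite -additive // inE.
Qed.

Lemma arc_set_independent : independent s -> cut_independent (arc_set s).
Proof.
move=> ind _ /[1!inE] /mapP[h hs ->]; have [X hX] := ind h hs.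
exists (fun v => X (rk v)) => b; rewrite inE => /mapP[h' hs' ->].
have [h1 h2 _] := link_lt (sE hs'); rewrite /= !vtxK // -/(crossing X h') hX //.
by apply/eqP/eqP => [->//|]; apply: ends_inj; apply: sE.
Qed.

Lemma independent_arc_set : cut_independent (arc_set s) -> independent s.
Proof.
move=> ind h hs; have [|X hX] := ind (ends h); first by rewrite inE map_f.
exists (fun i => X (vtx i)) => h' hs'; rewrite /crossing.
rewrite (hX (ends h')) ?inE ?map_f //.
by apply/eqP/eqP => [|->//]; apply: ends_inj; apply: sE.
Qed.

End ArcSet.

Lemma arc_set_of (A : {set V * V}) : (forall v, (v, v) \notin A) ->
  arc_set [seq h <- E | ends h \in A] = A.
Proof.
move=> loopless; apply/setP => -[u v]; rewrite inE; apply/mapP/idP.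
  by case=> h; rewrite mem_filter => /andP[hA _] ->.
move=> uvA; exists ((rk u, rk v), g (rk u, rk v)); last by rewrite /ends /tl /hd /= !rkK.
rewrite mem_filter /ends /tl /hd /= !rkK uvA mem_E ?rk_lt //.
apply/eqP => e; have := loopless u; rewrite -{2}[u]rkK e rkK uvA.
by [].
Qed.

Lemma polytree_loopless (A : {set V * V}) : polytree A -> forall v, (v, v) \notin A.
Proof. by case=> anti _ v; apply/negP => h; have := anti _ _ h; rewrite h. Qed.

Lemma run_score_max q (A : {set V * V}) : 0 < q -> polytree A ->
  (forall v, #|parents A v| <= q) ->
  score f A <= \sum_(r <- (run q n E).1) bval r.1.2.
Proof.
move=> q0 pA dA; have n0 : 0 < n by apply/card_gt0P; exists x0.
have loopless := polytree_loopless pA.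
pose s := [seq h <- E | ends h \in A].
have us : uniq s by rewrite filter_uniq // link_uniq.
have sE : {subset s <= E} by move=> h; rewrite mem_filter => /andP[].
have eA : arc_set s = A by apply: arc_set_of.
rewrite -eA -arc_set_score ?eA //.
apply: (run_max q0 n0 link_lt link_ex link_inj link_uniq us sE).
  by apply: independent_arc_set => //; rewrite eA; apply: polytree_cut_independent.
by move=> v vn; rewrite -(vtxK vn) arc_set_parents // eA.
Qed.

Lemma run_score_attained q : 0 < q -> exists A : {set V * V},
  [/\ polytree A, forall v, #|parents A v| <= q
    & score f A = \sum_(r <- (run q n E).1) bval r.1.2].
Proof.
move=> q0; have n0 : 0 < n by apply/card_gt0P; exists x0.
have [inv fin] := run_finished q0 n0 link_lt link_ex link_inj link_uniq.
have tr := inv_tree inv; set rows := (run q n E).1 in tr *.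
pose s := map fst rows; have us : uniq s := tree_uniq tr.
have sE : {subset s <= E} by move=> _ /mapP[r hr ->]; apply: (tree_sub tr).
have pA : polytree (arc_set s).
  apply: cut_independent_polytree; apply: arc_set_independent => // _ /mapP[r hr ->].
  exists (nth false r.2) => _ /mapP[r' hr' ->].
  by rewrite -[LHS]/(cross r.2 r'.1) (tree_dual tr) // eq_sym.
exists (arc_set s); split=> //.
  move=> v; rewrite -arc_set_parents // big_map -indegE.
  by move/allP: fin => /(_ (rk v)); apply; rewrite mem_iota rk_lt.
by rewrite -arc_set_score ?big_map //; apply: polytree_loopless.
Qed.

Lemma words_map : [seq binary (f v [set x]) | v <- enum V, x <- [seq y <- enum V | y != v]] =
  map g (arcs n).
Proof.
rewrite /arcs map_flatten enum_vtx -!map_comp; congr flatten.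
apply/eq_in_map => v; rewrite mem_iota => /andP[_ vn] /=.
rewrite filter_map -!map_comp; congr map; apply/eq_in_filter => u.
rewrite mem_iota => /andP[_ un] /=; congr negb.
by apply/eqP/eqP => [e|-> //]; rewrite -(vtxK un) e vtxK.
Qed.

End Link.

(** * The decision procedure *)

(** Reading from the right, a terminator opens a new word and a bit is put in front of the current
    one. *)
Definition word_step (acc : seq (seq bool)) (x : letter) : seq (seq bool) :=
  if isSome x then (odflt false x :: head [::] acc) :: behead acc else [::] :: acc.

Definition words (s : seq letter) : seq (seq bool) := foldl word_step [::] (rev s).

Lemma words_encode (ws : seq (seq bool)) :
  words (flatten [seq rcons (map Some w) None | w <- ws]) = ws.
Proof.
rewrite /words foldl_rev; elim: ws => //= w ws ih; rewrite foldr_cat ih foldr_rcons.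
by elim: w => //= b w ->.
Qed.

Lemma poly_words : poly words.
Proof.
apply: (@poly_foldl _ _ _ _ _ _ dflt (fun _ => word_step) _ _ (fun n => 6 * n + 1)).
- by pb.
- move=> s i.
  have h t acc : esize (foldl word_step acc t) <= 6 * size t + esize acc.
    elim: t acc => //= x t ih acc; apply: leq_trans (ih _) _.
    rewrite /word_step; case: x => [b|] /=; last by rewrite esize_cons esize_nil; lia.
    pose proof (esize_bool b).
    by case: acc => [|w acc] /=; rewrite !esize_cons ?esize_nil; lia.
  apply: leq_trans (h _ _) _; rewrite leq_add2r leq_mul2l /=.
  apply: leq_trans (leq_size_esize _) _; apply: leq_trans (esize_take _ _) _.
  by rewrite esize_rev.
- by rewrite /word_step; poly_auto.
- by poly_auto.
- exact: poly_const.
Qed.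

(* With [m = n * (n - 1)] weights there are [n] vertices; [m = 0] yields [1]. *)
Definition num_vertices (m : nat) : nat :=
  (head 0 [seq k <- iota 0 m.+1 | k.+1 * k == m]).+1.

Lemma num_verticesE n : 0 < n -> num_vertices (n * n.-1) = n.
Proof.
case: n => // k _; rewrite /num_vertices -[k.+1.-1]/k; set ks := filter _ _; congr _.+1.
have hk : k \in ks by rewrite mem_filter eqxx mem_iota leq0n; apply: leq_pmull.
have : head 0 ks \in ks by apply: head_mem; case: (ks) hk.
rewrite mem_filter => /andP[/eqP h _]; move: (head 0 ks) h => k' h.
by case: (ltngtP k' k) => // lt; have := ltn_mul lt lt; move: h; rewrite !mulSn; lia.
Qed.

Definition total (rows : seq row) : seq bool := foldl (fun s (r : row) => badd s r.1.2) [::] rows.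

Lemma bval_total rows : bval (total rows) = \sum_(r <- rows) bval r.1.2.
Proof.
have h s : bval (foldl (fun s (r : row) => badd s r.1.2) s rows) =
    bval s + \sum_(r <- rows) bval r.1.2.
  elim: rows s => [|r rows ih] s /=; first by rewrite big_nil addn0.
  by rewrite ih big_cons bval_badd addnA.
exact: h.
Qed.

Lemma poly_total : poly total.
Proof.
apply: (@poly_foldl _ _ _ _ _ _ dflt (fun _ s (r : row) => badd s r.1.2) _ _
  (fun n => 4 * (2 * n) + 1)).
- by pb.
- move=> rows i; apply: leq_trans (esize_bits _) _; rewrite leq_add2r leq_mul2l /=.
  have h t (s : seq bool) : size s <= esize rows -> {subset t <= rows} ->
      size (foldl (fun s (r : row) => badd s r.1.2) s t) <= esize rows + size t.
    (* [k] counts the additions already made, each of which may cost one bit. *)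
    have : size s <= esize rows + 0 -> {subset t <= rows} ->
        size (foldl (fun s (r : row) => badd s r.1.2) s t) <= esize rows + (0 + size t).
      elim: t s 0 => [|r t ih] s k hs ht /=; first by rewrite addn0.
      rewrite -addSnnS; apply: ih; last by move=> r' hr'; apply: ht; rewrite inE hr' orbT.
      rewrite size_badd addnS ltnS geq_max hs /=.
      have hr : r \in rows by apply: ht; rewrite mem_head.
      apply: leq_trans (size_weight _) _; apply: leq_trans _ (leq_addr _ _).
      by apply: leq_trans (ltnW (esize_mem hr)); rewrite [leqRHS]esize_pair leqW ?leq_addr.
    by rewrite addn0 add0n.
  apply: leq_trans (h _ _ _ _) _ => //; first by move=> r /mem_take.
  rewrite mul2n -addnn leq_add2l; apply: leq_trans (esize_take _ i).
  exact: leq_size_esize.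
- by poly_auto.
- by poly_auto.
- exact: poly_const.
Qed.

(** Word [0] is [l] with its sign bit first, word [2] is the number of vertices, and the weights
    start at word [3]; counting them yields the number of vertices in unary. For [c = 0] only the
    arcless digraph is feasible, and for [c < 0] nothing is unless there are no vertices. *)
Definition decide (c : int) (s : seq letter) : bool :=
  let ws := words s in
  let l := nth [::] ws 0 in
  let le_l S := head false l || ble (behead l) S in
  match c with
  | Posz q.+1 =>
      let n := num_vertices (size (drop 3 ws)) in
      le_l (total (run q.+1 n (items n (drop 3 ws))).1)
  | Posz 0 => le_l [::]
  | Negz _ => ble (nth [::] ws 2) [::] && le_l [::]
  end.

Lemma poly_decide c : poly (decide c).
Proof.
have pw := poly_words.
have pl0 : poly (fun s => head false (nth [::] (words s) 0)) by poly_auto; apply: pw.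
have pl1 : poly (fun s => behead (nth [::] (words s) 0)) by poly_auto; apply: pw.
have pl2 : poly (fun s => nth [::] (words s) 2) by poly_auto; apply: pw.
have pws : poly (fun s => drop 3 (words s)) by poly_auto; apply: pw.
rewrite /decide; case: c => [[|q]|k]; try by poly_auto.
apply: poly_orb => //; apply: poly_ble => //.
pose h (ws : seq (seq bool)) := total (run q.+1 (num_vertices (size ws))
  (items (num_vertices (size ws)) ws)).1.
apply: (@poly_comp _ _ _ _ _ _ h) => //.
have pn : poly (fun ws : seq (seq bool) => num_vertices (size ws)).
  by rewrite /num_vertices; poly_auto.
have parcs : poly arcs by rewrite /arcs; poly_auto.
have pit : poly (fun ws => items (num_vertices (size ws)) ws).
  apply: (@poly_comp2 _ _ _ _ _ _ _ _ items) => //; last exact: poly_id.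
  rewrite /items.
  have pa : poly (fun p : nat * seq (seq bool) => (arcs p.1, p.2)).
    by apply: poly_pair; [apply: (poly_comp parcs) |]; poly_auto.
  apply: (@poly_comp _ _ _ _ _ _ (fun p : seq (nat * nat) * seq (seq bool) =>
    [seq (nth (0, 0) p.1 i, nth [::] p.2 i) | i <- iota 0 (size p.2)])) pa.
  by poly_auto.
apply: (poly_comp poly_total); apply: poly_fst.
exact: (poly_comp (poly_run q.+1) (poly_pair pn pit)).
Qed.

Lemma int_le_nat (l : int) (S : nat) : (l <= Posz S)%R = (l < 0)%R || (`|l|%N <= S).
Proof. by lia. Qed.

Lemma polytree_set0 (V : finType) : polytree (set0 : {set V * V}).
Proof. by apply: cut_independent_polytree => a; rewrite inE. Qed.

Lemma parents_set0 (V : finType) (v : V) : parents set0 v = set0.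
Proof. by apply/setP => u; rewrite !inE. Qed.

Lemma score_no_parents (V : finType) (f : V -> {set V} -> nat) (A : {set V * V}) :
  additive_scores f -> (forall v, parents A v = set0) -> score f A = 0.
Proof.
by move=> add h; apply: big1 => v _; rewrite h add ?inE // big_set0.
Qed.

Lemma decideE c I : decide c (PL_encode I) =
  match c with
  | Posz q.+1 =>
      let ws := drop 3 (PL_words I) in let n := num_vertices (size ws) in
      (pl_l I <= Posz (\sum_(r <- (run q.+1 n (items n ws)).1) bval r.1.2))%R
  | Posz 0 => (pl_l I <= 0)%R
  | Negz _ => (#|pl_V I| == 0) && (pl_l I <= 0)%R
  end.
Proof.
rewrite /decide /PL_encode words_encode.
have h S : head false (nth [::] (PL_words I) 0) || ble (behead (nth [::] (PL_words I) 0)) S =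
    (pl_l I <= Posz (bval S))%R.
  by rewrite bleE (bval_binary `|pl_l I|%N) int_le_nat.
case: c => [[|q]|k].
- exact: h.
- by rewrite h bval_total.
- by rewrite h bleE (bval_binary #|pl_V I|) leqn0.
Qed.

Lemma decide_correct c I : pl_q I = c -> decide c (PL_encode I) <-> PL_yes I.
Proof.
rewrite decideE; case: I => V f l q add; rewrite -[pl_q _]/q => ->.
rewrite -[pl_l _]/l -[pl_V _]/V; case: c => [[|k]|k].
- split=> [l0|[A [_ dA]]].
    exists set0 => /=; split; first exact: polytree_set0.
      by move=> v; rewrite parents_set0 cards0.
    by rewrite score_no_parents // => v; apply: parents_set0.
  rewrite (score_no_parents add) // => v; apply/eqP; rewrite -cards_eq0.
  by have := dA v; rewrite /= lez_nat leqn0.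
- cbv zeta; have [V0|Vn0] := posnP #|V|.
    have eV : enum V = [::] by apply/nilP; rewrite /nilp -cardE V0.
    have -> : drop 3 (PL_words (PLInstance l k.+1 add)) = [::] by rewrite /PL_words /= eV.
    (* Without vertices there are no weights, which is read as one vertex; the run then gives the
       tree without arcs, of score [0]. *)
    rewrite -[num_vertices _]/1; set E := items _ _; have E0 : E = [::] by [].
    have [||||||inv _] := @run_finished k.+1 1 E; rewrite ?E0 //.
      by case=> // -[].
    have := tree_size (inv_tree inv); rewrite -E0 => /size0nil ->; rewrite big_nil.
    have noV (v : V) : False by have := fintype0 v V0.
    split=> [l0|[A [_ _]]]; last by rewrite (score_no_parents add) // => v.
    exists set0 => /=; split; [exact: polytree_set0 | by move=> v; have := noV v |].
    by rewrite score_no_parents // => v; have := noV v.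
  have [x0 _] := card_gt0P Vn0.
  have -> : drop 3 (PL_words (PLInstance l k.+1 add)) =
      map (fun a => binary (f (nth x0 (enum V) a.2) [set nth x0 (enum V) a.1])) (arcs #|V|).
    rewrite -[LHS]/(drop 0 _) drop0; exact: (words_map f x0).
  rewrite size_map size_arcs num_verticesE // items_map.
  split=> [hl|[A [pA dA hl]]].
    have [A [pA dA eA]] := run_score_attained x0 add (ltn0Sn k).
    by exists A; split=> //; rewrite eA.
  by apply: le_trans hl _; rewrite lez_nat; apply: run_score_max.
- split=> [/andP[/eqP V0 l0]|[A [_ dA hl]]].
    have noV (v : V) : False by have := fintype0 v V0.
    exists set0 => /=; split; [exact: polytree_set0 | by move=> v; have := noV v |].
    by rewrite score_no_parents // => v; have := noV v.
  have noV (v : V) : False by have := dA v.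
  rewrite (score_no_parents add) in hl; last by move=> v; have := noV v.
  by rewrite hl andbT; apply/pred0P => v; have := noV v.
Qed.

Theorem theorem11 (c : int) :
  solvable_in_polynomial_time PL_encode (fun I => pl_q I = c) PL_yes.
Proof. exact: poly_solvable (poly_decide c) (@decide_correct c). Qed.
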